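(* For every locally compact group $G$, \[ \Lambda(\mathsf{LUC}(G)^\ast)=\Lambda^{\mathsf{CBP}}(\mathsf{LUC}(G)^\ast)=\mathbf{M}_t(G). \]
   Context: All topological spaces and groups are Hausdorff; all linear spaces are over $\mathbb{R}$ and all functions and functionals are real-valued. Let $G$ be a topological group. A pseudometric $\Delta$ on $G$ is right-invariant if $\Delta(x,y)=\Delta(xz,yz)$ for all $x,y,z\in G$. The right uniformity on $G$ is the uniformity induced by the set of all right-invariant continuous pseudometrics on $G$. $\mathsf{LUC}(G)$ is the space of bounded real-valued functions on $G$ that are uniformly continuous with respect to the right uniformity, with the supremum norm, and $\mathsf{LUC}(G)^\ast$ is its norm dual. The weak$^\ast$ topology on $\mathsf{LUC}(G)^\ast$ is the topology of pointwise convergence on $\mathsf{LUC}(G)$; subsets $S$ of $\mathsf{LUC}(G)^\ast$ carry the relative weak$^\ast$ topology. Convolution on $\mathsf{LUC}(G)^\ast$ is defined by $(\mathfrak{m}\star\mathfrak{n})(f)=\mathfrak{m}\big(x\mapsto \mathfrak{n}(y\mapsto f(xy))\big)$ for $\mathfrak{m},\mathfrak{n}\in\mathsf{LUC}(G)^\ast$, $f\in\mathsf{LUC}(G)$. $\mathbf{M}_t(G)$ is the space of finite signed Radon measures on $G$, regarded as a subset of $\mathsf{LUC}(G)^\ast$ by identifying $\mu$ with the functional $f\mapsto\int f\,d\mu$, $f\in\mathsf{LUC}(G)$. A subset $B$ of a topological space $K$ has the Baire property in $K$ if it differs from some open set by a meager set (the symmetric difference is meager in $K$). A subset $A$ of a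 topological space $X$ is a CBP set if for every compact (Hausdorff) space $K$ and every continuous mapping $\varphi\colon K\to X$ the set $\varphi^{-1}(A)$ has the Baire property in $K$. A function $h\colon X\to\mathbb{R}$ is CBP measurable if $h^{-1}(U)$ is a CBP set in $X$ for every open $U\subseteq\mathbb{R}$. For $S\subseteq\mathsf{LUC}(G)^\ast$: - $\Lambda(S)$ is the set of all $\mathfrak{m}\in S$ such that for every $f\in\mathsf{LUC}(G)$ the function $\mathfrak{n}\mapsto(\mathfrak{m}\star\mathfrak{n})(f)$ is weak$^\ast$ continuous on $S$; - $\Lambda^{\mathsf{CBP}}(S)$ is the set of all $\mathfrak{m}\in S$ such that for every $f\in\mathsf{LUC}(G)$ the function $\mathfrak{n}\mapsto(\mathfrak{m}\star\mathfrak{n})(f)$ is CBP measurable on $S$ with the weak$^\ast$ topology. *)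

(* Defs.v *)
From HB Require Import structures.
From mathcomp Require Import all_boot all_order all_algebra.
From mathcomp Require Import all_classical all_reals all_analysis.

Set Implicit Arguments.
Unset Strict Implicit.
Unset Printing Implicit Defensive.

Import Order.TTheory GRing.Theory Num.Theory.
Import numFieldNormedType.Exports.

Local Open Scope classical_set_scope.
Local Open Scope ring_scope.

(* Hausdorffness is not built in: it is a hypothesis of the statement. *)
HB.mixin Record isTopologicalGroup G & Topological G & Group G := {
  mulg_continuous : continuous (fun p : G * G => (p.1 * p.2)%g) ;
  invg_continuous : continuous (fun x : G => (x^-1)%g)
}.

#[short(type="topologicalGroupType")]
HB.structure Definition TopologicalGroup :=
  {G of Topological G & Group G & isTopologicalGroup G}.

(* G with its right uniformity instead of its given topology. The phantom R is
   the range of the pseudometrics that generate the uniformity. *)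
Definition right_uniform_group (R : realType) (G : topologicalGroupType) : Type
  := G.

Section right_uniformity.
Variables (R : realType) (G : topologicalGroupType).

Record pseudometric (d : G -> G -> R) : Prop := Pseudometric {
  pseudometric_ge0 : forall x y, 0 <= d x y ;
  pseudometricxx : forall x, d x x = 0 ;
  pseudometric_sym : forall x y, d x y = d y x ;
  pseudometric_triangle : forall y x z, d x z <= d x y + d y z
}.

Definition right_invariant (d : G -> G -> R) :=
  forall x y z, d x y = d (x * z)%g (y * z)%g.

Definition continuous_right_pseudometric (d : G -> G -> R) : Prop :=
  [/\ pseudometric d, right_invariant d &
      continuous (fun p : G * G => d p.1 p.2)].

Definition right_entourage : set_system (G * G) :=
  smallest (@Filter (G * G)%type)
    [set [set p | d p.1 p.2 < e] | d in continuous_right_pseudometric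
                                 & e in [set e : R | 0 < e]].

Global Instance right_entourage_filter : Filter right_entourage.
Proof. exact: smallest_filter_filter. Qed.

Lemma zero_pseudometric : continuous_right_pseudometric (fun _ _ => 0).
Proof. by split; [split=> //= *; rewrite addr0|by []|exact: cst_continuous]. Qed.

Lemma max_pseudometric d1 d2 :
  continuous_right_pseudometric d1 -> continuous_right_pseudometric d2 ->
  continuous_right_pseudometric (fun x y => Num.max (d1 x y) (d2 x y)).
Proof.
move=> [[p1 z1 s1 t1] i1 c1] [[p2 z2 s2 t2] i2 c2]; split; first split.
- by move=> x y; rewrite le_max p1.
- by move=> x; rewrite z1 z2 maxxx.
- by move=> x y; rewrite s1 s2.
- move=> y x z; rewrite ge_max; apply/andP; split.
    by rewrite (le_trans (t1 y x z))// lerD// le_max lexx.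
  by rewrite (le_trans (t2 y x z))// lerD// le_max lexx orbT.
- by move=> x y z; rewrite -i1 -i2.
- by move=> p; apply: continuous_max; [exact: c1|exact: c2].
Qed.

Lemma right_entourageP (A : set (G * G)) : right_entourage A <->
  exists2 d, continuous_right_pseudometric d &
  exists2 e : R, 0 < e & forall x y, d x y < e -> A (x, y).
Proof.
split=> [|[d dP [e e0 dA]]]; last first.
  apply: (@filterS _ right_entourage _ [set p | d p.1 p.2 < e]).
    by move=> [x y]; exact: dA.
  by apply: sub_gen_smallest; exists d => //; exists e.
move: A; apply: smallest_sub.
  split.
  - by exists (fun _ _ => 0); [exact: zero_pseudometric|exists 1].
  - move=> A B [d dP [e e0 dA]] [d' d'P [e' e'0 d'B]].
    exists (fun x y => Num.max (d x y) (d' x y)); first exact: max_pseudometric.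
    exists (Num.min e e'); first by rewrite lt_min e0.
    move=> x y; rewrite gt_max !lt_min => /andP[/andP[+ _] /andP[_ +]].
    by move=> /dA ? /d'B.
  - move=> A B AB [d dP [e e0 dA]]; exists d => //; exists e => // x y /dA.
    exact: AB.
by move=> _ [d dP [e e0 <-]]; exists d => //; exists e.
Qed.

Lemma right_entourage_diag A : right_entourage A -> diagonal `<=` A.
Proof.
move=> /right_entourageP[d [[_ d0 _ _] _ _] [e e0 dA]] [x y] /diagonalP <-.
by apply: dA; rewrite d0.
Qed.

Lemma right_entourage_inv A : right_entourage A -> right_entourage (A^-1)%relation.
Proof.
move=> /right_entourageP[d dP [e e0 dA]]; apply/right_entourageP.
exists d => //; exists e => // x y xy; apply: dA.
by have [[_ _ + _] _ _] := dP => <-.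
Qed.

Lemma right_entourage_split A : right_entourage A ->
  exists2 B, right_entourage B & (B \; B)%relation `<=` A.
Proof.
move=> /right_entourageP[d dP [e e0 dA]].
exists [set p | d p.1 p.2 < e / 2].
  by apply/right_entourageP; exists d => //; exists (e / 2); rewrite ?divr_gt0.
move=> [x y] /= [z /= xz zy]; apply: dA; have [[_ _ _ t] _ _] := dP.
by rewrite (le_lt_trans (t z x y))// [e]splitr ltrD.
Qed.

HB.instance Definition _ := Choice.on (right_uniform_group R G).
HB.instance Definition _ := @isUniform.Build (right_uniform_group R G) right_entourage
  right_entourage_filter right_entourage_diag right_entourage_inv
  right_entourage_split.

Definition is_luc (f : G -> R^o) : Prop :=
  [bounded f x | x in [set: G]] /\
  unif_continuous (f : right_uniform_group R G -> R^o).

Lemma is_lucP (f : G -> R^o) : is_luc f <->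
  (exists M, forall x, `|f x| <= M) /\
  (forall e : R, 0 < e -> exists2 d, continuous_right_pseudometric d &
    exists2 r : R, 0 < r & forall x y, d x y < r -> `|f x - f y| < e).
Proof.
have PG : ProperFilter (globally [set: G]) by exact: (@globally_properfilter _ _ 1%g).
split=> -[bf uf]; split.
- by have /ex_bound[M fM] := bf; exists M => x; exact: fM.
- move=> e e0.
  have /uf/right_entourageP[d dP [r r0 H]] :
      entourage [set p : R^o * R^o | ball p.1 e p.2].
    by apply: entourage_ball (PosNum e0).
  by exists d => //; exists r.
- by have [M fM] := bf; apply/ex_bound; exists M => x _; exact: fM.
- move=> A; rewrite -entourage_ballE => -[e /= e0 eA].
  have [d dP [r r0 H]] := uf _ e0.
  by apply/right_entourageP; exists d => //; exists r => // x y xy; apply/eA/H.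
Qed.

End right_uniformity.


Section luc.
Variables (R : realType) (G : topologicalGroupType).

Definition luc_pred : {pred G -> R^o} := [pred f | `[< is_luc f >]].

Lemma luc_submod_closed : submod_closed luc_pred.
Proof.
split.
  apply/asboolP/is_lucP; split; first by exists 0 => x; rewrite normr0.
  move=> e e0.
  have [d dP _] := (@right_entourageP R G setT).1 (@filterT _ _ _).
  by exists d => //; exists 1 => // x y _; rewrite subrr normr0.
move=> a f g /asboolP/is_lucP[[Mf fM] uf] /asboolP/is_lucP[[Mg gM] ug].
apply/asboolP/is_lucP; split.
  exists (`|a| * Mf + Mg) => x.
  by rewrite (le_trans (ler_normD _ _))// lerD// normrM ler_wpM2l.
move=> e e0.
have a0 : 0 < `|a| + 1 by rewrite ltr_wpDl.
have [d dP [r r0 df]] := uf (e / 2 / (`|a| + 1)) ltac:(by rewrite !divr_gt0).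
have [d' d'P [r' r'0 dg]] := ug (e / 2) ltac:(by rewrite divr_gt0).
have : right_entourage R
    ([set p : G * G | d p.1 p.2 < r] `&` [set p | d' p.1 p.2 < r']).
  apply: (@filterI _ _ (right_entourage_filter R G)); apply/right_entourageP.
    by exists d => //; exists r.
  by exists d' => //; exists r'.
move=> /right_entourageP[D DP [s s0 H]]; exists D => //; exists s => // x y.
move=> /H[/= /df fxy /dg gxy].
rewrite [ltLHS](_ : _ = `|a * (f x - f y) + (g x - g y)|); last first.
  by rewrite mulrBr addrACA opprD.
rewrite (le_lt_trans (ler_normD _ _))// [e]splitr ler_ltD// normrM.
rewrite (@le_trans _ _ ((`|a| + 1) * `|f x - f y|))//.
  by rewrite ler_wpM2r// lerDl.
by rewrite -ler_pdivlMl// mulrC ltW.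
Qed.

HB.instance Definition _ :=
  GRing.isSubmodClosed.Build _ _ luc_pred luc_submod_closed.

Record luc := Luc { luc_fun :> G -> R^o ; luc_funP : luc_fun \in luc_pred }.

HB.instance Definition _ := [isSub for luc_fun].
HB.instance Definition _ := [Choice of luc by <:].
HB.instance Definition _ := [SubChoice_isSubLmodule of luc by <:].

Lemma lucP (f : luc) : is_luc f. Proof. exact/asboolP/luc_funP. Qed.

Definition luc_norm (f : luc) : R := sup (range (fun x => `|f x|)).

Lemma luc_normP (f : luc) x : `|f x| <= luc_norm f.
Proof.
have [[M fM] _] := (is_lucP _).1 (lucP f).
by apply: ub_le_sup; [exists M => _ [y _ <-]|exists x].
Qed.

Lemma luc_norm_le (f : luc) M : (forall x, `|f x| <= M) -> luc_norm f <= M.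
Proof.
by move=> fM; apply: ge_sup => [|_ [x _ <-]//]; exists `|f 1%g|; exists 1%g.
Qed.

Lemma luc_normD f g : luc_norm (f + g) <= luc_norm f + luc_norm g.
Proof.
by apply: luc_norm_le => x; rewrite (le_trans (ler_normD _ _))// lerD// luc_normP.
Qed.

Lemma luc_normZ_le (l : R) f : luc_norm (l *: f) <= `|l| * luc_norm f.
Proof.
by apply: luc_norm_le => x; rewrite normrM ler_wpM2l// luc_normP.
Qed.

Lemma luc_normZ (l : R) f : luc_norm (l *: f) = `|l| * luc_norm f.
Proof.
apply/eqP; rewrite eq_le luc_normZ_le/=.
have [->|l0] := eqVneq l 0.
  by rewrite normr0 mul0r (le_trans _ (luc_normP _ 1%g)).
rewrite -ler_pdivlMl ?normr_gt0// -normfV.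
by rewrite (le_trans _ (luc_normZ_le _ _))// scalerA mulVf// scale1r.
Qed.

Lemma luc_norm_eq0 f : luc_norm f = 0 -> f = 0.
Proof.
move=> f0; apply/val_inj/funext => x; apply/eqP.
by rewrite -normr_le0 -f0 luc_normP.
Qed.

HB.instance Definition _ :=
  Lmodule_isNormed.Build R luc luc_normD luc_normZ luc_norm_eq0.

Lemma luc_normE (f : luc) : `|f| = luc_norm f. Proof. by []. Qed.

Lemma left_translate_subproof (f : luc) (x : G) :
  (fun y => f (x * y)%g) \in luc_pred.
Proof.
apply/asboolP/is_lucP; have [[M fM] uf] := (is_lucP _).1 (lucP f).
split; first by exists M => y; exact: fM.
move=> e /uf[d [[p z s t] i c] [r r0 H]].
exists (fun y y' => d (x * y)%g (x * y')%g); last first.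
  by exists r => // y y'; exact: H.
split; first by split=> // *; exact: t.
  by move=> y y' w; rewrite !mulgA -i.
have cx : continuous (fun y : G => (x * y)%g).
  move=> y; apply: (@continuous_comp _ _ _ (fun y => (x, y))
    (fun p : G * G => (p.1 * p.2)%g)); last exact: mulg_continuous.
  by apply: cvg_pair => /=; [exact: cvg_cst|exact: cvg_id].
move=> q; apply: (@continuous_comp _ _ _
  (fun q : G * G => ((x * q.1)%g, (x * q.2)%g))
  (fun p : G * G => d p.1 p.2)); last exact: c.
apply: cvg_pair => /=.
  by apply: (@continuous_comp _ _ _ fst (fun y => (x * y)%g)); [exact: cvg_fst|exact: cx].
by apply: (@continuous_comp _ _ _ snd (fun y => (x * y)%g)); [exact: cvg_snd|exact: cx].
Qed.

Definition left_translate (f : luc) (x : G) : luc :=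
  Luc (left_translate_subproof f x).

(* Continuity is for the sup norm luc_norm. *)
Record luc_dual := LucDual {
  luc_dual_fun :> {linear luc -> R^o} ;
  luc_dual_continuous : continuous luc_dual_fun
}.

Lemma luc_dual_bound (m : luc_dual) :
  exists2 M : R, 0 < M & forall f, `|m f| <= M * `|f|.
Proof.
have /linear_bounded_continuous/linear_boundedP/pinfty_ex_gt0[M M0 H] :=
  @luc_dual_continuous m.
by exists M.
Qed.

HB.instance Definition _ := gen_eqMixin luc_dual.
HB.instance Definition _ := gen_choiceMixin luc_dual.

(* Pointwise convergence on luc, that is, the weak-star topology. *)
HB.instance Definition _ := Topological.copy luc_dual
  (initial_topology (fun m : luc_dual => (m : luc -> R^o) : {ptws luc -> R^o})).

Lemma luc_dual_slice_subproof (n : luc_dual) (f : luc) :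
  (fun x => n (left_translate f x)) \in luc_pred.
Proof.
apply/asboolP/is_lucP; have [[M fM] uf] := (is_lucP _).1 (lucP f).
have [C C0 nC] := luc_dual_bound n; split.
  exists (C * M) => x; rewrite (le_trans (nC _))// ler_pM2l//.
  by apply: luc_norm_le => y; exact: fM.
move=> e e0; have [d dP [r r0 H]] := uf (e / 2 / C) ltac:(by rewrite !divr_gt0).
exists d => //; exists r => // x x' xx'; rewrite -linearB.
rewrite (le_lt_trans (nC _))//.
rewrite (@le_lt_trans _ _ (e / 2))//; last by rewrite [ltRHS]splitr ltrDl divr_gt0.
rewrite -ler_pdivlMl// mulrC; apply: luc_norm_le => y /=.
by apply/ltW/H; have [_ i _] := dP; rewrite -i.
Qed.

Definition luc_dual_slice (n : luc_dual) (f : luc) : luc :=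
  Luc (luc_dual_slice_subproof n f).

Definition convolution_fun (m n : luc_dual) (f : luc) : R^o :=
  m (luc_dual_slice n f).

Lemma convolution_linear m n : linear (convolution_fun m n).
Proof.
move=> a f g; rewrite /convolution_fun -linearP; congr (m _).
apply/val_inj/funext => x /=; rewrite -[RHS]/(a *: n _ + n _) -linearP.
by congr (n _); exact/val_inj/funext.
Qed.

HB.instance Definition _ m n := GRing.isLinear.Build R luc R^o _
  (convolution_fun m n) (convolution_linear m n).

Lemma convolution_continuous m n : continuous (convolution_fun m n).
Proof.
apply/linear_bounded_continuous/linear_boundedP.
have [C C0 mC] := luc_dual_bound m; have [D D0 nD] := luc_dual_bound n.
exists (C * D); split; first exact: num_real.
move=> r CDr f; rewrite (le_trans (mC _))// (@le_trans _ _ (C * D * `|f|))//.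
  rewrite -mulrA ler_pM2l//; apply: luc_norm_le => x.
  rewrite (le_trans (nD _))// ler_pM2l//; apply: luc_norm_le => y.
  exact: (luc_normP f).
by rewrite ler_wpM2r// ltW.
Qed.

Definition convolution (m n : luc_dual) : luc_dual :=
  LucDual (@convolution_continuous m n).

Lemma convolutionE m n f : convolution m n f = m (luc_dual_slice n f).
Proof. by []. Qed.

End luc.

Section baire.

Definition nowhere_dense (T : topologicalType) (A : set T) :=
  interior (closure A) = set0.

Definition meager (T : topologicalType) (A : set T) :=
  exists2 F : nat -> set T, (forall n, nowhere_dense (F n)) & A = \bigcup_n F n.

Definition baire_property (T : topologicalType) (B : set T) :=
  exists2 U : set T, open U & meager (B `+` U).

Definition CBP_set (X : topologicalType) (A : set X) :=
  forall (K : topologicalType) (phi : K -> X),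
    compact [set: K] -> hausdorff_space K -> continuous phi ->
    baire_property (phi @^-1` A).

Definition CBP_measurable (R : realType) (X : topologicalType) (h : X -> R) :=
  forall U : set R, open U -> CBP_set (h @^-1` U).

End baire.

Section charges.
Context d (T : measurableType d) (R : realType).
Variable nu : {charge set T -> \bar R}.

Lemma hahn_subproof : exists PN, hahn_decomposition nu PN.1 PN.2.
Proof. by have [P [N PN]] := Hahn_decomposition nu; exists (P, N). Qed.

(* The measures below do not depend, on measurable sets, on the choice of the
   Hahn decomposition, see Hahn_decomposition_uniq. *)
Definition hahn_sets : set T * set T := sval (cid hahn_subproof).

Definition hahn_setsP : hahn_decomposition nu hahn_sets.1 hahn_sets.2 :=
  svalP (cid hahn_subproof).

Definition positive_variation : {finite_measure set T -> \bar R} :=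
  jordan_pos hahn_setsP.

Definition negative_variation : {finite_measure set T -> \bar R} :=
  jordan_neg hahn_setsP.

Definition total_variation : {measure set T -> \bar R} :=
  charge_variation hahn_setsP.

Definition charge_integral (f : T -> R) : R :=
  \int[positive_variation]_x f x - \int[negative_variation]_x f x.

End charges.

Section radon.
Variables (R : realType) (G : topologicalGroupType).

(* Measurable types are pointed. *)
Definition pointed_group : Type := G.
HB.instance Definition _ := Choice.on pointed_group.
HB.instance Definition _ := isPointed.Build pointed_group (1%g : G).

Definition borel := g_sigma_algebraType (@open G : set (set pointed_group)).
HB.instance Definition _ := Measurable.on borel.

(* Local finiteness is automatic: only finite measures are considered. *)
Definition radon_measure (mu : {measure set borel -> \bar R}) :=
  forall A : set borel, measurable A ->
    mu A = ereal_sup [set mu K | K in [set K | compact (K : set G) /\ K `<=` A]].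

Definition signed_radon_measure (nu : {charge set borel -> \bar R}) :=
  radon_measure (total_variation nu).

Definition Mt : set (luc_dual R G) :=
  [set m | exists2 nu : {charge set borel -> \bar R}, signed_radon_measure nu &
    forall f : luc R G, m f = charge_integral nu f].

End radon.
Arguments Mt : clear implicits.

Section Lambda.
Variables (R : realType) (G : topologicalGroupType).

Definition Lambda (S : set (luc_dual R G)) : set (luc_dual R G) :=
  [set m | S m /\ forall f : luc R G,
    continuous (fun n : S => convolution m (val n) f)].

Definition LambdaCBP (S : set (luc_dual R G)) : set (luc_dual R G) :=
  [set m | S m /\ forall f : luc R G,
    CBP_measurable (fun n : S => convolution m (val n) f : R)].

End Lambda.

(* Main.v *)
Require Import Defs.
From HB Require Import structures.
From mathcomp Require Import all_boot all_order all_algebra.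
From mathcomp Require Import all_classical all_reals all_analysis.
From mathcomp Require Import measurable_realfun lra ring.
From mathcomp Require wochoice.

(** For a Radon measure [m], the number [(m * n)(f)] is the value of [n] at the
    [m]-average of the translates of [f], a function in LUC(G); so it is
    weak-star continuous in [n].

    Conversely let [m] be CBP measurable, and let [m0] be the Radon measure that
    Riesz' theorem gives for the restriction of [m] to the continuous
    functions with compact support. Fix [f] in LUC(G) and a uniform
    partition of unity [(r_t)], [t] in [T], with supports in right
    translates of one compact set, and for [A] a subset of [T] put
    [h_A := sum_(t in A) f r_t]. The set function [mu A := (m - m0)(h_A)] is
    finitely additive, vanishes on finite sets, and satisfies
    [mu T = (m - m0)(f)]. There are as many finite subsets of [T] as
    elements of [T], so that a single [g] in LUC(G) can carry, on far apart
    translates, copies of all the [h_A] with [A] finite. Hence the compact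
    set of pairs [(n, A)] with [|n| <= 1] such that [n] sends the translates
    of [g] to [h_A] projects onto the whole cube [2^T], and on it
    [(n, A) |-> mu A] is the difference of the CBP measurable [(m * n)(g)]
    and the continuous [(m0 * n)(g)]. Restricting to a minimal compact set
    that is still mapped onto the cube transfers the Baire property to the
    cube, so that [mu] is almost constant on a comeager subset of some
    nonempty open set. For a finitely additive [mu] that vanishes on finite
    sets this forces [mu T] to be arbitrarily small. So [m = m0]. *)

Set Implicit Arguments.
Unset Strict Implicit.
Unset Printing Implicit Defensive.
Import Order.TTheory GRing.Theory Num.Theory.
Import numFieldNormedType.Exports.
Local Open Scope classical_set_scope.
Local Open Scope ring_scope.

(** * Cardinals *)

Section cardinals.

(** The obstacle is that CBP measurability gives the Baire property only in compact spaces mapped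
    continuously into the dual, whereas [mu] lives on the cube, and nothing provides a continuous
    choice of n from A. The compact set of pairs stands in for such a choice. Only finite A are
    coded, because the cube may have more points than there are far apart places in G. They suffice:
    h_A(x) depends on finitely many coordinates of A, so a weak-star cluster point of Dirac
    functionals, placed at the codes of the finite parts of A, takes care of an arbitrary A. [T] may
    be uncountable, so the places are found by transfinite recursion. At each stage fewer than |T|
    finite sets of places are forbidden, and these cannot exhaust [T]; this is the use of the
    cardinal arithmetic. Minimality of the compact set makes every nonempty relatively open subset
    contain the whole preimage of some cylinder, so that nowhere dense sets have nowhere dense
    images. *)

Definition embeds T U (A : set T) (B : set U) : Prop :=
  exists2 f : T -> U, set_inj A f & forall x, A x -> B (f x).

Lemma embeds_trans T U V (A : set T) (B : set U) (C : set V) :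
  embeds A B -> embeds B C -> embeds A C.
Proof.
move=> [f fi fB] [g gi gC];
  exists (g \o f) => [x y xA yA /= /gi fxy|x /fB/gC//].
by apply: fi => //; apply: fxy; rewrite inE; apply: fB; exact/set_mem.
Qed.

Lemma chain_pair T (F : set (set T)) p q : total_on F subset ->
  (\bigcup_(X in F) X) p -> (\bigcup_(X in F) X) q ->
  exists Z, [/\ F Z, Z p & Z q].
Proof.
move=> Ft [X FX Xp] [Y FY Yq]; have [XY|YX] := Ft _ _ FX FY.
  by exists Y; split=> //; exact: XY.
by exists X; split=> //; exact: YX.
Qed.

(** A partial bijection that is maximal under inclusion exhausts [A] or [B], as otherwise one more
    pair could be added. *)
Lemma embeds_total T (A B : set T) : embeds A B \/ embeds B A.
Proof.
pose P : set (set (T * T)) := [set M | M `<=` A `*` B /\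
  forall p q, M p -> M q -> (p.1 = q.1 <-> p.2 = q.2)].
have [|M [[MAB MP] Mmax]] := @Zorn_bigcup _ P.
  move=> F FP Ft; split; first by move=> p [X /FP[+ _] Xp] => /(_ _ Xp).
  move=> p q /(chain_pair Ft) /[apply] -[Z [/FP[_ ZP] Zp Zq]]; exact: ZP.
have [MA|/existsNP[a /not_implyP[aA /forallNP Ma]]] :=
    pselect (forall x, A x -> exists y, M (x, y)).
  left.
  have /choice[f fP] : forall x, exists y, A x -> M (x, y).
    by move=> x; have [/MA[y]|] := pselect (A x); [exists y|exists x].
  exists f => [x y /set_mem/fP Mx /set_mem/fP My fxy|x /fP/MAB[]//].
  exact: (MP _ _ Mx My).2.
have [MB|/existsNP[b /not_implyP[bB /forallNP Mb]]] :=
    pselect (forall y, B y -> exists x, M (x, y)).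
  right; have /choice[f fP] : forall y, exists x, B y -> M (x, y).
    by move=> y; have [/MB[x]|] := pselect (B y); [exists x|exists y].
  exists f => [x y /set_mem/fP Mx /set_mem/fP My fxy|x /fP/MAB[]//].
  exact: (MP _ _ Mx My).1.
exfalso; apply: (Mmax (M `|` [set (a, b)])).
  by split=> [p|/(_ (a, b))]; [left|move=> /(_ (or_intror erefl))/Ma].
split=> [p [/MAB//|-> //]|[x y] [x' y'] [Mp|[-> ->]] [Mq|[-> ->]]//=].
- exact: (MP (x, y) (x', y')).
- by split=> [xa|yb]; exfalso;
    [apply: (Ma y); rewrite -xa|apply: (Mb x); rewrite -yb].
- by split=> [ax|yb]; exfalso;
    [apply: (Ma y'); rewrite ax|apply: (Mb x'); rewrite yb].
Qed.


Lemma infinite_embeds T (A : set T) : infinite_set A ->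
  exists2 u : nat -> T, (forall i j, u i = u j -> i = j) & forall i, A (u i).
Proof.
move=> /infiniteP/card_leP[f].
exists (fun i => val (f (exist _ i (mem_set I)))) => [i j|i]; last first.
  exact/set_mem/valP.
move=> /val_inj/(@inj _ _ _ f); move=> /(_ (mem_set I) (mem_set I)).
by move=> /(congr1 val).
Qed.

(** Zorn's lemma is applied to graphs of injections from [X * X] to [X], with [X] inside [A]. For a
    maximal one, [A] minus [X] embeds into [X], since otherwise a disjoint copy of [X] could be
    annexed; then [A] itself embeds into [X]. *)
Lemma infinite_square T (A : set T) : infinite_set A ->
  exists f : T -> T -> T, [/\ forall x y, A x -> A y -> A (f x y) &
    forall x y x' y', A x -> A y -> A x' -> A y' -> f x y = f x' y' ->
      x = x' /\ y = y'].
Proof.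
move=> /infinite_embeds[u ui uA].
pose dom (M : set (T * T * T)) : set T := [set x | exists y z, M (x, y, z)].
(* A triple [(x, y, z)] means that the pair of x and y is sent to z. The equivalence in the third
   clause makes the graph functional and injective at once. *)
pose good (M : set (T * T * T)) :=
  [/\ forall p, M p -> dom M p.1.2 /\ dom M p.2,
  forall x y, dom M x -> dom M y -> exists z, M (x, y, z),
  forall p q, M p -> M q -> (p.1 = q.1 <-> p.2 = q.2) & dom M `<=` A].
pose M0 : set (T * T * T) :=
  [set (u i.1, u i.2, u (pickle i)) | i in [set: nat * nat]].
have dom0 i : dom M0 (u i) by exists (u i), (u (pickle (i, i))), (i, i).
have dom0P x : dom M0 x -> exists i, x = u i.
  by move=> [y [z [i _ [<- _ _]]]]; exists i.1.
have domS M M' : M `<=` M' -> dom M `<=` dom M'.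
  by move=> MM x [y [z /MM]]; exists y, z.
have good0 : good M0.
  split=> [_ [i _ <-]/=|x y /dom0P[i ->] /dom0P[j ->]||x /dom0P[i ->]//].
  - by split; exact: dom0.
  - by exists (u (pickle (i, j))), (i, j).
  - move=> _ _ [i _ <-] [j _ <-]/=; split=> [[/ui ij /ui ij']|/ui].
      by congr (u (pickle _)); case: i j ij ij' => ? ? [? ?] /= -> ->.
    by move=> /(pcan_inj pickleK) ->.
(* Joining [M0], a pairing on a countable set, makes the empty chain harmless and puts the tags
   [u i] into every domain. *)
pose P : set (set (T * T * T)) := [set M | good (M `|` M0)].
have [|M [gM Mmax]] := @Zorn_bigcup _ P.
  move=> F FP Ft; rewrite /P/=.
  pose F' := [set X `|` M0 | X in F] `|` [set M0].
  have -> : \bigcup_(X in F) X `|` M0 = \bigcup_(X in F') X.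
    apply/seteqP; split=> [p [[X FX Xp]|M0p]|p [_ [[X FX <-]|->] Xp]].
    - by exists (X `|` M0); [left; exists X|left].
    - by exists M0 => //; right.
    - by case: Xp => Xp; [left; exists X|right].
    - by right.
  have F'g : forall X, F' X -> good X by move=> _ [[X /FP FX <-]//|->].
  have F't : total_on F' subset.
    move=> _ _ [[X FX <-]|->] [[Y FY <-]|->].
    - by have [XY|YX] := Ft _ _ FX FY; [left|right]; exact: setSU.
    - by right; exact: subsetUr.
    - by left; exact: subsetUr.
    - by left.
  have sub X : F' X -> X `<=` \bigcup_(X in F') X by move=> F'X p Xp; exists X.
  split.
  - move=> p [X /[dup] F'X /F'g[+ _ _ _] Xp] => /(_ _ Xp)[? ?].
    by split; apply: domS (sub _ F'X) _ _.
  - move=> x y [x1 [x2 xX]] [y1 [y2 yX]].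
    have [Z [F'Z Zx Zy]] := chain_pair F't xX yX.
    have [_ ZP _ _] := F'g _ F'Z.
    have [z Zz] := ZP x y ltac:(by exists x1, x2) ltac:(by exists y1, y2).
    by exists z, Z.
  - move=> p q /(chain_pair F't) /[apply] -[Z [/F'g[_ _ ZP _] Zp Zq]];
      exact: ZP.
  - by move=> x [y [z [X /F'g[_ _ _ XA] Xx]]]; apply: XA; exists y, z.
pose N := M `|` M0; pose X := dom N; have [N1 N2 N3 XA] : good N by [].
have uX i : X (u i) by apply: domS (@subsetUr _ _ _) _ _; exact: dom0.
have /choice[g gN] : forall p, exists z, X p.1 -> X p.2 -> N (p, z).
  move=> [x y]; have [[Xx Xy]|nX] := pselect (X x /\ X y).
    by have [z Nz] := N2 x y Xx Xy; exists z.
  by exists x => /= Xx Xy; exfalso; apply: nX.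
have gX x y : X x -> X y -> X (g (x, y)).
  by move=> Xx Xy; have [] := N1 _ (gN (x, y) Xx Xy).
have gi x y x' y' : X x -> X y -> X x' -> X y' -> g (x, y) = g (x', y') ->
    x = x' /\ y = y'.
  move=> Xx Xy Xx' Xy' gxy.
  by have [_ /(_ gxy)[]] := N3 _ _ (gN (x, y) Xx Xy) (gN (x', y') Xx' Xy').
have u01 : u 0%N <> u 1%N by move=> /ui.
have [[v vi vX]|[v vi vX]] := embeds_total (A `\` X) X.
  (* The tags [u 0] and [u 1] keep the images of [X] and of its complement apart, so [w] embeds [A]
     into [X]. *)
  pose w x := if pselect (X x) then g (u 0%N, x) else g (u 1%N, v x).
  have wX x : A x -> X (w x).
    by rewrite /w; case: pselect => xX xA; apply: gX => //; exact: vX.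
  have wi x y : A x -> A y -> w x = w y -> x = y.
    rewrite /w => xA yA; do 2 case: pselect => ? //; move=> /gi.
    - by case.
    - by case=> //; exact: vX.
    - by case=> //; [exact: vX|move=> /esym].
    - by case; rewrite ?inE//; try exact: vX; move=> _; apply: vi; rewrite inE.
  exists (fun x y => g (w x, w y)); split=> [x y xA yA|x y x' y' Ax Ay Ax' Ay'].
    by apply: XA; apply: gX; exact: wX.
  by move=> /gi[|||| /wi-> // /wi->//]; exact: wX.
have {}vi x y : X x -> X y -> v x = v y -> x = y.
  by move=> Xx Xy; apply: vi; rewrite inE.
have vA x : X x -> A (v x) by move=> /vX[].
have vNX x : X x -> ~ X (v x) by move=> /vX[].
exfalso.
(* The copy of [X] under [v] lies in [A] outside [X]. The three new blocks of pairs are sent into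
   this copy, told apart by the tags [u 0], [u 1], [u 2]; the enlarged graph contradicts
   maximality. *)
pose c k x y := v (g (u k, g (x, y))).
have cX k x y : X x -> X y -> X (g (u k, g (x, y))) by move=> Xx Xy;
  exact: gX (uX k) (gX _ _ Xx Xy).
have ci k l x y x' y' : X x -> X y -> X x' -> X y' -> c k x y = c l x' y' ->
    [/\ k = l, x = x' & y = y'].
  move=> Xx Xy Xx' Xy' /vi-/(_ (cX _ _ _ Xx Xy) (cX _ _ _ Xx' Xy')).
  case/gi; [exact: uX|exact: gX|exact: uX|exact: gX|].
  by move=> /ui -> /gi[].
pose E : set (T * T * T) := [set p | exists x y, [/\ X x, X y &
  [\/ p = (x, v y, c 0%N x y), p = (v x, y, c 1%N x y) |
     p = (v x, v y, c 2%N x y)]]].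
pose Y := X `|` v @` X.
have YX x : X x -> Y x by left.
have Yv x : X x -> Y (v x) by right; exists x.
have domY : dom (N `|` E) = Y.
  apply/seteqP; split=>
    [x [y [z [Nx|[x1 [y1 [X1 Xy1 Ex]]]]]]|x [Xx|[x1 Xx1 <-]]].
  - by apply: YX; exists y, z.
  - by case: Ex => -[-> _ _]; [exact: YX|exact: Yv|exact: Yv].
  - by have [z Nz] := N2 _ _ Xx Xx; exists x, z; left.
  - by exists x1, (c 1%N x1 x1); right; exists x1, x1; split=> //;
      constructor 2.
apply: (Mmax (M `|` E)).
  split=> [p|]; first by left.
  move=> H; have : N (v (u 0%N), v (u 0%N), c 2%N (u 0%N) (u 0%N)).
    by left; apply: H; right; exists (u 0%N), (u 0%N); split=> //;
      constructor 3.
  by move=> Nv; apply: (vNX (u 0%N)) => //;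
    exists (v (u 0%N)), (c 2%N (u 0%N) (u 0%N)).
rewrite /P/= setUAC -/N; split; rewrite ?domY.
- move=> p [/N1[? ?]|[x [y [Xx Xy [] ->]]]] /=; first by split; exact: YX.
  + by split; apply: Yv => //; exact: cX.
  + by split; [exact: YX|apply: Yv; exact: cX].
  + by split; apply: Yv => //; exact: cX.
- move=> a b [Xa|[x Xx <-]] [Xb|[y Xy <-]].
  + by have [z Nz] := N2 _ _ Xa Xb; exists z; left.
  + by exists (c 0%N a y); right; exists a, y; split=> //; constructor 1.
  + by exists (c 1%N x b); right; exists x, b; split=> //; constructor 2.
  + by exists (c 2%N x y); right; exists x, y; split=> //; constructor 3.
- have NE p q : N p -> E q -> p.1 <> q.1 /\ p.2 <> q.2.
    case: p => -[a b] z Np [x [y [Xx Xy Eq]]].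
    have [Xa Xb Xz] : [/\ X a, X b & X z].
      by have [] := N1 _ Np; split=> //; exists b, z.
    case: Eq => -> /=; split=> -[].
    + by move=> _ bv; apply: (vNX _ Xy); rewrite -bv.
    + by move=> zv; apply: vNX (cX 0%N _ _ Xx Xy) _; rewrite -[v _]zv.
    + by move=> av _; apply: (vNX _ Xx); rewrite -av.
    + by move=> zv; apply: vNX (cX 1%N _ _ Xx Xy) _; rewrite -[v _]zv.
    + by move=> av _; apply: (vNX _ Xx); rewrite -av.
    + by move=> zv; apply: vNX (cX 2%N _ _ Xx Xy) _; rewrite -[v _]zv.
  move=> p q [Np|Ep] [Nq|Eq].
  + exact: N3.
  + by have [] := NE _ _ Np Eq.
  + by have [n1 n2] := NE _ _ Nq Ep; split=> /esym.
  + case: Ep => x [y [Xx Xy Ep]]; case: Eq => x' [y' [Xx' Xy' Eq]].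
    have vXX a b : X a -> X b -> a <> v b.
      by move=> Xa Xb ab; apply: (vNX _ Xb); rewrite -ab.
    case: Ep => ->; case: Eq => -> /=; split=> [[ea eb]|ec];
    try (by have [kl -> ->] := ci _ _ _ _ _ _ Xx Xy Xx' Xy' ec);
    try (by case: (vXX _ _ _ _ ea)); try (by case: (vXX _ _ _ _ (esym ea)));
    try (by case: (vXX _ _ _ _ eb)); try (by case: (vXX _ _ _ _ (esym eb)));
    try (by rewrite ea (vi _ _ Xy Xy' eb));
      try (by rewrite (vi _ _ Xx Xx' ea) eb);
    by rewrite (vi _ _ Xx Xx' ea) (vi _ _ Xy Xy' eb).
- by move=> x [/XA//|[y Xy <-]]; exact: vA.
Qed.


Lemma seq_embeds T : infinite_set [set: T] ->
  exists f : seq T -> T, injective f.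
Proof.
move=> Tinf; have [f [_ fi]] := infinite_square Tinf.
have [u ui _] := infinite_embeds Tinf.
pose code := fix code (s : seq T) :=
  if s is x :: s' then f (u 1%N) (f x (code s')) else f (u 0%N) (u 0%N).
have {}fi x y x' y' : f x y = f x' y' -> x = x' /\ y = y' by exact: fi.
exists code; elim=> [|x s IH] [|y t] //= => /fi[].
- by move=> /ui.
- by move=> /ui.
- by move=> _ /fi[-> /IH ->].
Qed.

Section selection.
Variables (T : choiceType).
Hypothesis Tinf : infinite_set [set: T].

Lemma embedsS (A B : set T) : A `<=` B -> embeds A B.
Proof. by move=> AB; exists idfun. Qed.

(** If the sets covered [T], each x would be determined by an index j and by its position in a list
    of [F j]. An infinite [J] absorbs the positions through a pairing, so [T] would embed into
    [J]. *)
Lemma bigcup_finite_lt (J : set T) (F : T -> set T) :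
  ~ embeds [set: T] J -> (forall j, J j -> finite_set (F j)) ->
  exists x, forall j, J j -> ~ F j x.
Proof.
move=> TJ Ff; apply: contrapT => /forallNP nF.
have /choice[i iP] : forall x, exists j, J j /\ F j x.
  by move=> x; apply: contrapT => /forallNP nj; apply: (nF x) => j Jj Fj;
    apply: (nj j).
have [Jfin|Jinf] := pselect (finite_set J).
  apply: Tinf; apply: (sub_finite_set _ (bigcup_finite Jfin Ff)) => x _.
  by have [? ?] := iP x; exists (i x).
have [f [fJ fi]] := infinite_square Jinf.
have [u ui uJ] := infinite_embeds Jinf.
have /choice[s sF] : forall j, exists s : seq T, J j -> F j `<=` [set` s].
  move=> j; have [Jj|] := pselect (J j); last by exists [::].
  by have /finite_seqP[s Fs] := Ff _ Jj; exists s => _; rewrite Fs.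
apply: TJ; exists (fun x => f (i x) (u (index x (s (i x))))) => [x y _ _|x _].
  have [Jx Fx] := iP x; have [Jy Fy] := iP y.
  move=> /(fi _ _ _ _ Jx (uJ _) Jy (uJ _))[ixy /ui exy].
  have xs : x \in s (i x) by exact: sF.
  have ys : y \in s (i x) by rewrite ixy; exact: sF.
  by rewrite -[LHS](nth_index x xs) exy ixy (nth_index x) // -ixy.
by apply: fJ => //; have [] := iP x.
Qed.

(** Greedy choice by transfinite recursion: each earlier choice forbids finitely many values, and
    [bigcup_finite_lt] leaves a value free. By symmetry a conflict can always be charged to the
    later of the two indices. *)
Lemma selection (D : Type) (e : D -> T) (conflict : D -> T -> D -> T -> Prop) :
  injective e ->
  (forall d x d' x', conflict d x d' x' -> conflict d' x' d x) ->
  (forall d d' x', finite_set [set x | conflict d x d' x']) ->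
  exists y : D -> T, forall d d', d <> d' -> ~ conflict d (y d) d' (y d').
Proof.
move=> ei csym cfin; have [R Rwo] := wochoice.well_ordering_principle T.
pose lt x y := R x y /\ x <> y.
have wmin (P : set T) : P !=set0 -> exists2 z, P z & forall x, P x -> R z x.
  move=> [x Px]; have [|z [[zP zmin] _]] := Rwo [pred x | x \in P].
    by exists x; rewrite inE.
  by exists z; [exact/set_mem|move=> y Py; apply: zmin; rewrite !inE].
have Rtot x y : x <> y -> lt x y \/ lt y x.
  move=> xy; have [z [|] -> zP] := wmin [set x; y] ltac:(by exists x; left).
    by left; split=> //; apply: zP; right.
  by right; split=> [|/esym//]; apply: zP; left.
have Ranti x y : R x y -> R y x -> x = y.
  move=> xy yx; have Rxx w : R w w.
    by have [z -> /(_ w erefl)] := wmin [set w] ltac:(by exists w).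
  have [z [_ zuniq]] : exists! z, wochoice.minimum_of R (mem [set x; y]) z.
    by apply: Rwo; exists x; rewrite inE; left.
  have zx : z = x by apply: zuniq; split=> [|w]; rewrite inE => //;
    [left|move=> [] ->].
  have zy : z = y by apply: zuniq; split=> [|w]; rewrite inE => //;
    [right|move=> [] ->].
  by rewrite -zx.
have ltwf : well_founded lt.
  move=> x; apply: contrapT => nx.
  have [z nz zmin] := wmin [set x | ~ Acc lt x] ltac:(by exists x).
  apply: nz; constructor => y [Ryz yz]; apply: contrapT => /zmin Rzy.
  by apply: yz; exact: Ranti.
(* Cut the well-order at the first initial segment as large as [T], so that
   all proper initial segments of [J] are strictly smaller than [T]. *)
have [J [TJ Jlt]] : exists J : set T, embeds [set: T] J /\
    forall j, J j -> ~ embeds [set: T] (J `&` [set i | lt i j]).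
  have [/wmin[z zbig zmin]|/forallNP nbig] :=
      pselect ([set z | embeds [set: T] [set i | lt i z]] !=set0).
    exists [set i | lt i z]; split=> // j [Rjz jz] jbig.
    apply: jz; apply: Ranti => //; apply: zmin => /=.
    by apply: embeds_trans jbig _; apply: embedsS => i [].
  exists [set: T]; split=> [|j _]; first exact: embedsS.
  by rewrite setTI; exact: nbig.
have [h hi hJ] := TJ; have {}hi : injective h by move=> x y; apply: hi;
  rewrite inE.
pose d_ j d := h (e d) = j.
have d_inj j d d' : d_ j d -> d_ j d' -> d = d' by move=> <- /hi/ei.
(* An index that codes no element of [D] forbids nothing, so values can be chosen at all indices of
   [J]. *)
pose bad (y : T -> T) j i := [set x | exists d d', [/\ d_ j d, d_ i d' &
  conflict d x d' (y i)]].
have badfin y j i : finite_set (bad y j i).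
  have [[[d dj] [d' d'i]]|nd] :=
    pselect ((exists d, d_ j d) /\ (exists d, d_ i d)).
    apply: sub_finite_set (cfin d d' (y i)) => x [d1 [d1' [dj1 di1 dd]]].
    by rewrite (d_inj _ _ _ dj dj1) (d_inj _ _ _ d'i di1).
  rewrite (_ : bad _ _ _ = set0)// -subset0 => x [d [d' [? ? _]]].
  by apply: nd; split; [exists d|exists d'].
have pick (y : T -> T) j : exists x, J j ->
    forall i, J i -> lt i j -> ~ bad y j i x.
  have [Jj|] := pselect (J j); last by exists j.
  have [x xP] := bigcup_finite_lt (Jlt _ Jj) (fun i _ => badfin y j i).
  by exists x => _ i Ji ij; exact: xP.
have [Y YP] : exists Y : T -> T, forall j, J j -> forall i, J i -> lt i j ->
    ~ bad Y j i (Y j).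
  (* Recursion supplies values only below [j]; the fallback [i] merely makes the argument of [pick]
     total. *)
  pose F (j : T) (rec : forall i, lt i j -> T) : T :=
    sval (cid (pick (fun i =>
      if pselect (lt i j) is left ij then rec i ij else i) j)).
  exists (Fix ltwf (fun=> T) F) => j Jj i Ji ij.
  rewrite [X in ~ _ X]Fix_eq; last first.
    move=> x f g fg; congr (F x _).
    by apply: functional_extensionality_dep => i';
      apply: functional_extensionality_dep.
  rewrite /F; case: cid => x /= xP [d [d' [dj di dd]]].
  apply: (xP Jj i Ji ij); exists d, d'; split=> //.
  by case: pselect.
exists (Y \o h \o e) => d d' dd' cdd'.
have [lt1|lt2] : lt (h (e d)) (h (e d')) \/ lt (h (e d')) (h (e d)).
- by apply: Rtot => /hi/ei.
- apply: (YP _ (hJ _ I) _ (hJ _ I) lt1).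
  by exists d', d; split=> //; exact: csym.
- by apply: (YP _ (hJ _ I) _ (hJ _ I) lt2); exists d, d'; split.
Qed.

End selection.

End cardinals.

(** * Finitely additive set functions and category *)

Section cantor_cube.
Variable I : choiceType.
Implicit Types (A B a : I -> bool) (E F : seq I) (N : set (I -> bool)).

Definition agree F A B := {in F, A =1 B}.

Lemma agree_sub F F' A B : {subset F <= F'} -> agree F' A B -> agree F A B.
Proof. by move=> FF AB i /FF/AB. Qed.

(* Nowhere density in the product topology of the cube. *)
Definition cube_nowhere_dense N := forall F a, exists F' a',
  [/\ {subset F <= F'}, agree F a a' & forall B, agree F' a' B -> ~ N B].

Lemma cube_nowhere_denseU N1 N2 : cube_nowhere_dense N1 ->
  cube_nowhere_dense N2 -> cube_nowhere_dense (N1 `|` N2).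
Proof.
move=> n1 n2 F a; have [F1 [a1 [FF1 aa1 B1]]] := n1 F a.
have [F2 [a2 [FF2 aa2 B2]]] := n2 F1 a1; exists F2, a2; split.
- by move=> i /FF1/FF2.
- by move=> i iF; rewrite aa1// aa2//; exact: FF1.
- move=> B B2a [N1B|N2B]; last exact: (B2 B).
  by apply: (B1 B) => // i iF1; rewrite aa2// B2a//; exact: FF2.
Qed.

Lemma cube_patterns E : exists ps : seq (I -> bool),
  forall B, exists2 p, List.In p ps & agree E p B.
Proof.
elim: E => [|i E [ps psP]]; first by exists [:: xpred0] => B;
  exists xpred0 => //; left.
exists (map (fun p j => (j == i) || p j) ps ++
  map (fun p j => (j != i) && p j) ps).
move=> B; have [p pps pB] := psP B.
exists (if B i then fun j => (j == i) || p j else fun j => (j != i) && p j).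
  apply/List.in_or_app; case: (B i); [left|right].
    by apply/List.in_map_iff; exists p.
  by apply/List.in_map_iff; exists p.
move=> j; rewrite inE => /orP[/eqP ->|jE]; first by case: (B i); rewrite eqxx.
have [->|ji] := eqVneq j i; first by case: (B i); rewrite eqxx.
by case: (B i); rewrite ?(negPf ji) ?ji/= pB.
Qed.

(** There are finitely many patterns on [E]. Treating them one after another, and extending the
    condition found so far only off [E], produces a single condition that works for all of them. *)
Lemma cube_avoid N E : cube_nowhere_dense N -> exists F a,
  [/\ forall i, i \in F -> i \notin E & forall B, agree F a B -> ~ N B].
Proof.
move=> nN; have [ps psP] := cube_patterns E.
suff [F [a [FE FN]]] : exists F a, [/\ forall i, i \in F -> i \notin E &
    forall p, List.In p ps -> forall B, agree E p B -> agree F a B -> ~ N B].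
  by exists F, a; split=> // B; have [p pps pB] := psP B; exact: (FN p).
elim: ps {psP} => [|p ps [F [a [FE FN]]]]; first by exists [::], xpred0.
have [F' [a' [FF' aa' BN]]] :=
  nN (E ++ F) (fun i => if i \in E then p i else a i).
exists [seq i <- F' | i \notin E], a'; split=> [i|q].
  by rewrite mem_filter => /andP[].
have aF i : i \in F -> a i = a' i.
  move=> iF; have := aa' i; rewrite mem_cat iF orbT => /(_ isT).
  by rewrite (negPf (FE _ iF)).
have FF i : i \in F -> i \in [seq i <- F' | i \notin E].
  by move=> iF; rewrite mem_filter FE// FF'// mem_cat iF orbT.
move=> [<-|qps] B EB FB; last first.
  by apply: (FN q qps B EB) => i iF; rewrite aF// FB// FF.
apply: BN => i iF'; have [iE|iE] := boolP (i \in E).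
  by rewrite -EB//; have := aa' i; rewrite mem_cat iE => /(_ isT).
by apply: FB; rewrite mem_filter iE.
Qed.

(* The Talagrand--Jalali-Naini characterization of comeager sets, relative to a
   basic open set. *)
Lemma cube_comeager (J : countType) (N : J -> set (I -> bool)) F0 a0 :
  (forall j, cube_nowhere_dense (N j)) ->
  exists (F : nat -> seq I) (a : I -> bool),
    [/\ forall n i, i \in F n -> i \notin F0,
        forall m n i, i \in F m -> i \in F n -> m = n &
        forall B, agree F0 a0 B ->
          (forall k, exists2 n, (k <= n)%N & agree (F n) a B) ->
          forall j, ~ N j B].
Proof.
move=> nN.
pose M n : set (I -> bool) := if unpickle n is Some j then N j else set0.
have nM n : cube_nowhere_dense (M n).
  rewrite /M; case: unpickle => // F a; by exists F, a; split=> [i|i|B _ []].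
have nMU n : cube_nowhere_dense [set B | exists2 k, (k <= n)%N & M k B].
  elim: n => [|n IH].
    move=> F a; have [F' [a' [? ? H]]] := nM 0%N F a; exists F', a'; split=> //.
    by move=> B FB [k]; rewrite leqn0 => /eqP ->; exact: (H B).
  move=> F a; have [F' [a' [FF aa H]]] := cube_nowhere_denseU IH (nM n.+1) F a.
  exists F', a'; split=> // B /H nB [k];
    rewrite leq_eqVlt ltnS => /orP[/eqP ->|kn] MB.
    by apply: nB; right.
  by apply: nB; left; exists k.
have /choice[st stP] : forall p : nat * seq I, exists Fa : seq I * (I -> bool),
    (forall i, i \in Fa.1 -> i \notin p.2) /\
    forall B, agree Fa.1 Fa.2 B -> ~ exists2 k, (k <= p.1)%N & M k B.
  by move=> [n E]; have [F [a [? ?]]] := cube_avoid E (nMU n); exists (F, a).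
(* [E n] collects [F0] and the blocks before n. Block n is chosen off [E n], so the blocks are
   disjoint, and it excludes all sets of index at most n; agreement on infinitely many blocks
   therefore excludes every set. *)
pose E := fix E n := if n is n'.+1 then E n' ++ (st (n', E n')).1 else F0.
pose F n := (st (n, E n)).1; pose b n := (st (n, E n)).2.
have EE n m : (n <= m)%N -> {subset E n <= E m}.
  elim: m => [|m IH]; first by rewrite leqn0 => /eqP ->.
  rewrite leq_eqVlt ltnS => /orP[/eqP -> //|/IH EE i /EE iE].
  by rewrite /= mem_cat iE.
have FE n m i : i \in F n -> (n < m)%N -> i \in E m.
  by move=> iF /EE; apply; rewrite /= mem_cat iF orbT.
have FnE n i : i \in F n -> i \notin E n by have [+ _] := stP (n, E n); apply.
have Fdisj m n i : i \in F m -> i \in F n -> m = n.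
  move=> im iN; case: (ltngtP m n) => // mn.
    by have := FnE _ _ iN; rewrite (FE _ _ _ im mn).
  by have := FnE _ _ im; rewrite (FE _ _ _ iN mn).
have /choice[a aP] :
    forall i, exists c : bool, forall n, i \in F n -> c = b n i.
  move=> i; have [[n iF]|nF] := pselect (exists n, i \in F n).
    by exists (b n i) => m /(Fdisj _ _ _ iF) ->.
  by exists true => n iF; exfalso; apply: nF; exists n.
exists F, a; split=> //.
  by move=> n i /FnE; apply: contra; exact: (EE 0%N).
move=> B F0B FB j Nj; have [n jn nB] := FB (pickle j).
have [_ /(_ B)] := stP (n, E n); apply.
  by move=> i iF; rewrite -nB//; exact/esym/aP.
by exists (pickle j) => //; rewrite /M pickleK.
Qed.

Variables (R : realType) (mu : (I -> bool) -> R).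
Hypothesis muD : forall A B, (forall i, A i -> ~~ B i) ->
  mu (fun i => A i || B i) = mu A + mu B.
Hypothesis mu_finite : forall (s : seq I) A, (forall i, A i -> i \in s) ->
  mu A = 0.

Let mu_off (s : seq I) A B : (forall i, i \notin s -> A i = B i) -> mu A = mu B.
Proof.
have off C : mu C = mu (fun i => C i && (i \notin s)).
  have -> : C = (fun i => (C i && (i \in s)) || (C i && (i \notin s))).
    by apply/funext => i; case: (i \in s); case: (C i).
  rewrite muD => [|i /andP[_ ->]]; last by rewrite andbF.
  rewrite (@mu_finite s) ?add0r => [|i /andP[]//]; congr mu; apply/funext => i.
  by case: (i \in s); case: (C i).
move=> AB; rewrite off [RHS]off; congr mu; apply/funext => i.
by have [|/AB ->] := boolP (i \in s); rewrite ?andbF.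
Qed.

(** As [mu] ignores changes on [F0], it is within d of c on every set that agrees with [a] on
    infinitely many blocks. Blocks are sorted modulo 3 to get disjoint A and B such that A, B, their
    union and the complement of A are all of this kind. Comparing mu A + mu B with its two terms
    gives |c| <= 3 d; the value of the whole is mu A plus that of the complement, within 2 d of 2 c,
    hence at most 8 d. *)
Lemma additive_almost_constant (J : countType)
  (N : J -> set (I -> bool)) F0 a0 c d :
  (forall j, cube_nowhere_dense (N j)) ->
  (forall B, agree F0 a0 B -> (forall j, ~ N j B) -> `|mu B - c| <= d) ->
  `|mu xpredT| <= 8 * d.
Proof.
move=> nN muc; have [F [a [FF0 Fdisj FP]]] := cube_comeager F0 a0 nN.
have {muc FP} muc B : (forall k, exists2 n, (k <= n)%N & agree (F n) a B) ->
    `|mu B - c| <= d.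
  move=> BP; pose B' i := if i \in F0 then a0 i else B i.
  rewrite (@mu_off F0 B B') => [|i /negPf iF0]; last by rewrite /B' iF0.
  apply: muc => [i iF0|]; first by rewrite /B' iF0.
  apply: FP => [i iF0|k]; first by rewrite /B' iF0.
  have [n kn nB] := BP k; exists n => // i iF.
  by rewrite /B' (negPf (FF0 _ _ iF)) nB.
pose S r i := `[< exists2 n, (n %% 3 = r)%N & i \in F n >].
have SF n i : i \in F n -> forall r, S r i = (n %% 3 == r)%N.
  move=> iF r; apply/asboolP/eqP => [[m <- /(Fdisj _ _ _ iF) ->//]|nr].
  by exists n.
have S_disj r r' i : S r i -> S r' i -> r = r'.
  by move=> /asboolP[n <- iF] /asboolP[n' <- /(Fdisj _ _ _ iF) ->].
have large r : (r < 3)%N -> forall k, exists2 n, (k <= n)%N & (n %% 3 = r)%N.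
  move=> r3 k; exists (k * 3 + r)%N; last by rewrite modnMDl modn_small.
  by rewrite (leq_trans _ (leq_addr _ _))// leq_pmulr.
(* [A] follows [a] on the blocks of class 0 and contradicts it on those of class 2, where its
   complement follows [a]; class 1 is left to [B]. *)
pose A i := (S 0%N i && a i) || (S 2%N i && ~~ a i).
pose B i := S 1%N i && a i.
have muA : `|mu A - c| <= d.
  apply: muc => k; have [n kn n3] := large 0%N isT k; exists n => // i iF.
  by rewrite /A !(SF _ _ iF) n3 /= orbF.
have muB : `|mu B - c| <= d.
  apply: muc => k; have [n kn n3] := large 1%N isT k; exists n => // i iF.
  by rewrite /B !(SF _ _ iF) n3.
have AB i : A i -> ~~ B i.
  rewrite /B => AiB; apply/negP => /andP[S1 _].
  by case/orP: AiB => /andP[/S_disj/(_ S1)].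
have muAB : `|mu A + mu B - c| <= d.
  rewrite -muD//; apply: muc => k; have [n kn n3] := large 0%N isT k.
  by exists n => // i iF; rewrite /A /B !(SF _ _ iF) n3 /= !orbF.
have muCA : `|mu (fun i => ~~ A i) - c| <= d.
  apply: muc => k; have [n kn n3] := large 2%N isT k; exists n => // i iF.
  by rewrite /A !(SF _ _ iF) n3 /= negbK.
have -> : xpredT = (fun i => A i || ~~ A i) by apply/funext => i; rewrite orbN.
rewrite muD => [|i]; last by rewrite negbK.
move: muA muB muAB muCA;
  rewrite !ler_norml => /andP[? ?] /andP[? ?] /andP[? ?] /andP[? ?].
by apply/andP; split; lra.
Qed.

End cantor_cube.

(** * Compact sets mapped onto a cube *)

Section compact_over_cube.
Variables (X : topologicalType) (I : choiceType) (pi : X -> I -> bool).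
Hypothesis pi_near : forall x i, \forall y \near x, pi y i = pi x i.
Implicit Types (K C U V : set X).

Definition onto_cube C := forall A, exists2 x, C x & pi x = A.

Lemma agree_near (F : seq I) x : \forall y \near x, agree F (pi x) (pi y).
Proof.
elim: F => [|i F IH]; first by near=> y => i.
near=> y => j; rewrite inE => /orP[/eqP ->|jF].
  by apply/esym; near: y; exact: pi_near.
by move: j jF; near: y.
Unshelve. all: by end_near. Qed.

(** The points matching A on finite sets form a filter base on [C]; as the coordinates of [pi] are
    locally constant, a cluster point matches A everywhere. *)
Lemma onto_cube_finite C A : compact C ->
  (forall F : seq I, exists2 x, C x & agree F A (pi x)) ->
    exists2 x, C x & pi x = A.
Proof.
move=> Cc CF; pose B (F : seq I) := C `&` [set x | agree F A (pi x)].
have FB : ProperFilter (filter_from [set: seq I] B).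
  apply: filter_from_proper => [|F _]; last by have [x] := CF F; exists x.
  apply: filter_from_filter; first by exists [::].
  move=> F F' _ _; exists (F ++ F') => // x [Cx xA].
  by split; split=> //; apply: agree_sub xA => i iF; rewrite mem_cat iF ?orbT.
have [|x [Cx xcl]] := Cc _ FB; first by exists [::] => // x [].
exists x => //; apply/funext => i.
have [||y [[_ yA] yi]] := xcl (B [:: i]) [set y | pi y i = pi x i].
- by exists [:: i].
- exact: pi_near.
- by rewrite -yi -yA// inE.
Qed.

(* Category on [K] cannot see the closed sets whose removal keeps the map onto;
   so pass to a closed subset on which there are none. *)
Lemma irreducible_onto_cube K : compact K -> onto_cube K -> exists U,
  [/\ open U, onto_cube (K `\` U) &
      forall V, open V -> onto_cube (K `\` U `\` V) -> (K `\` U) `&` V = set0].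
Proof.
move=> Kc Ko; pose P : set (set X) := [set U | open U /\ onto_cube (K `\` U)].
have [|U [[Uo KU] Umax]] := @Zorn_bigcup _ P.
  move=> F FP Ft; split; first by apply: bigcup_open => U /FP[].
  have [->|/set0P[U0 FU0]] := eqVneq F set0; first by rewrite bigcup_set0 setD0.
  (* The parts of the fibre over A left by the members of the chain are nested and nonempty. A
     cluster point lies in no member, the members being open. *)
  move=> A; pose B U := K `&` [set x | pi x = A] `\` U.
  have FB : ProperFilter (filter_from F B).
    apply: filter_from_proper => [|U FU]; last first.
      by have [_ /(_ A)[x [Kx Ux] xA]] := FP _ FU; exists x.
    apply: filter_from_filter; first by exists U0.
    move=> U V FU FV; have [UV|VU] := Ft _ _ FU FV.
      by exists V => // x [KAx Vx]; do 2 split=> //; apply: contra_not Vx;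
        exact: UV.
    by exists U => // x [KAx Ux]; do 2 split=> //; apply: contra_not Ux;
      exact: VU.
  have [|x [Kx xcl]] := Kc _ FB; first by exists U0 => // x [[]].
  exists x.
    split=> // -[U FU Ux]; have [Uo _] := FP _ FU.
    have [||y [[_ nUy] Uy]] := xcl (B U) U; last exact: nUy.
      by exists U.
    exact: open_nbhs_nbhs.
  apply/funext => i.
  have [||y [[[_ yA] _] yi]] := xcl (B U0) [set y | pi y i = pi x i].
  - by exists U0.
  - exact: pi_near.
  - by rewrite -yi yA.
exists U; split=> // V Vo KUV; apply: contrapT => /eqP/set0P[x [[Kx nUx] Vx]].
apply: (Umax (U `|` V)).
  by split=> [|/(_ x (or_intror Vx))//]; exact: subsetUl.
by split; [exact: openU|rewrite -setDDl].
Qed.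

Section minimal_compact.
Variable K : set X.
Hypotheses (Kc : compact K) (Ko : onto_cube K).
Hypothesis Kmin : forall V, open V -> onto_cube (K `\` V) -> K `&` V = set0.

(** Otherwise the part of [K] off [V] would meet every finite pattern, so by compactness it would
    map onto the cube, and minimality would make [V] miss [K]. *)
Lemma open_over_cube V x : open V -> K x -> V x -> exists F A,
  forall y, K y -> agree F A (pi y) -> V y.
Proof.
move=> Vo Kx Vx; apply: contrapT => nFA.
suff /(Kmin Vo)/seteqP[/(_ x)/(_ (conj Kx Vx))] : onto_cube (K `\` V) by [].
move=> A; apply: onto_cube_finite.
  by rewrite setDE; apply: compact_closedI => //; exact: open_closedC.
move=> F; apply: contrapT => nF; apply: nFA; exists F, A => y Ky yA.
by apply: contrapT => nVy; apply: nF; exists y.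
Qed.

(** Above a given cylinder some relatively open set misses [M]. By [open_over_cube] it contains the
    full preimage of a smaller cylinder, and that cylinder then misses the image of [M]. *)
Lemma nowhere_dense_over_cube (M : set (K : topologicalType)) :
  nowhere_dense M ->
  cube_nowhere_dense [set A | exists2 x : K, M x & pi (val x) = A].
Proof.
move=> nM F a; have [x Kx xa] := Ko a.
pose V : set X := [set y | nbhs y [set z | agree F a (pi z)]].
have VE y : agree F a (pi y) -> V y.
  move=> ya; have := agree_near F y; apply: filterS => z yz i iF.
  by rewrite ya// yz.
have Vo : open V.
  by rewrite openE => y Vy; exact: near_join Vy.
have [W [Wo [y [Ky Wy]] WV WM]] :
  exists W, [/\ open W, K `&` W !=set0, W `<=` V &
    forall z : K, W (val z) -> ~ M z].
  have Vx' : (val @^-1` V : set K) (exist _ x (mem_set Kx)).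
    by apply: VE; rewrite xa.
  have : ~ (val @^-1` V : set (K : topologicalType)) `<=` closure M.
    move=> VM; suff : (interior (closure M)) (exist _ x (mem_set Kx)).
      by rewrite nM.
    have : nbhs (exist _ x (mem_set Kx) : K) (val @^-1` V).
      apply: (@initial_continuous _ _ (val : K -> X)); apply: open_nbhs_nbhs.
      by split.
    by apply: filterS.
  move=> /existsNP[y /not_implyP[Vy ny]].
  have : open (~` closure M) by apply: closed_openC; exact: closed_closure.
  case=> W Wo WM; exists (W `&` V); split.
  - exact: openI.
  - exists (val y); split; first exact/set_mem/valP.
    by split=> //; have : (~` closure M) y by []; rewrite -WM.
  - by move=> ? [].
  - move=> z [Wz _]; have : (val @^-1` W) z by [].
    by rewrite [X in X z]WM => + /subset_closure.
have [F1 [A FA]] := open_over_cube Wo Ky Wy.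
have [z Kz zA] := Ko A.
exists (F ++ F1), A; split=> [i iF|i iF|B BA [v Mv vB]];
  first by rewrite mem_cat iF.
  have /WV/nbhs_singleton/(_ i iF) -> : W z by apply: FA => // j; rewrite zA.
  by rewrite zA.
apply: WM Mv; apply: FA; first exact/set_mem/valP.
by rewrite vB; apply: agree_sub BA => i iF; rewrite mem_cat iF orbT.
Qed.

End minimal_compact.

Section additive_category.
Variables (R : realType) (mu : (I -> bool) -> R) (K : set X) (h c : X -> R).
Hypothesis muD : forall A B : I -> bool, (forall i, A i -> ~~ B i) ->
  mu (fun i => A i || B i) = mu A + mu B.
Hypothesis mu_finite : forall (s : seq I) (A : I -> bool),
  (forall i, A i -> i \in s) -> mu A = 0.
Hypotheses (Kc : compact K) (Ko : onto_cube K).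
Hypothesis hE : forall x, K x -> h x = mu (pi x) + c x.
Hypothesis c_cont : continuous c.
Hypothesis h_baire : forall C, C `<=` K -> compact C ->
  forall O : set R, open O ->
  baire_property ([set x | O (h (val x))] : set (C : topologicalType)).

(** Off a meager set each band where [h] lies in [O k] agrees with an open set. A point over a
    generic pattern lies in such an open set, which thus contains all points over some cylinder. On
    the generic patterns there, [mu] is within 2 d of a constant: d from the band and d from the
    variation of [c]. The bound 8 * (2 d) is the 16 d below. *)
Theorem additive_category : mu xpredT = 0.
Proof.
suff mud (d : R) : 0 < d -> `|mu xpredT| <= 16 * d.
  apply/eqP; rewrite -normr_le0; apply/ler_addgt0Pl => e e0; rewrite addr0.
  by rewrite (le_trans (mud (e / 16) _))// ?divr_gt0// mulrC divfK.
move=> d0; have [U [Uo KUo Umin]] := irreducible_onto_cube Kc Ko.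
set C := K `\` U in KUo Umin.
have CK : C `<=` K by move=> x [].
have Cc : compact C.
  by rewrite /C setDE; apply: compact_closedI => //; exact: open_closedC.
(* Balls of radius d around the multiples of d cover the line, so countably many bands, hence
   countably many exceptional sets, suffice. *)
pose O (k : int) : set R := ball (k%:~R * d) d.
have /choice[V VP] k : exists V : set X * (nat -> set (C : topologicalType)),
    [/\ open V.1, forall n, nowhere_dense (V.2 n) &
    forall x : C, (forall n, ~ V.2 n x) -> O k (h (val x)) <-> V.1 (val x)].
  have [W [V Vo VW] [M Mn ME]] := h_baire CK Cc (ball_open (k%:~R * d : R^o) d).
  exists (V, M); split=> // x nM; split=> [Ox|Vx]; apply: contrapT => nx.
    have : ([set x0 | O k (h (\val x0))] `+` W) x.
      by left; split=> //; rewrite -VW.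
    by rewrite ME => -[n _ /nM].
  have : ([set x0 | O k (h (\val x0))] `+` W) x.
    by right; split=> //; rewrite -VW.
  by rewrite ME => -[n _ /nM].
pose N (j : int * nat) : set (I -> bool) :=
  [set A | exists2 x : C, (V j.1).2 j.2 x & pi (val x) = A].
have nN j : cube_nowhere_dense (N j).
  by apply: nowhere_dense_over_cube => //; have [_ + _] := VP j.1; apply.
have [F [a [_ Fdisj Fa]]] := cube_comeager [::] xpred0 nN.
have [x Cx xa] := KUo a.
(* The pattern [a] agrees with itself on every block: this is Baire's theorem for the cube. *)
have xN j : ~ N j a.
  by apply: Fa => // k; exists k.
pose k := Num.floor (h x / d).
have Ok : O k (h x).
  rewrite /O /ball/= ltr_norml; have := floor_itv (h x / d) => /andP[].
  rewrite -/k ler_pdivlMr// ltr_pdivrMr// rmorphD/= mulrDl mul1r => ? ?.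
  by apply/andP; split; lra.
have [Vo Vn VE] := VP k.
have Vx : (V k).1 x.
  have /VE[+ _] : forall n, ~ (V k).2 n (exist _ x (mem_set Cx)).
    by move=> n Mx; apply: (xN (k, n)); exists (exist _ x (mem_set Cx)).
  exact.
have cx : \forall y \near x, `|c x - c y| < d.
  by have /cvgrPdist_lt := @c_cont x; apply.
have [W [Wo Wx WV]] : exists W, [/\ open W, W x &
    W `<=` (V k).1 `&` [set y | `|c x - c y| < d]].
  have : nbhs x ((V k).1 `&` [set y | `|c x - c y| < d]).
    by apply: filterI cx; exact: open_nbhs_nbhs.
  by rewrite nbhsE => -[W [Wo Wx] WV]; exists W.
have [F0 [a0 FA]] := open_over_cube Cc Umin Wo Cx Wx.
rewrite (_ : 16 = 8 * 2)// -?mulrA; last by rewrite -natrM.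
apply: (@additive_almost_constant _ _ mu muD mu_finite _ N F0 a0
  (k%:~R * d - c x)) => //.
move=> B FB nB; have [y Cy yB] := KUo B.
have [|Vy cy] := WV y; first by apply: FA => //; rewrite yB.
have Oy : O k (h y).
  have /VE[_ +] : forall n, ~ (V k).2 n (exist _ y (mem_set Cy)).
    by move=> n Mx; apply: (nB (k, n)); exists (exist _ y (mem_set Cy)).
  exact.
move: Oy cy; rewrite /O /ball/= (hE (CK _ Cy)) yB !ltr_norml ler_norml.
by move=> /andP[? ?] /andP[? ?]; apply/andP; split; lra.
Qed.

End additive_category.

End compact_over_cube.

(** * Compactly supported functions and LUC(G) *)

Section compact_support.
Variables (X : topologicalType) (R : realType).
Implicit Types f g : X -> R.

Definition cc f := continuous f /\ exists2 K, compact K &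
  forall x, ~ K x -> f x = 0.

Lemma cc_le f g : cc f -> continuous g -> (forall x, f x = 0 -> g x = 0) ->
  cc g.
Proof. by move=> [_ [K Kc K0]] cg fg; split=> //; exists K => // x /K0/fg. Qed.

Lemma ccD f g : cc f -> cc g -> cc (fun x => f x + g x).
Proof.
move=> [cf [K Kc Kf]] [cg [L Lc Lg]]; split.
  by move=> x; apply: cvgD; [exact: cf|exact: cg].
exists (K `|` L); first exact: compactU.
by move=> x /not_orP[nK nL]; rewrite Kf// Lg// addr0.
Qed.

Lemma ccZ a f : cc f -> cc (fun x => a * f x).
Proof.
move=> cf; apply: (cc_le cf) => [x|x ->]; last by rewrite mulr0.
by apply: cvgM; [exact: cvg_cst|exact: cf.1].
Qed.

Lemma ccB f g : cc f -> cc g -> cc (fun x => f x - g x).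
Proof.
move=> cf cg; have := ccD cf (ccZ (-1) cg).
by under eq_fun do rewrite mulN1r.
Qed.

Lemma cc_min f g : cc f -> cc g -> cc (fun x => Num.min (f x) (g x)).
Proof.
move=> [cf [K Kc Kf]] [cg [L Lc Lg]]; split.
  by move=> x; apply: continuous_min; [exact: cf|exact: cg].
exists (K `|` L); first exact: compactU.
by move=> x /not_orP[nK nL]; rewrite Kf// Lg// minxx.
Qed.

Lemma cc_max f g : cc f -> cc g -> cc (fun x => Num.max (f x) (g x)).
Proof.
move=> [cf [K Kc Kf]] [cg [L Lc Lg]]; split.
  by move=> x; apply: continuous_max; [exact: cf|exact: cg].
exists (K `|` L); first exact: compactU.
by move=> x /not_orP[nK nL]; rewrite Kf// Lg// maxxx.
Qed.

Lemma cc0 : cc (fun=> 0).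
Proof. by split; [exact: cst_continuous|exists set0 => //;
  exact: compact0]. Qed.

Lemma cc_bounded f : cc f -> exists M, forall x, `|f x| <= M.
Proof.
move=> [cf [K Kc K0]].
have fKc : compact (f @` K : set R^o).
  by apply: continuous_compact => //; exact: continuous_subspaceT.
have /pinfty_ex_gt0[M _ fM] := compact_bounded fKc.
exists (Num.max M 0) => x; have [Kx|/K0 ->] := pselect (K x).
  by rewrite le_max fM//; exists x.
by rewrite normr0 le_max lexx orbT.
Qed.

Lemma compact_seq_cover (K : set X) (V : X -> set X) : compact K ->
  (forall x, K x -> nbhs x (V x)) ->
  exists s : seq X, forall y, K y -> exists2 x, x \in s & V x y.
Proof.
move=> /compact_near_coveringP Kc KV.
pose B (s : seq X) := [set s' : seq X | {subset s <= s'}].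
have FB : Filter (filter_from [set: seq X] B).
  apply: filter_from_filter; first by exists [::].
  move=> s s' _ _; exists (s ++ s') => // t st.
  by split=> x xs; apply: st; rewrite mem_cat xs ?orbT.
have [|s _ /(_ s (fun _ => id)) Ks] :=
    Kc _ (filter_from [set: seq X] B) (fun s x => exists2 z, z \in s & V z x) _.
  move=> x Kx; exists (V x, B [:: x]); first by split=> /=;
    [exact: KV|exists [:: x]].
  by move=> [y s] /= [Vy xs]; exists x => //; apply: xs; rewrite inE.
by exists s.
Qed.

Hypothesis (lcX : locally_compact [set: X]).

Lemma lc_nbhs (x : X) : exists2 C, nbhs x C & compact C.
Proof.
have [B Bx [Bc _]] := @lcX x I; exists B => //.
have : nbhs x [set y | [set: X] y -> B y] by exact: Bx.
by apply: filterS => y; exact.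
Qed.

Hypothesis hausX : hausdorff_space X.

Lemma cc_urysohn (x : X) (U : set X) : open U -> U x -> exists f,
  [/\ cc f, forall y, 0 <= f y <= 1, f x = 1 & forall y, ~ U y -> f y = 0].
Proof.
move=> Uo Ux; have [C Cx Cc] := lc_nbhs x.
pose V := U `&` interior C.
have Vo : open V by apply: openI => //; exact: open_interior.
have /(@uniform_separatorP _ R)[g [gc g01 gx gV]] :
  uniform_separator [set x] (~` V).
  apply: (@locally_compact_completely_regular X R lcX hausX).
    exact: open_closedC.
  by apply.
exists (fun y => 1 - g y); split.
- split; first by move=> y; apply: cvgB; [exact: cvg_cst|exact: gc].
  exists C => // y nCy; have -> : g y = 1; last by rewrite subrr.
  by apply: gV; exists y => // -[_ /interior_subset].
- by move=> y; have := g01 (g y) (imageP _ I); rewrite /= in_itv/=; lra.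
- have -> : g x = 0; last by rewrite subr0.
  by apply: gx; exists x.
- move=> y nU; have -> : g y = 1; last by rewrite subrr.
  by apply: gV; exists y => // -[].
Qed.

End compact_support.

Section luc_group.
Variables (R : realType) (G : topologicalGroupType).
Implicit Types (f : G -> R) (x y u : G).

Lemma mulgr_continuous (a : G) : continuous (fun x : G => (x * a)%g).
Proof.
move=> y; apply: (@continuous_comp _ _ _ (fun y => (y, a))
  (fun p : G * G => (p.1 * p.2)%g)); last exact: mulg_continuous.
by apply: cvg_pair => /=; [exact: cvg_id|exact: cvg_cst].
Qed.

Lemma mulgl_continuous (a : G) : continuous (fun x : G => (a * x)%g).
Proof.
move=> y; apply: (@continuous_comp _ _ _ (fun y => (a, y))
  (fun p : G * G => (p.1 * p.2)%g)); last exact: mulg_continuous.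
by apply: cvg_pair => /=; [exact: cvg_cst|exact: cvg_id].
Qed.

Lemma nbhs1_inv (A : set G) : nbhs (1 : G)%g A ->
  nbhs (1 : G)%g [set u | A (u^-1)%g].
Proof. by move=> A1; apply: (@invg_continuous G 1%g A); rewrite /= invg1. Qed.

Lemma nbhs1_div (A : set G) x : nbhs (1 : G)%g A ->
  nbhs x [set y | A (y * x^-1)%g].
Proof. by move=> A1; apply: (@mulgr_continuous x^-1%g x A); rewrite mulgV. Qed.

Section near_pseudometric.
Variable f : G -> R.
Hypothesis f_bounded : exists M, forall x, `|f x| <= M.
Hypothesis f_near : forall e : R, 0 < e ->
  nbhs (1 : G)%g [set u | forall x, `|f (u * x)%g - f x| < e].

(** The least right-invariant pseudometric for which [f] is 1-Lipschitz. *)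
Let d x y := sup (range (fun z => `|f (x * z)%g - f (y * z)%g|)).

Let d_ub x y z : `|f (x * z)%g - f (y * z)%g| <= d x y.
Proof.
have [M fM] := f_bounded; apply: ub_le_sup; last by exists z.
exists (M + M) => _ [t _ <-]; rewrite (le_trans (ler_normB _ _))//.
by rewrite lerD.
Qed.

Let d_le x y e : (forall z, `|f (x * z)%g - f (y * z)%g| <= e) -> d x y <= e.
Proof.
by move=> H; apply: ge_sup => [|_ [z _ <-]//];
  exists `|f (x * 1)%g - f (y * 1)%g|; exists 1%g.
Qed.

Let dP : pseudometric d.
Proof.
split.
- by move=> x y; apply: le_trans (d_ub x y 1%g).
- move=> x; apply/eqP; rewrite eq_le; apply/andP; split.
    by apply: d_le => z; rewrite subrr normr0.
  exact: le_trans (normr_ge0 _) (d_ub x x 1%g).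
- by move=> x y; rewrite /d; under eq_fun do rewrite distrC.
- move=> y x z; apply: d_le => t.
  by apply: le_trans (ler_distD (f (y * t)%g) _ _) _; rewrite lerD.
Qed.

Let d_inv : right_invariant d.
Proof.
move=> x y z; apply/eqP; rewrite eq_le; apply/andP; split; apply: d_le => t.
    by have := d_ub (x * z)%g (y * z)%g (z^-1 * t)%g; rewrite -!mulgA !mulVKg.
by rewrite -!mulgA.
Qed.

Lemma near_pseudometric : is_luc (f : G -> R^o).
Proof.
apply/is_lucP; split=> // e e0; exists d; last first.
  exists e => // x y; apply: le_lt_trans.
  by have := d_ub x y 1%g; rewrite !mulg1.
split=> // -[x0 y0] /=; apply/(@cvgrPdist_le _ R^o) => r r0.
have r2 : 0 < r / 2 by rewrite divr_gt0.
have near1 x : \forall y \near x, d y x <= r / 2.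
  have := nbhs1_div x (f_near r2); apply: filterS => y /= yx.
  rewrite (d_inv _ _ x^-1%g) mulgV; apply: d_le => z; rewrite mul1g.
  exact/ltW/yx.
have : nbhs (x0, y0) [set p : G * G | d p.1 x0 <= r / 2 /\ d p.2 y0 <= r / 2].
  by exists ([set y | d y x0 <= r / 2], [set y | d y y0 <= r / 2]);
    [split; exact: near1|].
apply: filterS => -[x y] /= [xx0 yy0].
have [_ _ s t] := dP.
have := t x x0 y0; have := t y x y0; have := t x0 x y; have := t y0 x0 y.
rewrite (s x0 x) (s y0 y) => ? ? ? ?.
by rewrite ler_norml; apply/andP; split; lra.
Qed.

End near_pseudometric.

(** By right invariance the distance of u x and x is that of u and 1, so only the left multiplier
    matters. This form replaces pseudometrics in the later estimates. *)
Lemma luc_near f : is_luc (f : G -> R^o) <->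
  (exists M, forall x, `|f x| <= M) /\
  forall e : R, 0 < e ->
    nbhs (1 : G)%g [set u | forall x, `|f (u * x)%g - f x| < e].
Proof.
split=> [/is_lucP[fb uf]|[fb fe]]; last exact: near_pseudometric.
split=> // e /uf[d [[_ d0 _ _] dinv dc] [r r0 H]].
have : nbhs (1 : G)%g [set u | d u 1%g < r].
  have /(@cvgrPdist_lt _ R^o)/(_ _ r0) := dc (1%g, 1%g).
  move=> [[A B] /= [A1 B1] AB]; apply: filterS A1 => u Au.
  have := AB (u, 1%g) (conj Au (nbhs_singleton B1)).
  by rewrite /= d0 sub0r normrN; apply: le_lt_trans; exact: ler_norm.
apply: filterS => u ur x; apply: H.
by rewrite -{2}[x]mul1g -dinv.
Qed.

Lemma luc_continuous f : is_luc (f : G -> R^o) -> continuous f.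
Proof.
move=> /luc_near[_ fe] x; apply/(@cvgrPdist_lt _ R^o) => e /fe/(nbhs1_div x).
by apply: filterS => y /(_ x); rewrite /= mulgVK distrC.
Qed.

Lemma cc_luc f : cc f -> is_luc (f : G -> R^o).
Proof.
move=> fcc; apply/luc_near; split; first exact: cc_bounded.
have [fc [K Kc K0]] := fcc.
move=> e e0.
have near_K :
    nbhs (1 : G)%g [set u | forall x, K x -> `|f (u * x)%g - f x| < e].
  have /compact_near_coveringP := Kc.
  move=> /(_ G (nbhs (1 : G)%g) (fun u x => `|f (u * x)%g - f x| < e)); apply.
  move=> x Kx.
  have e2 : 0 < e / 2 by rewrite divr_gt0.
  have /(@cvgrPdist_lt _ R^o)/(_ _ e2) fx := fc x.
  have fmc : {for ((1 : G)%g, x),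
    continuous (fun p : G * G => f (p.1 * p.2)%g)}.
    apply: (@continuous_comp _ _ _ (fun p : G * G => (p.1 * p.2)%g) f).
      exact: (@mulg_continuous G).
    exact: fc.
  have /(@cvgrPdist_lt _ R^o)/(_ _ e2) := fmc.
  rewrite mul1g => -[[A B] /= [A1 Bx] AB].
  exists (B `&` [set x' | `|f x - f x'| < e / 2], A); first by split=> //;
    exact: filterI.
  move=> [x' u] /= [[Bx' fx'] Au]; have /= fux' := AB (u, x') (conj Au Bx').
  rewrite [e]splitr (le_lt_trans (ler_distD (f x) _ _))// ltrD// distrC//.
near=> u => x.
have [Kx|nKx] := pselect (K x).
  by move: x Kx; near: u.
(* If only [u * x] lies in [K], the estimate on [K] is applied at [u * x] to the inverse of [u]. *)
have [Kux|nKux] := pselect (K (u * x)%g).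
  rewrite -{2}[x](mulKg u) distrC; move: (u * x)%g Kux; near: u.
  exact: nbhs1_inv near_K.
by rewrite !K0// subrr normr0.
Unshelve. all: by end_near. Qed.

End luc_group.

(** * The Riesz representation theorem *)

Section positive_functional.
Variables (X : topologicalType) (R : realType).
Hypotheses (lcX : locally_compact [set: X]) (hausX : hausdorff_space X).
Implicit Types (f g h k l : X -> R) (U V : set X).

Definition cc_pos f := cc f /\ forall x, 0 <= f x.

Record bounded_positive (P : (X -> R) -> R) (M : R) : Prop := BoundedPositive {
  positive_ge0 : forall f, cc_pos f -> 0 <= P f ;
  positiveD : forall f g, cc_pos f -> cc_pos g ->
    P (fun x => f x + g x) = P f + P g ;
  positiveZ : forall a f, 0 <= a -> cc_pos f -> P (fun x => a * f x) = a * P f ;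
  positive_le : forall f, cc_pos f -> (forall x, f x <= 1) -> P f <= M
}.

Variables (P : (X -> R) -> R) (M : R).
Hypothesis PM : bounded_positive P M.
Let P_ge0 := positive_ge0 PM.
Let PD := positiveD PM.
Let PZ := positiveZ PM.
Let P_le := positive_le PM.

Lemma cc_posD f g : cc_pos f -> cc_pos g -> cc_pos (fun x => f x + g x).
Proof. by move=> [fc f0] [gc g0]; split=> [|x];
  [exact: ccD|rewrite addr_ge0]. Qed.

Lemma cc_posZ a f : 0 <= a -> cc_pos f -> cc_pos (fun x => a * f x).
Proof. by move=> a0 [fc f0]; split=> [|x]; [exact: ccZ|rewrite mulr_ge0]. Qed.

Lemma positive_mono f g : cc_pos f -> cc_pos g -> (forall x, f x <= g x) ->
  P f <= P g.
Proof.
move=> fc gc fg; have gfc : cc_pos (fun x => g x - f x).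
  by split=> [|x]; [apply: ccB; [exact: gc.1|exact: fc.1]|rewrite subr_ge0].
have -> : g = (fun x => f x + (g x - f x)) by apply/funext => x;
  rewrite addrC subrK.
by rewrite PD// lerDl P_ge0.
Qed.

Lemma cc_pos0 : cc_pos (fun=> 0). Proof. by split=> //; exact: cc0. Qed.

Lemma positive0 : P (fun=> 0) = 0.
Proof.
by have := PZ (lexx 0) cc_pos0; under eq_fun do rewrite mul0r; rewrite mul0r.
Qed.

Lemma cc_pos_sum n (k : nat -> X -> R) : (forall i, cc_pos (k i)) ->
  cc_pos (fun x => \sum_(i < n) k i x).
Proof.
move=> kc; elim: n => [|n IH].
  by under eq_fun do rewrite big_ord0; exact: cc_pos0.
by under eq_fun do rewrite big_ord_recr/=; exact: cc_posD.
Qed.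

Lemma positive_sum n (k : nat -> X -> R) : (forall i, cc_pos (k i)) ->
  P (fun x => \sum_(i < n) k i x) = \sum_(i < n) P (k i).
Proof.
move=> kc; elim: n => [|n IH].
  by under eq_fun do rewrite big_ord0; rewrite big_ord0 positive0.
under eq_fun do rewrite big_ord_recr/=.
by rewrite PD ?IH ?big_ord_recr//; exact: cc_pos_sum.
Qed.

(** These functions vanish off [U], but their supports may reach its boundary; this is why later
    arguments cut them at a small height [d]. *)
Definition bumps U :=
  [set h | [/\ cc_pos h, forall x, h x <= 1 & forall x, ~ U x -> h x = 0]].

Definition open_content U : R := sup [set P h | h in bumps U].

Lemma bumps0 U : bumps U (fun=> 0).
Proof. by split=> //; exact: cc_pos0. Qed.

Lemma bumps_sub U V : U `<=` V -> bumps U `<=` bumps V.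
Proof. by move=> UV h [? ? h0]; split=> // x nV; apply: h0 => /UV. Qed.

Lemma open_content_ub U h : bumps U h -> P h <= open_content U.
Proof.
move=> hU; apply: ub_le_sup; last by exists h.
by exists M => _ [k [kc k1 _] <-]; exact: P_le.
Qed.

Lemma open_content_le U a : (forall h, bumps U h -> P h <= a) ->
  open_content U <= a.
Proof.
by move=> H; apply: ge_sup => [|_ [h /H ? <-]//];
  exists (P (fun=> 0)), (fun=> 0) => //; exact: bumps0.
Qed.

Lemma open_content_ge0 U : 0 <= open_content U.
Proof. by rewrite -positive0; apply: open_content_ub; exact: bumps0. Qed.

Lemma open_content_leM U : open_content U <= M.
Proof. by apply: open_content_le => h [hc h1 _]; exact: P_le. Qed.

Lemma open_content_set0 : open_content set0 = 0.
Proof.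
apply/eqP; rewrite eq_le open_content_ge0 andbT;
  apply: open_content_le => h [_ _ h0].
by rewrite (_ : h = fun=> 0) ?positive0//; apply/funext => x; exact: h0.
Qed.

Lemma open_content_adherent U e : 0 < e -> exists2 h, bumps U h &
  open_content U - e < P h.
Proof.
move=> e0; have : has_sup [set P h | h in bumps U].
  split; first by exists (P (fun=> 0)), (fun=> 0) => //; exact: bumps0.
  by exists M => _ [k [kc k1 _] <-]; exact: P_le.
by move=> /(sup_adherent e0)[_ [h hU <-] ?]; exists h.
Qed.

(** On the compact set where h >= d, finitely many bumps of the [A n] have a sum above h - d. What
    remains is below min(h, d), and this costs at most d M <= e. *)
Lemma open_content_sigma_subadditive (A : nat -> set X) h e :
  (forall n, open (A n)) -> bumps (\bigcup_n A n) h -> 0 < e ->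
  exists N, P h <= \sum_(n < N) open_content (A n) + e.
Proof.
move=> Ao [[hc h0] h1 hA] e0.
have M0 : 0 <= M by apply: le_trans (open_content_leM setT);
  exact: open_content_ge0.
pose d := e / (M + 1).
have d0 : 0 < d by rewrite divr_gt0// ltr_wpDl.
have dM : d * M <= e.
  by rewrite /d mulrAC ler_pdivrMr ?ltr_wpDl// ler_pM2l// lerDl.
have [hcont [K Kc K0]] := hc.
pose C := K `&` [set x | d <= h x].
have Cc : compact C.
  apply: compact_closedI => //;
    apply: (@preimage_closed _ _ h [set r | d <= r]).
    by move=> x _; exact: hcont.
  exact: closed_ge.
(* An index is a family of bumps with a number of terms. Pointwise maxima make the indices directed,
   so that local choices over [C] merge into a single one. *)
pose D : set ((nat -> X -> R) * nat) := [set i | forall n, bumps (A n) (i.1 n)].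
pose B (i : (nat -> X -> R) * nat) := D `&`
  [set j | (forall n x, i.1 n x <= j.1 n x) /\ (i.2 <= j.2)%N].
have FB : ProperFilter (filter_from D B).
  apply: filter_from_proper => [|i Di]; last by exists i.
  apply: filter_from_filter.
    by exists (fun _ _ => 0, 0%N) => n; exact: bumps0.
  move=> i j Di Dj.
  exists (fun n x => Num.max (i.1 n x) (j.1 n x), maxn i.2 j.2).
    move=> n /=; have [[ic i0] i1 iA] := Di n; have [[jc j0] j1 jA] := Dj n.
    split; first by split=> [|x]; [exact: cc_max|rewrite le_max i0].
      by move=> x; rewrite ge_max i1 j1.
    by move=> x nA; rewrite iA// jA// maxxx.
  move=> k [Dk [kn k2]]; split; split=> //; split.
  - by move=> n x; apply: le_trans (kn n x); rewrite le_max lexx.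
  - by apply: leq_trans k2; rewrite leq_maxl.
  - by move=> n x; apply: le_trans (kn n x); rewrite le_max lexx orbT.
  - by apply: leq_trans k2; rewrite leq_maxr.
have /compact_near_coveringP := Cc.
move=> /(_ _ (filter_from D B) (fun i x => h x - d <= \sum_(n < i.2) i.1 n x)).
case.
  move=> x [Kx dx].
  have [n _ An] : (\bigcup_n A n) x.
    by apply: contrapT => /hA hx; move: dx; rewrite /= hx leNgt d0.
  have [u [uc u01 ux uA]] := cc_urysohn R lcX hausX (Ao n) An.
  pose i0 := (fun m => if m == n then u else (fun=> 0), n.+1).
  have Di0 : D i0.
    move=> m; rewrite /i0/=; case: eqP => [->|_]; last exact: bumps0.
    by split=> // [|y]; [split=> // y|]; have /andP[] := u01 y.
  have ux' : \forall y \near x, 1 - d < u y.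
    have /(@cvgrPdist_lt _ R^o)/(_ _ d0) := uc.1 x.
    by apply: filterS => y; rewrite ux ltr_norml => /andP[? ?]; lra.
  exists ([set y | 1 - d < u y], B i0); first by split=> //; exists i0.
  move=> [y i] /= [uy [Di [ile i2]]].
  have ni2 : (n < i.2)%N by [].
  rewrite (bigD1 (Ordinal ni2))//=.
  have iy : u y <= i.1 n y by have := ile n y; rewrite /= eqxx.
  have s0 : 0 <= \sum_(m < i.2 | m != Ordinal ni2) i.1 m y.
    by apply: sumr_ge0 => m _; have [[_ +] _ _] := Di m; apply.
  by have := h1 y; lra.
move=> i0 Di0 /(_ i0 (conj Di0 (conj (fun _ _ => lexx _) (leqnn _)))) hC.
exists i0.2.
pose w x := Num.min (h x) d.
have wc : cc_pos w.
  split=> [|x]; last by rewrite le_min h0 ltW.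
  apply: (cc_le hc) => [x|x hx]; last by rewrite /w hx; apply/min_idPl/ltW.
  exact: (continuous_min (@hcont x) (@cst_continuous _ R^o d x)).
have ic n : cc_pos (i0.1 n) by have [] := Di0 n.
apply: (@le_trans _ _ (P (fun x => \sum_(n < i0.2) i0.1 n x + w x))).
  apply: positive_mono => // [|x]; first by apply: cc_posD => //;
    exact: cc_pos_sum.
  have s0 : 0 <= \sum_(n < i0.2) i0.1 n x.
    by apply: sumr_ge0 => m _; have [_] := ic m.
  rewrite /w minEle; case: (leP (h x) d) => [_|hd]; first by rewrite lerDr.
  rewrite -lerBlDr hC//; split; last exact: ltW.
  apply: contrapT => /K0 hx; move: hd; rewrite hx => /lt_le_trans /(_ (ltW d0)).
  by rewrite ltxx.
rewrite PD//; last exact: cc_pos_sum.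
rewrite positive_sum// lerD//; first by apply: ler_sum => n _;
  exact: open_content_ub.
have -> : w = (fun x => d * (d^-1 * w x)) by apply/funext => x;
  rewrite mulVKf// gt_eqF.
have dw : cc_pos (fun x => d^-1 * w x) by apply: cc_posZ => //;
  rewrite invr_ge0 ltW.
rewrite (PZ (ltW d0) dw); apply: le_trans dM; rewrite ler_pM2l//;
  apply: P_le => // x.
by rewrite mulrC ler_pdivrMr// mul1r ge_min lexx orbT.
Qed.

(** As [V] minus [U] need not be open, it is enlarged to the part of [V] where k < d, with k a
    nearly optimal bump of the intersection. A bump l of this set satisfies k + l <= 1 + d, so (k +
    l) / (1 + d) is a bump of [V]. This is the Caratheodory inequality for open sets up to [e]. *)
Lemma open_content_split V U e : open V -> open U -> 0 < e -> exists W,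
  [/\ open W, V `\` U `<=` W &
    open_content (V `&` U) + open_content W <= open_content V + e].
Proof.
move=> Vo Uo e0.
have M0 : 0 <= M by apply: le_trans (open_content_leM setT);
  exact: open_content_ge0.
pose d := e / 2 / (M + 1).
have d0 : 0 < d by rewrite !divr_gt0// ltr_wpDl.
have dM : d * M <= e / 2.
  by rewrite /d mulrAC ler_pdivrMr ?ltr_wpDl// ler_pM2l ?divr_gt0// lerDl.
have e2 : 0 < e / 2 by rewrite divr_gt0.
have [k [[kc k0] k1 kVU] kP] := open_content_adherent (V `&` U) e2.
exists (V `&` [set x | k x < d]); split.
- apply: openI => //; apply: (@open_comp _ _ k [set r | r < d]);
    last exact: open_lt.
  by move=> x _; exact: kc.1.
- by move=> x [Vx nUx]; split=> //=; rewrite kVU// => -[].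
suff : open_content (V `&` [set x | k x < d]) <= open_content V + d * M - P k.
  by lra.
apply: open_content_le => l [[lc l0] l1 lW]; rewrite lerBrDr addrC.
have d1 : 0 < 1 + d by rewrite ltr_wpDl.
have klc : cc_pos (fun x => k x + l x) by exact: cc_posD.
rewrite -PD//.
have -> : (fun x => k x + l x) =
    (fun x => (1 + d) * ((1 + d)^-1 * (k x + l x))).
  by apply/funext => x; rewrite mulVKf// gt_eqF.
have klc' : cc_pos (fun x => (1 + d)^-1 * (k x + l x)).
  by apply: cc_posZ => //; rewrite invr_ge0 ltW.
have famV : bumps V (fun x => (1 + d)^-1 * (k x + l x)).
  split=> // x; last by move=> nV; rewrite kVU ?lW ?addr0 ?mulr0// => -[].
  rewrite mulrC ler_pdivrMr// mul1r.
  have [kd|kd] := ltP (k x) d; first by rewrite addrC lerD ?l1// ltW.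
  rewrite (lW x) ?addr0; last by move=> [_ /=]; rewrite ltNge kd.
  by rewrite (le_trans (k1 x))// lerDl ltW.
rewrite (PZ (ltW d1) klc') mulrDl mul1r lerD ?open_content_ub//.
by rewrite ler_pM2l//; have [? ? _] := famV; exact: P_le.
Qed.

End positive_functional.

Section riesz_measure.
Variables (R : realType) (G : topologicalGroupType).
Hypotheses (lcG : locally_compact [set: G]) (hausG : hausdorff_space G).
Variables (P : (G -> R) -> R) (M : R).
Hypothesis PM : bounded_positive P M.
Local Open Scope ereal_scope.

(** The value [+oo] makes all covers by sets that are not open irrelevant in [mu_ext], which thus
    becomes an infimum over open covers. *)
Let q (A : set (borel G)) : \bar R :=
  if `[< open (A : set G) >] then (open_content P A)%:E else +oo.

Let q_open A : open (A : set G) -> q A = (open_content P A)%:E.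
Proof. by move=> Ao; rewrite /q asboolT. Qed.

Let q0 : q set0 = 0.
Proof. by rewrite q_open ?(open_content_set0 PM)//; exact: open0. Qed.

Let q_ge0 A : 0 <= q A.
Proof. by rewrite /q; case: ifP => // _;
  rewrite lee_fin (open_content_ge0 PM). Qed.

Let nu : set (borel G) -> \bar R := mu_ext q.

Lemma open_borel (U : set G) : open U -> measurable (U : set (borel G)).
Proof. by move=> Uo; exact: sub_sigma_algebra. Qed.

Lemma closed_borel (U : set G) : closed U -> measurable (U : set (borel G)).
Proof.
move=> Uc; rewrite -[U]setCK; apply: measurableC; apply: open_borel.
exact: closed_openC.
Qed.

Let cover_content U (F : nat -> set G) : (forall n, open (F n)) ->
  U `<=` \bigcup_n F n -> (open_content P U)%:E <= \sum_(0 <= k <oo) q (F k).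
Proof.
move=> Fo UF; apply/lee_addgt0Pr => e e0.
have [c cE cU] : exists2 c : R, (open_content P U - e = c)%R &
  (c <= open_content P U)%R.
  by exists (open_content P U - e)%R => //; rewrite gerDl oppr_le0 ltW.
have e2 : (0 < e / 2)%R by rewrite divr_gt0.
have [h hU hP] := open_content_adherent PM U e2.
have [N hN] := open_content_sigma_subadditive lcG hausG PM Fo
  (bumps_sub UF hU) e2.
have : (open_content P U)%:E <= (\sum_(n < N) open_content P (F n) + e)%:E.
  by rewrite lee_fin; lra.
move=> /le_trans; apply; rewrite EFinD leeD2r//.
apply: le_trans (@nneseries_lim_ge _ _ xpredT 0 N _); last by move=> n _ _;
  exact: q_ge0.
by rewrite big_mkord -sumEFin; apply: lee_sum => i _; rewrite q_open.
Qed.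

Lemma riesz_nu_open U : open U -> nu U = (open_content P U)%:E.
Proof.
move=> Uo; apply/eqP; rewrite eq_le; apply/andP; split.
  apply: ereal_inf_lbound; exists (fun n => if n is 0 then U else set0).
    split; last by move=> x Ux; exists 0%N.
    by case=> [|n]; [exact: open_borel|exact: measurable0].
  rewrite (@nneseries_split _ _ 0 1)//= ?add0n.
  rewrite big_nat1 q_open// eseries0 ?adde0//.
  by move=> [|n] //.
apply: le_ereal_inf_tmp => _ [F [Fm UF] <-].
have [Fo|/existsNP[n nFo]] := pselect (forall n, open (F n : set G)).
  exact: cover_content.
rewrite (@nneseries_pinfty _ _ xpredT n) ?leey//.
by rewrite /q; case: asboolP.
Qed.

Lemma riesz_nu_outer A e : nu A \is a fin_num -> (0 < e)%R -> exists U,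
  [/\ open U, A `<=` U & (open_content P U)%:E <= nu A + e%:E].
Proof.
move=> Afin e0; have [_ [F [Fm AF] <-] lt] := lb_ereal_inf_adherent e0 Afin.
have Fo n : open (F n : set G).
  apply: contrapT => nFo; move: lt; rewrite (@nneseries_pinfty _ _ xpredT n)//.
    by rewrite ltNge leey.
  by rewrite /q; case: asboolP.
exists (\bigcup_n F n); split=> //; first exact: bigcup_open.
by apply: le_trans (ltW lt); exact: cover_content.
Qed.

Lemma riesz_nu_le A : nu A <= M%:E.
Proof.
apply: (@le_trans _ _ (nu setT)); first exact: le_mu_ext.
by rewrite riesz_nu_open ?lee_fin ?(open_content_leM PM)//; exact: openT.
Qed.

Lemma riesz_nu_fin A : nu A \is a fin_num.
Proof.
rewrite ge0_fin_numE; first exact: le_lt_trans (riesz_nu_le A) (ltry _).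
exact: mu_ext_ge0.
Qed.

Let nu_outer : {outer_measure set (borel G) -> \bar R} :=
  HB.pack nu (isOuterMeasure.Build R (borel G) nu (mu_ext0 q0 q_ge0)
    (mu_ext_ge0 q_ge0) (@le_mu_ext _ _ _ q) (mu_ext_sigma_subadditive q_ge0)).

Let open_caratheodory U : open (U : set G) -> nu_outer.-caratheodory U.
Proof.
move=> Uo; apply: le_caratheodory_measurable => A /=.
apply/lee_addgt0Pr => e e0; have e2 : (0 < e / 2)%R by rewrite divr_gt0.
have [V [Vo AV VA]] := riesz_nu_outer (riesz_nu_fin A) e2.
have [W [Wo VUW cW]] := open_content_split PM Vo Uo e2.
apply: (@le_trans _ _ ((open_content P (V `&` U))%:E + (open_content P W)%:E)).
  rewrite leeD//.
    rewrite -riesz_nu_open; last exact: openI.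
    by apply: le_mu_ext; exact: setSI.
  rewrite -riesz_nu_open//; apply: le_mu_ext => x [Ax nUx]; apply: VUW.
  by split=> //; exact: AV.
rewrite -EFinD; apply: (@le_trans _ _ ((open_content P V)%:E + (e / 2)%:E)).
  by rewrite -EFinD lee_fin.
rewrite (_ : e%:E = (e / 2)%:E + (e / 2)%:E) ?addeA ?leeD2r//.
by rewrite -EFinD -splitr.
Qed.

Let borel_caratheodory (A : set (borel G)) : measurable A ->
  nu_outer.-caratheodory A.
Proof.
move: A; apply: smallest_sub; last exact: open_caratheodory.
split.
- exact: caratheodory_measurable_set0.
- by move=> A mA; rewrite setTD; exact: caratheodory_measurable_setC.
- by move=> F mF; exact: caratheodory_measurable_bigcup.
Qed.

Let nu_sigma_additive : semi_sigma_additive (nu : set (borel G) -> \bar R).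
Proof.
move=> F mF tF mUF.
apply: (@caratheodory_measure_sigma_additive R (borel G) nu_outer) => //.
  by move=> i; exact: (borel_caratheodory (mF i)).
exact: (borel_caratheodory mUF).
Qed.

Lemma riesz_measure_exists : exists mu : {measure set (borel G) -> \bar R},
  [/\ mu setT <= M%:E, forall U, open U -> mu U = (open_content P U)%:E &
      forall A e, (0 < e)%R ->
        exists U, [/\ open U, A `<=` U & (mu U <= mu A + e%:E)]].
Proof.
pose mu : {measure set (borel G) -> \bar R} := HB.pack nu
  (isMeasure.Build _ _ _ nu (mu_ext0 q0 q_ge0) (mu_ext_ge0 q_ge0)
    nu_sigma_additive).
exists mu; split; [exact: riesz_nu_le|exact: riesz_nu_open|].
move=> A e e0; have [U [Uo AU UA]] := riesz_nu_outer (riesz_nu_fin A) e0.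
by exists U; split=> //; rewrite -riesz_nu_open in UA.
Qed.

End riesz_measure.

Section riesz_representation.
Variables (R : realType) (G : topologicalGroupType).
Hypotheses (lcG : locally_compact [set: G]) (hausG : hausdorff_space G).
Variables (P : (G -> R) -> R) (M : R).
Hypothesis PM : bounded_positive P M.
Variable mu : {measure set (borel G) -> \bar R}.
Hypothesis mu_open : forall U : set G, open U -> mu U = (open_content P U)%:E.
Hypothesis mu_outer : forall (A : set (borel G)) (e : R), 0 < e ->
  exists U : set G, [/\ open U, A `<=` U & (mu U <= mu A + e%:E)%E].
Local Open Scope ereal_scope.

Let mu_fin A : measurable A -> mu A \is a fin_num.
Proof.
move=> mA; rewrite ge0_fin_numE//.
apply: le_lt_trans (ltry (open_content P [set: G])); rewrite -mu_open;
  last exact: openT.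
by apply: le_measure; rewrite ?inE.
Qed.

(** Let [C] carry a nearly optimal bump h of the whole space. For a bump l of the complement of [C],
    h + l is again a bump, so P l fits into the gap left by P h. *)
Lemma riesz_tight (e : R) : (0 < e)%R ->
  exists2 C : set G, compact C & mu (~` C) <= e%:E.
Proof.
move=> e0; have [h hT hP] := open_content_adherent PM [set: G] e0.
have [[[hc [C Cc Ch]] h0] h1 _] := hT; exists C => //.
have Co : open (~` C) by apply: closed_openC; exact: compact_closed.
rewrite mu_open// lee_fin; apply: open_content_le => l [lc l1 lC].
suff : (P h + P l <= open_content P [set: G])%R by lra.
rewrite -(positiveD PM)//; last by case: hT.
apply: (open_content_ub PM); split=> [|x|x /(_ I)//].
  by apply: cc_posD => //; case: hT.
have [Cx|/Ch ->] := pselect (C x); last by rewrite add0r.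
by rewrite (lC x) ?addr0//; exact.
Qed.

(** Outer regularity is applied to the complement of A: if the open set [U] exceeds it by little,
    then [C] minus [U], with [C] from tightness, is compact, lies in A and misses little of it. *)
Lemma riesz_radon : radon_measure mu.
Proof.
move=> A mA; apply/eqP; rewrite eq_le; apply/andP; split; last first.
  apply: ge_ereal_sup => _ [K [Kc KA] <-]; apply: le_measure; rewrite ?inE//.
  by apply: closed_borel; exact: compact_closed.
apply/lee_addgt0Pr => e e0; have e2 : (0 < e / 2)%R by rewrite divr_gt0.
have [C Cc muC] := riesz_tight e2.
have [U [Uo AU muU]] := mu_outer (~` A) e2.
have mU := open_borel Uo.
have Cm : measurable (C : set (borel G)).
  by apply: closed_borel; exact: compact_closed.
have muAU : mu (A `&` U) <= (e / 2)%:E.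
  have mAC := measurableC mA; have mAU := measurableI _ _ mA mU.
  have UE : U = (A `&` U) `|` ~` A.
    apply/seteqP; split=> [x Ux|x [[]|/AU]//].
    by have [Ax|nAx] := pselect (A x); [left|right].
  have := muU; rewrite {1}UE (measureU _ mAU mAC).
    by rewrite addeC leeD2lE// mu_fin.
  by rewrite -setIA (setIC U) setIA setICr set0I.
pose K := C `&` ~` U.
have Kc : compact (K : set G).
  by apply: compact_closedI => //; exact: open_closedC.
have KA : K `<=` A by move=> x [_ nUx]; apply: contrapT => /AU.
have Km : measurable (K : set (borel G)).
  by apply: measurableI => //; exact: measurableC.
apply: (@le_trans _ _ (mu (K `|` ((A `&` U) `|` ~` C)))).
  apply: le_measure; rewrite ?inE//.
    apply: measurableU => //; apply: measurableU; first exact: measurableI.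
    exact: measurableC.
  move=> x Ax; have [Ux|nUx] := pselect (U x); first by right; left.
  by have [Cx|nCx] := pselect (C x); [left|right; right].
have mC := measurableC Cm; have mAU := measurableI _ _ mA mU.
apply: (le_trans (measureU2 _ _ _)) => //; first exact: measurableU.
rewrite leeD//; first by apply: ereal_sup_ubound; exists K.
apply: (le_trans (measureU2 _ _ _)) => //.
by rewrite [e in leRHS]splitr EFinD leeD.
Qed.

Let layer (t : R) (k : nat) : R := Num.min (Num.max (t - k%:R)%R 0%R) 1%R.

Let layer01 t k : (0 <= layer t k <= 1)%R.
Proof. by rewrite /layer le_min ler01 le_max lexx orbT/= ge_min lexx orbT. Qed.

Let layer0 t k : (t <= k%:R)%R -> layer t k = 0%R.
Proof.
move=> tk; rewrite /layer (_ : Num.max _ _ = 0)%R; last first.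
  by apply/max_idPr; rewrite subr_le0.
by apply/min_idPl.
Qed.

Let layer1 t k : (k.+1%:R <= t)%R -> layer t k = 1%R.
Proof.
move=> kt; rewrite /layer; apply/min_idPr; rewrite le_max lerBrDl.
by rewrite -natr1 in kt; rewrite kt.
Qed.

Let layer_sum t n : (0 <= t)%R -> (\sum_(k < n) layer t k)%R = Num.min t n%:R%R.
Proof.
move=> t0; elim: n => [|n IH].
  by rewrite big_ord0; apply/esym/min_idPr.
rewrite big_ord_recr/= IH /layer -natr1.
have [tn|tn] := leP t n%:R.
  rewrite (_ : Num.max _ _ = 0)%R; last by apply/max_idPr; rewrite subr_le0.
  rewrite (_ : Num.min 0 1 = 0)%R; last by apply/min_idPl.
  by rewrite addr0; apply/esym/min_idPl; lra.
rewrite (_ : Num.max _ _ = t - n%:R)%R; last by apply/max_idPl;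
  rewrite subr_ge0 ltW.
have [tn1|tn1] := leP (t - n%:R)%R 1%R.
  by rewrite addrC subrK; apply/esym/min_idPl; lra.
by apply/esym/min_idPr; lra.
Qed.

Lemma continuous_borel (f : G -> R) : continuous f ->
  measurable_fun [set: borel G] (f : borel G -> R).
Proof.
move=> fc; apply: (measurability _ (RGenOInfty.measurableE R)).
move=> _ [_ [a ->] <-]; rewrite setTI; apply: open_borel.
apply: (@open_comp _ _ f `]a, +oo[); first by move=> x _; exact: fc.
exact: interval_open.
Qed.

(** Cut n f into layers of height 1. Both [P] and the integral of layer k lie between the contents
    of [V k.+1] and [V k], so the sums differ by a telescoping error of at most M. This holds for
    every n, and dividing by n makes the error small. *)
Theorem riesz_integral f : cc_pos f -> \int[mu]_x (f x)%:E = (P f)%:E.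
Proof.
move=> fcp; have [fcc f0] := fcp; have [fc _] := fcc.
have M0 : (0 <= M)%R.
  exact: le_trans (open_content_ge0 PM setT) (open_content_leM PM setT).
have [B fB] := cc_bounded fcc.
have If0 : 0 <= \int[mu]_x (f x)%:E.
  by apply: integral_ge0 => x _; rewrite lee_fin.
have key n : (0 < n)%N ->
  n%:R%:E * \int[mu]_x (f x)%:E <= (n%:R * P f + M)%:E /\
    (n%:R * P f)%:E <= n%:R%:E * \int[mu]_x (f x)%:E + M%:E.
  move=> n0.
  pose N := (Num.truncn (n%:R * B)).+1.
  have NB : (n%:R * B <= N%:R)%R by apply/ltW/truncnS_gt.
  pose g k x := layer (n%:R * f x) k.
  pose V k : set G := [set x | k%:R < n%:R * f x]%R.
  have nfc : cc_pos (fun x => n%:R * f x)%R by exact: cc_posZ.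
  have Vo k : open (V k).
    apply: (@open_comp _ _ (fun x => n%:R * f x)%R [set r | k%:R < r]%R).
      by move=> x _; exact: nfc.1.1.
    exact: open_gt.
  have gcc k : cc_pos (g k).
    split=> [|x]; last by have /andP[] := layer01 (n%:R * f x)%R k.
    apply: (cc_le fcc) => [x|x fx]; last by rewrite /g fx mulr0 layer0.
    apply: (continuous_min _ (@cst_continuous _ R^o 1%R x)).
    apply: (continuous_max _ (@cst_continuous _ R^o 0%R x)).
    apply: cvgB; last exact: cvg_cst.
    by apply: cvgM; [exact: cvg_cst|exact: fc].
  have gfam k : bumps (V k) (g k).
    split=> // x; first by have /andP[] := layer01 (n%:R * f x)%R k.
    by move=> nV; apply: layer0; rewrite leNgt; exact/negP.
  have gV k x : V k.+1 x -> g k x = 1%R by move=> /ltW; exact: layer1.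
  have Pg_ub k : (P (g k) <= open_content P (V k))%R
    by exact: (open_content_ub PM).
  have Pg_lb k : (open_content P (V k.+1) <= P (g k))%R.
    apply: open_content_le => l [lc l1 lV]; apply: (positive_mono PM) => // x.
    have [/gV -> //|/lV ->] := pselect (V k.+1 x).
    by have [_] := gcc k; exact.
  have mV k : measurable (V k : set (borel G)) by exact: open_borel.
  have mg k : measurable_fun [set: borel G] (g k : borel G -> R).
    by apply: continuous_borel; have [[]] := gcc k.
  have g0 k x : (0 <= g k x)%R by have [_] := gcc k; exact.
  have Ig_ub k : \int[mu]_x (g k x)%:E <= (open_content P (V k))%:E.
    rewrite -mu_open// -[leRHS]mul1e -integral_cst//=.
    rewrite [leRHS]integral_mkcond; apply: ge0_le_integral => //=.
    - by move=> x ?; exact: g0.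
    - by apply/measurable_EFinP; exact: mg.
    - apply/(measurable_restrictT _ _).1 => //; exact: measurable_cst.
    - move=> x ?; rewrite patchE; case: ifPn => [_|].
        by have [_ + _] := gfam k; apply.
      by move=> /negP nV; have [_ _ ->] := gfam k; rewrite // => Vx; apply: nV;
        rewrite inE.
  have Ig_lb k : (open_content P (V k.+1))%:E <= \int[mu]_x (g k x)%:E.
    rewrite -mu_open// -[leLHS]mul1e -integral_cst//=.
    rewrite [leLHS]integral_mkcond; apply: ge0_le_integral => //=.
    - by move=> x ?; rewrite patchE; case: ifP => // ?; exact: lee01.
    - apply/(measurable_restrictT _ _).1 => //; exact: measurable_cst.
    - by apply/measurable_EFinP; exact: mg.
    - move=> x ?; rewrite patchE; case: ifPn => [|_]; last exact: g0.
      by rewrite inE => /gV ->.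
  have gsum x : (\sum_(k < N) g k x = n%:R * f x)%R.
    rewrite layer_sum ?mulr_ge0//; apply/min_idPl; apply: le_trans NB.
    by rewrite ler_wpM2l// (le_trans (ler_norm _) (fB x)).
  have Psum : (n%:R * P f = \sum_(k < N) P (g k))%R.
    by rewrite -(positiveZ PM)// -(positive_sum PM)//; congr P;
      apply/funext => x; rewrite gsum.
  have Isum : n%:R%:E * \int[mu]_x (f x)%:E =
      \sum_(k < N) \int[mu]_x (g k x)%:E.
    rewrite -ge0_integralZl//=; last first.
    - by move=> x _; rewrite lee_fin.
    - by apply/measurable_EFinP; exact: continuous_borel.
    rewrite -(@ge0_integral_sum _ _ _ mu _ _ _ (fun (k : 'I_N) x =>
      (g k x)%:E))//.
    - by apply: eq_integral => x _; rewrite sumEFin gsum.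
    - by move=> k; apply/measurable_EFinP; exact: mg.
    - by move=> k x _; rewrite lee_fin.
  have tele : (\sum_(k < N) open_content P (V k) <=
      \sum_(k < N) open_content P (V k.+1) + M)%R.
    have V0M := open_content_leM PM (V 0%N).
    have VN0 := open_content_ge0 PM (V N).
    have shift (c : nat -> R) m :
        (\sum_(k < m) c k + c m = c 0%N + \sum_(k < m) c k.+1)%R.
      by elim: m => [|m IH];
        rewrite ?big_ord0 ?addr0 ?add0r// !big_ord_recr/= IH addrA.
    by have := shift (fun k => open_content P (V k)) N; lra.
  rewrite Isum Psum; split.
    apply: (@le_trans _ _ (\sum_(k < N) open_content P (V k))%:E).
      by rewrite -sumEFin; apply: lee_sum => k _.
    rewrite lee_fin; apply: le_trans tele _; rewrite lerD2r.
    by apply: ler_sum => k _.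
  apply: (@le_trans _ _ (\sum_(k < N) open_content P (V k))%:E).
    by rewrite lee_fin; apply: ler_sum => k _.
  apply: (@le_trans _ _ (\sum_(k < N) open_content P (V k.+1) + M)%:E).
    by rewrite lee_fin.
  by rewrite EFinD leeD2r// -sumEFin; apply: lee_sum => k _.
have Ifin : \int[mu]_x (f x)%:E \is a fin_num.
  rewrite ge0_fin_numE//; have [+ _] := key 1%N isT.
  by rewrite mul1e => /le_lt_trans; apply; exact: ltry.
move: key; rewrite -(fineK Ifin); set I := fine _ => key; congr EFin.
have {}key n : (0 < n)%N ->
  (n%:R * I <= n%:R * P f + M /\ n%:R * P f <= n%:R * I + M)%R.
  by move=> /key; rewrite -!EFinM -!EFinD !lee_fin.
apply/eqP; rewrite -subr_eq0 -normr_le0; apply/ler_addgt0Pl => e e0;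
  rewrite addr0.
pose n := (Num.truncn (M / e)).+1.
have nM : (M <= n%:R * e)%R.
  by rewrite -ler_pdivrMr//; apply/ltW/truncnS_gt.
have n0 : (0 < n%:R :> R)%R by rewrite ltr0n.
have [k1 k2] := key n isT.
rewrite -(ler_pM2l n0) -[X in (X * `|_|)%R]gtr0_norm// -normrM mulrBr ler_norml.
by apply/andP; split; lra.
Qed.

End riesz_representation.

(** * Radon measures and differences of measures *)

Section radon_measures.
Variables (R : realType) (G : topologicalGroupType).
Hypothesis hausG : hausdorff_space G.
Local Open Scope ereal_scope.

Lemma compact_borel (K : set G) : compact K -> measurable (K : set (borel G)).
Proof. by move=> Kc; apply: closed_borel; exact: compact_closed. Qed.

Lemma radon_inner (mu : {finite_measure set (borel G) -> \bar R})
    (A : set (borel G)) (e : R) : radon_measure mu -> measurable A ->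
      (0 < e)%R ->
  exists K : set G, [/\ compact K, K `<=` A & mu (A `\` K) <= e%:E].
Proof.
move=> mur mA e0; have Afin : mu A \is a fin_num by exact: fin_num_measure.
have := mur A mA; set S := [set mu K | K in _] => AS.
have Sfin : ereal_sup S \is a fin_num by rewrite -AS.
have [_ [K [Kc KA] <-]] := ub_ereal_sup_adherent e0 Sfin.
rewrite -AS => lt; exists K; split=> //.
have Km := compact_borel Kc.
rewrite measureD//=; last by rewrite ltey_eq Afin.
rewrite setIidr// leeBlDr ?fin_num_measure// addeC -leeBlDr//.
exact: ltW.
Qed.

(** Two compact subsets, each nearly exhausting A for one of the measures, have a union that nearly
    exhausts A for [rho]. The application is to the total variation of [m1 - m2]. *)
Lemma radon_dominated (rho : {finite_measure set (borel G) -> \bar R})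
    (m1 m2 : {finite_measure set (borel G) -> \bar R}) :
  radon_measure m1 -> radon_measure m2 ->
  (forall A, measurable A -> rho A <= m1 A + m2 A) -> radon_measure rho.
Proof.
move=> r1 r2 rle A mA; apply/eqP; rewrite eq_le; apply/andP; split; last first.
  apply: ge_ereal_sup => _ [K [Kc KA] <-]; apply: le_measure; rewrite ?inE//.
  exact: compact_borel.
apply/lee_addgt0Pr => e e0; have e2 : (0 < e / 2)%R by rewrite divr_gt0.
have [K1 [K1c K1A K1e]] := radon_inner r1 mA e2.
have [K2 [K2c K2A K2e]] := radon_inner r2 mA e2.
have Kc : compact (K1 `|` K2) by exact: compactU.
have Km := compact_borel Kc.
have KA : K1 `|` K2 `<=` A by move=> x [/K1A|/K2A].
have mD : measurable (A `\` (K1 `|` K2)) by exact: measurableD.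
have AE : rho A = rho (K1 `|` K2) + rho (A `\` (K1 `|` K2)).
  by rewrite -measureU ?setDUK// setDIK.
rewrite [leLHS]AE leeD//; first by apply: ereal_sup_ubound; exists (K1 `|` K2).
apply: (le_trans (rle _ mD)); rewrite [e]splitr EFinD leeD//.
  apply: le_trans K1e; apply: le_measure; rewrite ?inE//.
    by apply: measurableD => //; exact: compact_borel.
  by apply: setDS; exact: subsetUl.
apply: le_trans K2e; apply: le_measure; rewrite ?inE//.
  by apply: measurableD => //; exact: compact_borel.
by apply: setDS; exact: subsetUr.
Qed.

End radon_measures.

Section luc_integral.
Variables (R : realType) (G : topologicalGroupType).
Implicit Types (rho : {finite_measure set (borel G) -> \bar R}) (f g : G -> R).

Lemma bounded_continuous_integrable rho f : continuous f ->
  (exists M, forall x, `|f x| <= M) ->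
    rho.-integrable setT (EFin \o (f : borel G -> R)).
Proof.
move=> fc [M fM]; apply: measurable_bounded_integrable => //.
- by rewrite ltey_eq fin_num_measure.
- exact: continuous_borel.
- by exists M; split=> [|r Mr x _];
    [exact: num_real|exact: le_trans (fM x) (ltW Mr)].
Qed.

Lemma bounded_Rintegral rho (E : set (borel G)) f M : measurable E ->
  continuous f -> (exists M', forall x, `|f x| <= M') ->
  (forall x, E x -> `|f x| <= M) ->
    `|\int[rho]_(x in E) f x| <= M * fine (rho E).
Proof.
move=> mE fc fb fM.
have fi : rho.-integrable E (EFin \o (f : borel G -> R)).
  apply: (integrableS measurableT) => //.
  exact: bounded_continuous_integrable.
apply: le_trans (le_normr_Rintegral mE fi) _.
rewrite -(Rintegral_cst rho mE)//.
apply: le_Rintegral => //; first exact: integrable_norm.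
exact: finite_measure_integrable_cst.
Qed.

End luc_integral.

Section charge_difference.
Variables (R : realType) (G : topologicalGroupType).
Hypothesis hausG : hausdorff_space G.
Variables (m1 m2 : {finite_measure set (borel G) -> \bar R}).

Definition measure_diff : {charge set (borel G) -> \bar R} :=
  cadd (charge_of_finite_measure m1) (copp (charge_of_finite_measure m2)).

Local Open Scope ereal_scope.

Lemma measure_diffE A : measure_diff A = m1 A - m2 A.
Proof. by []. Qed.

Let pv := positive_variation measure_diff.
Let nv := negative_variation measure_diff.

(** The Jordan parts of [m1 - m2] need not be [m1] and [m2]; this balance of sums of measures
    carries integrals from one pair to the other. *)
Lemma measure_diff_variations A : measurable A -> pv A + m2 A = nv A + m1 A.
Proof.
move=> mA; have := jordan_decomp (hahn_setsP measure_diff) mA.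
rewrite measure_diffE /cadd/= /cscale/=.
rewrite -[jordan_pos _ A]/(pv A) -[jordan_neg _ A]/(nv A).
rewrite -(fineK (fin_num_measure m1 _ mA)) -(fineK (fin_num_measure m2 _ mA)).
rewrite -(fineK (fin_num_measure pv _ mA)) -(fineK (fin_num_measure nv _ mA)).
by rewrite -!EFinM -!EFinD => -[E]; congr EFin; lra.
Qed.

Lemma measure_diff_total_variation A : measurable A ->
  Defs.total_variation measure_diff A <= m1 A + m2 A.
Proof.
move=> mA; have [[mP _] [mN _] _ _] := hahn_setsP measure_diff.
have mAP := measurableI _ _ mA mP; have mAN := measurableI _ _ mA mN.
rewrite /Defs.total_variation /charge_variation/= leeD//.
  rewrite jordan_posE cjordan_posE /crestr0 mem_set// /crestr measure_diffE.
  apply: (@le_trans _ _ (m1 (A `&` (hahn_sets measure_diff).1))).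
    by rewrite leeBlDr ?fin_num_measure// leeDl.
  by apply: le_measure; rewrite ?inE.
rewrite jordan_negE cjordan_negE /crestr0 mem_set// /crestr measure_diffE.
rewrite fin_num_oppeB ?fin_num_measure// addeC.
apply: (@le_trans _ _ (m2 (A `&` (hahn_sets measure_diff).2))).
  by rewrite leeBlDr ?fin_num_measure// leeDl.
by apply: le_measure; rewrite ?inE.
Qed.

Lemma measure_diff_radon : radon_measure m1 -> radon_measure m2 ->
  signed_radon_measure measure_diff.
Proof.
move=> r1 r2.
have fin : fin_num_fun (Defs.total_variation measure_diff).
  by move=> A mA; rewrite fin_numD !fin_num_measure.
pose rho : {finite_measure set (borel G) -> \bar R} :=
  HB.pack (Measure.sort (Defs.total_variation measure_diff))
    (Measure.class (Defs.total_variation measure_diff))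
    (Measure_isFinite.Build _ _ _ (Defs.total_variation measure_diff) fin).
exact: (@radon_dominated _ _ hausG rho m1 m2 r1 r2
  measure_diff_total_variation).
Qed.

Lemma measure_diff_integral (f : G -> R) : continuous f ->
  (exists M, forall x, `|f x| <= M)%R ->
  charge_integral measure_diff f = (\int[m1]_x f x - \int[m2]_x f x)%R.
Proof.
move=> fc fb; have fi rho := @bounded_continuous_integrable R G rho f fc fb.
have : \int[measure_add pv m2]_x (f x)%:E = \int[measure_add nv m1]_x (f x)%:E.
  apply: eq_measure_integral => A mA _; transitivity (pv A + m2 A).
    exact: measure_addE.
  by rewrite measure_diff_variations//; exact/esym/measure_addE.
rewrite !(integral_measure_add _ (fi _) (fi _))//.
have E (rho : {finite_measure set (borel G) -> \bar R}) :
  \int[rho]_x (f x)%:E = (\int[rho]_x f x)%R%:E.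
  by rewrite /Rintegral fineK//;
    exact: (integrable_fin_num measurableT (fi rho)).
rewrite !E -!EFinD => -[EE]; rewrite /charge_integral.
rewrite -/pv -/nv; lra.
Qed.

End charge_difference.

(** * Positive parts of functionals and the representation of m *)

Section jordan_functional.
Variables (X : topologicalType) (R : realType).
Implicit Types (f g h : X -> R) (L : (X -> R) -> R).

Record cc_functional L (M : R) : Prop := CcFunctional {
  cc_functionalD : forall f g, cc f -> cc g ->
    L (fun x => f x + g x) = L f + L g ;
  cc_functionalZ : forall a f, cc f -> L (fun x => a * f x) = a * L f ;
  cc_functional_le : forall f, cc f -> (forall x, `|f x| <= 1) -> L f <= M
}.

(** The Riesz--Kantorovich formula for the positive part of [L], meant for nonnegative f. *)
Definition lpos L f :=
  sup [set L h | h in [set h | cc_pos h /\ forall x, h x <= f x]].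

Section lpos.
Variables (L : (X -> R) -> R) (M : R).
Hypothesis LM : cc_functional L M.

Lemma cc_functional0 : L (fun=> 0) = 0.
Proof.
have := cc_functionalZ LM 0 (@cc0 X R).
by under eq_fun do rewrite mul0r; rewrite mul0r.
Qed.

Lemma lpos_has_sup f : cc_pos f ->
  has_sup [set L h | h in [set h | cc_pos h /\ forall x, h x <= f x]].
Proof.
move=> [fc f0]; split; first by exists (L (fun=> 0)), (fun=> 0) => //;
  split=> //; exact: cc_pos0.
have [B fB] := cc_bounded fc; pose b := `|B| + 1.
have b0 : 0 < b by rewrite ltr_wpDl.
exists (b * M) => _ [h [[hc h0] hf] <-].
have -> : h = (fun x => b * (b^-1 * h x)).
  by apply/funext => x; rewrite mulVKf// gt_eqF.
have hbc : cc (fun x => b^-1 * h x) by exact: ccZ.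
rewrite (cc_functionalZ LM _ hbc) ler_pM2l//; apply: (cc_functional_le LM) =>
  // x.
rewrite ger0_norm; last by rewrite mulr_ge0// invr_ge0 ltW.
rewrite mulrC ler_pdivrMr// mul1r (le_trans (hf x))// (le_trans (ler_norm _))//.
by rewrite (le_trans (fB x))// (le_trans (ler_norm _))// lerDl.
Qed.

Lemma lpos_ub f h : cc_pos f -> cc_pos h -> (forall x, h x <= f x) ->
  L h <= lpos L f.
Proof.
by move=> fc hc hf; apply: ub_le_sup; [exact: (lpos_has_sup fc).2|exists h].
Qed.

Lemma lpos_le f a : cc_pos f ->
  (forall h, cc_pos h -> (forall x, h x <= f x) -> L h <= a) -> lpos L f <= a.
Proof.
by move=> fc H; apply: ge_sup => [|_ [h [hc hf] <-]];
  [exact: (lpos_has_sup fc).1|exact: H].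
Qed.

Lemma lpos_positive : bounded_positive (lpos L) M.
Proof.
split.
- by move=> f fc; rewrite -cc_functional0; apply: lpos_ub => //;
    [exact: cc_pos0|exact: fc.2].
- move=> f g fc gc; have fgc := cc_posD fc gc.
  apply/eqP; rewrite eq_le; apply/andP; split.
    (* Riesz decomposition: [h <= f + g] splits as [min h f] and
       [h - min h f]. *)
    apply: lpos_le => // h hc hfg.
    pose h1 x := Num.min (h x) (f x); pose h2 x := h x - h1 x.
    have h1c : cc_pos h1.
      split=> [|x]; first by apply: cc_min; [exact: hc.1|exact: fc.1].
      by rewrite le_min hc.2 fc.2.
    have h2c : cc_pos h2.
      split=> [|x]; first by apply: ccB; [exact: hc.1|exact: h1c.1].
      by rewrite subr_ge0 /h1 ge_min lexx.
    have -> : h = (fun x => h1 x + h2 x) by apply/funext => x;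
      rewrite addrC subrK.
    rewrite (cc_functionalD LM h1c.1 h2c.1) lerD//; apply: lpos_ub => // x.
      by rewrite /h1 ge_min lexx orbT.
    rewrite /h2 /h1 lerBlDr minEle; case: ifP => _; first by rewrite lerDr gc.2.
    by rewrite addrC.
  rewrite -lerBrDr; apply: lpos_le => // h1 h1c h1f;
    rewrite lerBrDr addrC -lerBrDr.
  apply: lpos_le => // h2 h2c h2g;
    rewrite lerBrDr -(cc_functionalD LM h2c.1 h1c.1).
  apply: lpos_ub => //; first exact: cc_posD.
  by move=> x; rewrite addrC lerD.
- have scale_le a f : 0 < a -> cc_pos f ->
    a * lpos L f <= lpos L (fun x => a * f x).
    move=> a0 fc; have afc := cc_posZ (ltW a0) fc.
    rewrite -ler_pdivlMl//; apply: lpos_le => // h hc hf.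
    rewrite ler_pdivlMl// -(cc_functionalZ LM _ hc.1); apply: lpos_ub => //.
      by apply: cc_posZ => //; exact: ltW.
    by move=> x; rewrite ler_pM2l.
  move=> a f; rewrite le_eqVlt => /orP[/eqP <- fc|a0 fc].
    under eq_fun do rewrite mul0r; rewrite mul0r; apply/eqP; rewrite eq_le.
    apply/andP; split.
      apply: lpos_le => [|h [_ h0] hle]; first exact: cc_pos0.
      rewrite (_ : h = fun=> 0) ?cc_functional0//; apply/funext => x; apply/eqP.
      by rewrite eq_le h0 hle.
    by rewrite -[leLHS]cc_functional0; apply: lpos_ub => //; exact: cc_pos0.
  apply/eqP; rewrite eq_le scale_le// andbT -ler_pdivrMl//.
  have afc := cc_posZ (ltW a0) fc.
  have ai0 : 0 < a^-1 by rewrite invr_gt0.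
  apply: le_trans (scale_le _ _ ai0 afc) _; rewrite (_ : (fun x => _) = f)//.
  by apply/funext => x; rewrite mulKf// gt_eqF.
- move=> f fc f1; apply: lpos_le => // h hc hf; apply: (cc_functional_le LM) =>
    [|x].
    exact: hc.1.
  by rewrite ger0_norm ?hc.2// (le_trans (hf x)).
Qed.

End lpos.

(** The map from h to f - h permutes the functions between 0 and f, and L(f - h) = L f - L h turns
    one supremum into the other. *)
Lemma lpos_diff L M f : cc_functional L M -> cc_functional (fun g => - L g) M ->
  cc_pos f -> L f = lpos L f - lpos (fun g => - L g) f.
Proof.
move=> LM LM' fc.
have swap h : cc_pos h -> (forall x, h x <= f x) ->
    [/\ cc_pos (fun x => f x - h x), forall x, f x - h x <= f x &
        L (fun x => f x - h x) = L f - L h].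
  move=> hc hf; have fhc : cc_pos (fun x => f x - h x).
    by split=> [|x]; [apply: ccB; [exact: fc.1|exact: hc.1]|rewrite subr_ge0].
  split=> // [x|]; first by rewrite gerBl hc.2.
  have := cc_functionalD LM fhc.1 hc.1.
  by under eq_fun do rewrite subrK; move=> ->; rewrite addrK.
apply/eqP; rewrite eq_le; apply/andP; split.
  rewrite lerBrDr addrC -lerBrDr;
    apply: (lpos_le LM') => // h hc /(swap _ hc)[fhc fh E].
  by rewrite lerBrDr addrC -E; exact: (lpos_ub LM).
rewrite lerBlDr; apply: (lpos_le LM) => // h hc /(swap _ hc)[fhc fh E].
by have := lpos_ub LM' fc fhc fh; rewrite E; lra.
Qed.

End jordan_functional.

Section finite_copy.
Context d (T : measurableType d) (R : realType).
Variable mu : {measure set T -> \bar R}.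

(** The alias takes the proof of finiteness as an argument, so that the finite measure structure can
    be attached to it. *)
Definition finite_copy of fin_num_fun mu : set T -> \bar R := mu.

Variable fin : fin_num_fun mu.
HB.instance Definition _ := Measure.copy (finite_copy fin) mu.
HB.instance Definition _ := Measure_isFinite.Build _ _ _ (finite_copy fin) fin.

End finite_copy.

Section luc_representation.
Variables (R : realType) (G : topologicalGroupType).
Hypotheses (lcG : locally_compact [set: G]) (hausG : hausdorff_space G).

Lemma luc_bounded_continuous (f : luc R G) :
  continuous (f : G -> R) /\ exists M, forall x, `|f x| <= M.
Proof.
by split; [exact: luc_continuous (lucP f)|
  have [[? ?] _] := (luc_near _).1 (lucP f); eexists].
Qed.

Section charge_functional.
Variable nu : {charge set (borel G) -> \bar R}.

Definition charge_fun (f : luc R G) : R^o := charge_integral nu f.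

Lemma charge_fun_linear : linear charge_fun.
Proof.
move=> a f g; rewrite /charge_fun /charge_integral.
have [fc fb] := luc_bounded_continuous f.
have [gc gb] := luc_bounded_continuous g.
have E (rho : {finite_measure set (borel G) -> \bar R}) :
    \int[rho]_x (a *: f + g) x = a * \int[rho]_x f x + \int[rho]_x g x.
  have fi := bounded_continuous_integrable rho fc fb.
  have gi := bounded_continuous_integrable rho gc gb.
  rewrite -RintegralZl// -RintegralD//.
  exact: (integrableZl measurableT a fi).
by rewrite !E/= -[a *: _]/(a * _) mulrBr; lra.
Qed.

HB.instance Definition _ :=
  GRing.isLinear.Build R (luc R G) R^o _ charge_fun charge_fun_linear.

Lemma charge_fun_continuous : continuous charge_fun.
Proof.
apply/linear_bounded_continuous/linear_boundedP.
pose B := fine (positive_variation nu setT) + fine (negative_variation nu setT).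
exists B; split; first exact: num_real.
move=> r Br f; rewrite /charge_fun /charge_integral.
have [fc fb] := luc_bounded_continuous f.
have le (rho : {finite_measure set (borel G) -> \bar R}) :=
  bounded_Rintegral rho measurableT fc fb (fun x _ => luc_normP f x).
apply: le_trans (ler_normB _ _) _.
apply: (@le_trans _ _ (B * `|f|)); last by rewrite ler_wpM2r// ltW.
by rewrite mulrC mulrDr lerD// le.
Qed.

Definition charge_functional : luc_dual R G := LucDual charge_fun_continuous.

End charge_functional.

Lemma riesz_luc (m : luc_dual R G) : exists2 m0, Mt R G m0 &
  forall f : luc R G, cc (f : G -> R) -> m f = m0 f.
Proof.
have [M M0 mM] := luc_dual_bound m.
(* The Riesz theorem above is about functionals on all functions. The default 0 outside LUC(G) is
   harmless, since compactly supported continuous functions belong to LUC(G). *)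
pose L (f : G -> R) : R :=
  if pselect (is_luc (f : G -> R^o)) is left fl
  then m (Luc (asboolT fl)) else 0.
have LE (f : luc R G) : L f = m f.
  rewrite /L; case: pselect => [fl|]; last by have := lucP f.
  by congr (m _); exact: val_inj.
have LE' f (fc : cc f) : exists2 fl : luc R G, (fl : G -> R) = f & L f = m fl.
  pose fl : luc R G := Luc (asboolT (cc_luc fc)).
  by exists fl => //; rewrite -LE.
have L_funct (s : R) : `|s| = 1 -> cc_functional (fun f => s * L f) M.
  move=> s1; split.
  - move=> f g fc gc; have [fl fE ->] := LE' f fc; have [gl gE ->] := LE' g gc.
    have -> : (fun x => f x + g x) = (fl + gl : luc R G) :> (G -> R).
      by apply/funext => x; rewrite -fE -gE.
    by rewrite LE linearD mulrDr.
  - move=> a f fc; have [fl fE ->] := LE' f fc.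
    have -> : (fun x => a * f x) = (a *: fl : luc R G) :> (G -> R).
      by apply/funext => x; rewrite -fE.
    by rewrite LE linearZ mulrCA.
  - move=> f fc f1; have [fl fE ->] := LE' f fc.
    apply: le_trans (ler_norm _) _; rewrite normrM s1 mul1r.
    apply: (le_trans (mM _)); rewrite ger_pMr//; apply: luc_norm_le => x.
    by rewrite fE.
have LM : cc_functional L M.
  by have := L_funct 1 (normr1 _); under eq_fun do rewrite mul1r.
have LM' : cc_functional (fun f => - L f) M.
  have := L_funct (-1); rewrite normrN normr1 => /(_ erefl).
  by under eq_fun do rewrite mulN1r.
have finite (P : (G -> R) -> R) : bounded_positive P M ->
    exists mu : {finite_measure set (borel G) -> \bar R}, radon_measure mu /\
      forall f, cc_pos f -> \int[mu]_x f x = P f.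
  move=> PM; have [mu [muM mu_open mu_outer]] :=
    riesz_measure_exists lcG hausG PM.
  have fin : fin_num_fun mu.
    move=> A mA; rewrite ge0_fin_numE//; apply: le_lt_trans (ltry M).
    by apply: le_trans muM; apply: le_measure; rewrite ?inE.
  exists (finite_copy fin); split;
    first exact: (riesz_radon hausG PM mu_open mu_outer).
  by move=> f fc; rewrite /Rintegral (riesz_integral PM mu_open).
have [m1 [r1 i1]] := finite _ (lpos_positive LM).
have [m2 [r2 i2]] := finite _ (lpos_positive LM').
exists (charge_functional (measure_diff m1 m2)).
  by exists (measure_diff m1 m2) => //; exact: measure_diff_radon.
move=> f fc; have [fcont fb] := luc_bounded_continuous f.
pose fp x := Num.max (f x : R) 0; pose fn x := Num.max (- f x : R) 0.
have fpc : cc_pos fp.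
  split=> [|x]; last by rewrite le_max lexx orbT.
  by apply: cc_max => //; exact: cc0.
have fnc : cc_pos fn.
  split=> [|x]; last by rewrite le_max lexx orbT.
  apply: cc_max; last exact: cc0.
  by have := ccZ (-1) fc; under eq_fun do rewrite mulN1r.
have fE : f = (fun x => fp x + -1 * fn x) :> (G -> R).
  apply/funext => x; rewrite /fp /fn mulN1r !maxEle.
  by case: ifP => h1; case: ifP => h2; lra.
rewrite -LE fE (cc_functionalD LM fpc.1 (ccZ _ fnc.1))
  (cc_functionalZ LM _ fnc.1).
rewrite (lpos_diff LM LM' fpc) (lpos_diff LM LM' fnc) -!i1// -!i2//.
rewrite /= /charge_fun measure_diff_integral//.
have Ef (rho : {finite_measure set (borel G) -> \bar R}) :
    \int[rho]_x f x = \int[rho]_x fp x - \int[rho]_x fn x.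
  have fpi := bounded_continuous_integrable rho fpc.1.1 (cc_bounded fpc.1).
  have fni := bounded_continuous_integrable rho fnc.1.1 (cc_bounded fnc.1).
  rewrite -RintegralB//; apply: eq_Rintegral => x _.
  by rewrite fE mulN1r.
by rewrite !Ef; lra.
Qed.

End luc_representation.

(** * Averages of translates *)

Section dirac_dual.
Variables (R : realType) (G : topologicalGroupType).

Definition dirac_fun (y : G) (f : luc R G) : R^o := f y.

Lemma dirac_linear y : linear (dirac_fun y). Proof. by []. Qed.

HB.instance Definition _ y :=
  GRing.isLinear.Build R (luc R G) R^o _ (dirac_fun y) (dirac_linear y).

Lemma dirac_continuous y : continuous (dirac_fun y).
Proof.
apply/linear_bounded_continuous/linear_boundedP; exists 1; split=> // r r1 f.
by rewrite (@le_trans _ _ `|f|)//; [exact: luc_normP|rewrite ler_peMl// ltW].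
Qed.

Definition dirac_dual (y : G) : luc_dual R G := LucDual (@dirac_continuous y).

Lemma left_translate_norm_near (f : luc R G) x (e : R) : 0 < e ->
  \forall y \near x, `|left_translate f y - left_translate f x| <= e.
Proof.
move=> e0; have [_ /(_ _ e0)] := (luc_near _).1 (lucP f).
move=> /(nbhs1_div x); apply: filterS => y /= fe; apply: luc_norm_le => z /=.
by have := fe (x * z)%g; rewrite mulgA mulgVK => /ltW.
Qed.

End dirac_dual.

Section tight_average.
Variables (R : realType) (G : topologicalGroupType).
Hypothesis hausG : hausdorff_space G.
Variable rho : {finite_measure set (borel G) -> \bar R}.
Hypothesis rho_tight : forall e : R, 0 < e ->
  exists2 K : set G, compact K & (rho (~` K) <= e%:E)%E.
Variable f : luc R G.

Definition dual_bound (n : luc_dual R G) (C : R) :=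
  0 <= C /\ forall h : luc R G, `|n h| <= C * `|h|.

Let F (n : luc_dual R G) x : R := luc_dual_slice n f x.

Let Fi n (E : set (borel G)) : measurable E ->
  rho.-integrable E (EFin \o (F n : borel G -> R)).
Proof.
move=> mE; apply: (integrableS measurableT) => //.
by have [? ?] := luc_bounded_continuous (luc_dual_slice n f);
  exact: bounded_continuous_integrable.
Qed.

Let piece (d : R) x :=
  interior [set y | `|left_translate f y - left_translate f x| <= d].

(** A Riemann sum of the norm continuous map from x to [left_translate f x], one value per piece
    weighted by its mass. The point is that [u] does not depend on [n]. *)
Let average_on (d : R) (s : seq G) (E : set (borel G)) : measurable E ->
  (forall y, E y -> exists2 x, x \in s & piece d x y) ->
  exists u : luc R G, forall n C, dual_bound n C ->
    `|\int[rho]_(x in E) F n x - n u| <= d * C * fine (rho E).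
Proof.
elim: s E => [|x s IH] E mE EU.
  exists 0 => n C _; rewrite linear0 subr0.
  have -> : E = set0 by rewrite -subset0 => y /EU[].
  by rewrite Rintegral_set0 normr0 measure0 mulr0.
pose V : set (borel G) := piece d x.
have mV : measurable V by apply: open_borel; exact: open_interior.
have mEV := measurableI _ _ mE mV; have mED := measurableD mE mV.
have [y [Ey nVy]|u uP] := IH _ mED.
  have [z + zy] := EU y Ey; rewrite inE => /orP[/eqP zx|zs]; last by exists z.
  by exfalso; apply: nVy; rewrite /V -zx.
pose c := fine (rho (E `&` V)).
exists (c *: left_translate f x + u) => n C nC; have [C0 nle] := nC.
have EE : E = (E `&` V) `|` (E `\` V) by rewrite setUIDK.
have mu_split : fine (rho E) = c + fine (rho (E `\` V)).
  rewrite {1}EE measureU//; first by rewrite fineD ?fin_num_measure.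
  by rewrite setDE setIACA setICr setI0.
have int_split : \int[rho]_(y in E) F n y =
    \int[rho]_(y in E `&` V) F n y + \int[rho]_(y in E `\` V) F n y.
  rewrite {1}EE Rintegral_setU//; first by rewrite -EE; exact: Fi.
  by apply/disj_setPS => y [[_ Vy] [_ nVy]].
have EV : `|\int[rho]_(y in E `&` V) F n y - c * n (left_translate f x)| <=
    d * C * c.
  have -> : c * n (left_translate f x) =
      \int[rho]_(y in E `&` V) (n (left_translate f x) : R).
    by rewrite Rintegral_cst// mulrC.
  rewrite -RintegralB//; [|exact: Fi|exact: finite_measure_integrable_cst].
  have [sc [sM sb]] := luc_bounded_continuous (luc_dual_slice n f).
  apply: bounded_Rintegral => //.
  - by move=> y; apply: cvgB; [exact: sc|exact: cvg_cst].
  - exists (sM + `|n (left_translate f x)|) => y.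
    by apply: le_trans (ler_normB _ _) _; rewrite lerD2r; exact: sb.
  - move=> y [_ /interior_subset/= Vy]; rewrite /F /= -linearB.
    by rewrite (le_trans (nle _))// mulrC ler_wpM2r.
have -> : n (c *: left_translate f x + u) = c * n (left_translate f x) + n u.
  by rewrite linearD linearZ.
rewrite int_split mu_split mulrDr.
apply: le_trans (lerD EV (uP n C nC)); rewrite (le_trans _ (ler_normD _ _))//.
by rewrite opprD addrACA.
Qed.

Lemma approx_average (e : R) : 0 < e -> exists u : luc R G,
  forall n C, dual_bound n C -> `|\int[rho]_x F n x - n u| <= e * C.
Proof.
move=> e0; pose N := `|f| + 1; pose M := fine (rho setT) + 1.
have M0 : 0 < M by rewrite ltr_wpDl// fine_ge0.
have N0 : 0 < N by rewrite ltr_wpDl.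
(* [d] is the oscillation allowed on [K], whose mass is at most [M]; [d'] bounds the mass off [K],
   where the integrand is at most [C * N]. *)
pose d := e / 2 / M; pose d' := e / 2 / N.
have d0 : 0 < d by rewrite !divr_gt0.
have d'0 : 0 < d' by rewrite !divr_gt0.
have [K Kc rhoK] := rho_tight d'0.
have mK : measurable (K : set (borel G)) by exact: compact_borel.
have mCK := measurableC mK.
have [s sK] : exists s : seq G,
    forall y, K y -> exists2 x, x \in s & piece d x y.
  apply: compact_seq_cover => // x _; apply: open_nbhs_nbhs.
  by split; [exact: open_interior|exact: left_translate_norm_near].
have [u uP] := average_on mK sK.
exists u => n C nC; have [C0 nle] := nC.
have F_bound x : `|F n x| <= C * N.
  rewrite (le_trans (nle _))// ler_wpM2l//; apply: luc_norm_le => y.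
  by rewrite (le_trans (luc_normP f _))// /N -luc_normE lerDl.
have KCK : [set: borel G] = K `|` ~` K by rewrite setUv.
have -> : \int[rho]_x F n x =
    \int[rho]_(x in K) F n x + \int[rho]_(x in ~` K) F n x.
  rewrite KCK Rintegral_setU//; first by rewrite -KCK; exact: Fi.
  by apply/disj_setPS => y [].
have [sc sb] := luc_bounded_continuous (luc_dual_slice n f).
have b2 : `|\int[rho]_(x in ~` K) F n x| <= e / 2 * C.
  apply: le_trans (bounded_Rintegral rho mCK sc sb (fun x _ => F_bound x)) _.
  have dN : d' * N = e / 2 by rewrite divfK ?gt_eqF.
  have -> : e / 2 * C = C * N * d' by rewrite -dN mulrC [d' * N]mulrC mulrA.
  rewrite ler_wpM2l ?mulr_ge0 ?(ltW N0)//.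
  by rewrite -lee_fin fineK ?fin_num_measure.
have b1 : `|\int[rho]_(x in K) F n x - n u| <= e / 2 * C.
  apply: le_trans (uP n C nC) _; rewrite mulrAC ler_wpM2r//.
  rewrite /d -[leRHS](divfK (lt0r_neq0 M0)) ler_wpM2l ?(ltW d0)//.
  rewrite /M (@le_trans _ _ (fine (rho setT)))// ?lerDl//.
  apply: fine_le; rewrite ?fin_num_measure//.
  by apply: le_measure; rewrite ?inE.
rewrite addrAC (le_trans (ler_normD _ _))//.
by rewrite [e]splitr mulrDl lerD.
Qed.

(** Dirac functionals dictate g(y), the integral of f(x y) in x. They all have bound 1, so the
    Riemann sums converge to g uniformly; hence g is in LUC(G), and any [n] passes to the limit. *)
Lemma average_exists : exists g : luc R G, forall n : luc_dual R G,
  \int[rho]_x luc_dual_slice n f x = n g.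
Proof.
pose gf y := \int[rho]_x F (dirac_dual R y) x.
have dirac_bound y : dual_bound (dirac_dual R y) 1.
  by split=> // h; rewrite mul1r; exact: luc_normP.
have gf_approx (e : R) : 0 < e -> exists u : luc R G,
    (forall n C, dual_bound n C -> `|\int[rho]_x F n x - n u| <= e * C) /\
    forall y, `|gf y - u y| <= e.
  move=> /approx_average[u uP]; exists u; split=> // y.
  by rewrite (le_trans (uP _ _ (dirac_bound y)))// mulr1.
have gluc : is_luc (gf : G -> R^o).
  apply/luc_near; split.
    have [u [_ uP]] := gf_approx 1 ltr01; exists (`|u| + 1) => y.
    have := uP y; have := luc_normP u y; rewrite -luc_normE => u1 u2.
    rewrite -[gf y](subrK (u y)) (le_trans (ler_normD _ _))// addrC.
    by rewrite lerD.
  move=> e e0; have e3 : 0 < e / 3 by rewrite divr_gt0.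
  have [u [_ uP]] := gf_approx _ e3.
  have [_ /(_ _ e3)] := (luc_near _).1 (lucP u); apply: filterS => v uv x.
  have := uP (v * x)%g; have := uP x; have := uv x.
  rewrite ltr_norml !ler_norml ltr_norml => /andP[? ?] /andP[? ?] /andP[? ?].
  by apply/andP; split; lra.
exists (Luc (asboolT gluc)) => n; set g := Luc _.
have [C C0 nC] := luc_dual_bound n.
have nCb : dual_bound n C by split=> //; exact: ltW.
apply/eqP; rewrite -subr_eq0 -normr_le0; apply/ler_addgt0Pl => e e0;
  rewrite addr0.
have e' : 0 < e / 2 / C by rewrite !divr_gt0.
have [u [uP ug]] := gf_approx _ e'.
rewrite -[X in X - _](subrK (n u)) -addrA -linearB.
rewrite (le_trans (ler_normD _ _))// [leRHS]splitr lerD//.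
  by rewrite (le_trans (uP _ _ nCb))// divfK// gt_eqF.
rewrite (le_trans (nC _))// -ler_pdivlMl// mulrC; apply: luc_norm_le => y /=.
by rewrite distrC; exact: ug.
Qed.

End tight_average.

Section Mt_Lambda.
Variables (R : realType) (G : topologicalGroupType).
Hypothesis hausG : hausdorff_space G.

Lemma Mt_slice (m : luc_dual R G) : Mt R G m -> forall f : luc R G,
  exists g : luc R G, forall n, m (luc_dual_slice n f) = n g.
Proof.
move=> [nu nur mE] f.
have tight (rho : {finite_measure set (borel G) -> \bar R}) :
    (forall A, measurable A -> (rho A <= Defs.total_variation nu A)%E) ->
    forall e : R, 0 < e -> exists2 K : set G, compact K &
      (rho (~` K) <= e%:E)%E.
  move=> rle e e0.
  have fin : fin_num_fun (Defs.total_variation nu).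
    by move=> A mA; rewrite fin_numD !fin_num_measure.
  have [K [Kc _ Ke]] :=
    radon_inner hausG (mu := finite_copy fin) nur measurableT e0.
  exists K => //; apply: le_trans Ke; rewrite setTD; apply: rle.
  by apply: measurableC; exact: compact_borel.
have [|g1 g1E] := @average_exists R G hausG (positive_variation nu) _ f.
  by apply: tight => A mA; rewrite leeDl.
have [|g2 g2E] := @average_exists R G hausG (negative_variation nu) _ f.
  by apply: tight => A mA; rewrite leeDr.
by exists (g1 - g2) => n; rewrite mE /charge_integral g1E g2E linearB.
Qed.

End Mt_Lambda.

(** * Uniform partitions of unity *)

Section uniform_partition.
Variables (R : realType) (G : topologicalGroupType).
Hypotheses (lcG : locally_compact [set: G]) (hausG : hausdorff_space G).

(** [r A] is to be the sum of the members with index in A, and [s x] lists indices that decide its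
    value at x. Continuity is uniform in A because a single function will later be glued from many
    [r A]. *)
Record uniform_partition (T : set G) (K : set G) (s : G -> seq T)
    (r : (T -> bool) -> G -> R) : Prop := UniformPartition {
  partition_compact : compact K ;
  partition01 : forall A x, 0 <= r A x <= 1 ;
  partition_near : forall e : R, 0 < e ->
    nbhs (1 : G)%g [set u | forall A x, `|r A (u * x)%g - r A x| < e] ;
  partitionD : forall (A B : T -> bool) x, (forall i, A i -> ~~ B i) ->
    r (fun i => A i || B i) x = r A x + r B x ;
  partitionT : forall x, r xpredT x = 1 ;
  partition_local : forall (A B : T -> bool) x, {in s x, A =1 B} ->
    r A x = r B x ;
  partition_support : forall (A : T -> bool) x, r A x != 0 ->
    exists2 i, A i & K (x * (val i)^-1)%g ;
  partition_cover : forall x, exists i : T, K (x * (val i)^-1)%g ;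
  partition_finite : forall (C : set G) x, compact C ->
    finite_set [set i : T | C (val i * x^-1)%g]
}.

(** Symmetry makes [1 <= phi (t * t'^-1)] a symmetric relation of closeness; the value 2 at the unit
    keeps phi above the threshold 1 nearby. *)
Lemma symmetric_bump : exists phi : G -> R,
  [/\ cc phi, forall x, 0 <= phi x, phi 1%g = 2 &
    forall x, phi (x^-1)%g = phi x].
Proof.
have [p [pc p01 p1 _]] := cc_urysohn R lcG hausG (@openT G) (I : [set: G] 1%g).
exists (fun x => p x + p (x^-1)%g); split.
- apply: ccD => //; have [pcont [K Kc K0]] := pc; split.
    move=> x; apply: (@continuous_comp _ _ _ (fun x : G => (x^-1)%g) p).
      exact: invg_continuous.
    exact: pcont.
  exists ((fun x : G => (x^-1)%g) @` K).
    apply: continuous_compact => //; apply: continuous_subspaceT.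
    exact: invg_continuous.
  by move=> x nKx; apply: K0 => Kx; apply: nKx; exists (x^-1)%g => //;
    rewrite invgK.
- by move=> x; have /andP[? _] := p01 x; have /andP[? _] := p01 (x^-1)%g;
    exact: addr_ge0.
- by rewrite invg1 p1.
- by move=> x; rewrite invgK addrC.
Qed.

Variable phi : G -> R.
Hypotheses (phic : cc phi) (phi0 : forall x, 0 <= phi x) (phi1 : phi 1%g = 2)
  (phiV : forall x, phi (x^-1)%g = phi x).

Lemma maximal_separated : exists T : set G,
  (forall t t', T t -> T t' -> t <> t' -> phi (t * t'^-1)%g < 1) /\
  forall x, exists2 t, T t & 1 <= phi (x * t^-1)%g.
Proof.
pose P : set (set G) := [set T | forall t t', T t -> T t' -> t <> t' ->
  phi (t * t'^-1)%g < 1].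
have [|T [TP Tmax]] := @Zorn_bigcup _ P.
  move=> F FP Ft t t' [X FX Xt] [Y FY Yt'].
  have [XY|YX] := Ft _ _ FX FY; [exact: (FP _ FY t t' (XY _ Xt) Yt')|].
  exact: (FP _ FX t t' Xt (YX _ Yt')).
exists T; split=> // x; apply: contrapT => nx.
have xT t : T t -> phi (x * t^-1)%g < 1.
  by move=> Tt; rewrite ltNge; apply/negP => ?; apply: nx; exists t.
have nTx : ~ T x by move=> /xT; rewrite mulgV phi1 => ?; lra.
apply: (Tmax (T `|` [set x])).
  by split=> [|TT]; [exact: subsetUl|apply: nTx; apply: TT; right].
move=> t t' [Tt|->] [Tt'|->] // tt'.
- exact: TP.
- by rewrite -phiV invgM invgK; exact: xT.
- exact: xT.
Qed.

Variable T : set G.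
Hypothesis Tsep : forall t t', T t -> T t' -> t <> t' -> phi (t * t'^-1)%g < 1.
Hypothesis Tcov : forall x, exists2 t, T t & 1 <= phi (x * t^-1)%g.

(** Cover [C] by translates of a set [W] such that phi >= 1 on quotients of its elements: after
    translation by [x^-1], distinct points of [T] never share one of them. The cover depends on [C]
    alone, so the bound is uniform in x. *)
Lemma separated_bound (C : set G) : compact C -> exists N : nat,
  forall x (l : seq T), uniq l -> (forall i, i \in l -> C (val i * x^-1)%g) ->
  (size l <= N)%N.
Proof.
move=> Cc.
have [W W1 WW] : exists2 W : set G, nbhs (1 : G)%g W &
    forall w w', W w -> W w' -> 1 <= phi (w * w'^-1)%g.
  have cont : {for ((1 : G)%g, (1 : G)%g),
      continuous (fun p : G * G => phi (p.1 * p.2^-1)%g)}.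
    apply: (@continuous_comp _ _ _ (fun p : G * G => (p.1 * p.2^-1)%g) phi).
      apply: (@continuous_comp _ _ _ (fun p : G * G => (p.1, p.2^-1)%g)
        (fun p : G * G => (p.1 * p.2)%g)); last exact: mulg_continuous.
      apply: cvg_pair; first exact: cvg_fst.
      apply: (@continuous_comp _ _ _ snd (fun x : G => (x^-1)%g)).
        exact: cvg_snd.
      exact: invg_continuous.
    exact: phic.1.
  have /(@cvgrPdist_lt _ R^o)/(_ 1 ltr01) := cont.
  rewrite /= invg1 mulg1 phi1 => -[[A B] /= [A1 B1] AB].
  exists (A `&` B) => [|w w' [Aw _] [_ Bw']]; first exact: filterI.
  have /= := AB (w, w') (conj Aw Bw'); rewrite ltr_norml => /andP[_ ?]; lra.
have [cs csP] := compact_seq_cover Cc (fun c _ => nbhs1_div c W1).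
exists (size cs) => x l ul lC.
have /choice[c cP] : forall i : T, exists c : G, i \in l ->
    c \in cs /\ W (val i * x^-1 * c^-1)%g.
  move=> i; have [il|] := boolP (i \in l); last by exists 1%g.
  by have [c ? ?] := csP _ (lC i il); exists c.
rewrite -(size_map c); apply: uniq_leq_size.
  rewrite map_inj_in_uniq// => i j il jl cij; apply/val_inj;
    apply: contrapT => ij.
  have [_ Wi] := cP i il; have [_ Wj] := cP j jl.
  have := WW _ _ Wi Wj; rewrite cij !invgM !invgK !mulgA mulgVK mulgVK.
  by rewrite leNgt Tsep//; exact/set_mem/valP.
by move=> _ /mapP[i il ->]; have [] := cP i il.
Qed.

Lemma separated_finite (C : set G) x : compact C ->
  finite_set [set i : T | C (val i * x^-1)%g].
Proof.
move=> Cc; have [N NP] := separated_bound Cc.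
apply: contrapT => /(@infinite_set_fset _ _ N.+1)[X XC].
rewrite ltnNge => /negP; apply; apply: (NP x) => [|i iX];
  first exact: finmap.fset_uniq.
exact: (XC i).
Qed.

Let w (i : T) x := phi (x * (val i)^-1)%g.

Let supp : exists K, exists N : nat, exists s : G -> seq T, [/\ compact K,
  forall x i, w i x != 0 -> K (x * (val i)^-1)%g &
  forall x, [/\ uniq (s x), (size (s x) <= N)%N & forall i, w i x != 0 ->
    i \in s x]].
Proof.
have [_ [K Kc K0]] := phic; have wK x i : w i x != 0 -> K (x * (val i)^-1)%g.
  by move=> w0; apply: contrapT => /K0 wx; move: w0; rewrite /w wx eqxx.
have wK' x i : w i x != 0 -> K (val i * x^-1)%g.
  move=> w0; apply: contrapT => /K0 wx; move: w0.
  by rewrite /w -phiV invgM invgK wx eqxx.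
have [N NP] := separated_bound Kc.
have /choice[s sP] : forall x,
    exists l : seq T, uniq l /\ forall i, (i \in l) = (w i x != 0).
  move=> x; have fin : finite_set [set i | w i x != 0].
    by apply: sub_finite_set (separated_finite x Kc) => i; exact: wK'.
  have /finite_seqP[l lE] := fin; exists (undup l); split;
    first exact: undup_uniq.
  move=> i; rewrite mem_undup; apply/idP/idP => [il|wi].
    by have : [set` l] i by []; rewrite -lE.
  by have : [set i | w i x != 0] i by []; rewrite lE.
exists K, N, s; split=> // x; have [us sE] := sP x; split=> //.
  by apply: (NP x) => // i; rewrite sE; exact: wK'.
by move=> i; rewrite sE.
Qed.

Lemma uniform_partition_exists :
  exists K (s : G -> seq T) r, uniform_partition K s r.
Proof.
have [K [N [s [Kc wK sP]]]] := supp.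
pose S (A : T -> bool) x := \sum_(i <- s x | A i) w i x.
have SE (A : T -> bool) x (l : seq T) : uniq l ->
  (forall i, w i x != 0 -> i \in l) ->
    S A x = \sum_(i <- l | A i) w i x.
  move=> ul lP; have [us _ sxP] := sP x.
  have supE (l' : seq T) : \sum_(i <- l' | A i) w i x =
      \sum_(i <- [seq i <- l' | w i x != 0] | A i) w i x.
    rewrite big_filter_cond [RHS]big_mkcond [LHS]big_mkcond.
    apply: eq_bigr => i _; case: eqVneq => [->|] /=; first by case: ifP.
    by [].
  rewrite /S supE [RHS]supE; apply: perm_big; apply: uniq_perm.
  - exact: filter_uniq.
  - exact: filter_uniq.
  - move=> i; rewrite !mem_filter; have [//|w0] := eqVneq (w i x) 0.
    by rewrite sxP// lP.
have w0 i x : 0 <= w i x by exact: phi0.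
have S_ge0 A x : 0 <= S A x by apply: sumr_ge0.
have S_leT A x : S A x <= S xpredT x.
  rewrite /S [leLHS]big_mkcond/=; apply: ler_sum => i _.
  by case: ifP.
have ST1 x : 1 <= S xpredT x.
  have [t Tt xt] := Tcov x; pose i : T := exist _ t (mem_set Tt).
  have [us _ sxP] := sP x.
  have is_ : i \in s x by apply: sxP; rewrite gt_eqF// (lt_le_trans ltr01).
  rewrite /S (bigD1_seq i)//= (le_trans xt)// lerDl sumr_ge0//.
have S_near (e : R) : 0 < e -> nbhs (1 : G)%g [set u | forall A x,
    `|S A (u * x)%g - S A x| < e].
  (* At most [N + N] indices are active at [x] or [u * x]; the successor makes the final inequality
     strict. *)
  move=> e0; pose d := e / (N + N).+1%:R.
  have d0 : 0 < d by rewrite divr_gt0.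
  have [_ /(_ _ d0)] := (luc_near phi).1 (cc_luc phic).
  apply: filterS => u phiu A x.
  have [u1 z1 s1] := sP (u * x)%g; have [u2 z2 s2] := sP x.
  pose l := undup (s (u * x)%g ++ s x).
  rewrite (SE A _ l (undup_uniq _)); last first.
    by move=> i /s1 ?; rewrite mem_undup mem_cat; apply/orP; left.
  rewrite (SE A x l (undup_uniq _)); last first.
    by move=> i /s2 ?; rewrite mem_undup mem_cat; apply/orP; right.
  rewrite -sumrB; apply: le_lt_trans (ler_norm_sum _ _ _) _.
  apply: (@le_lt_trans _ _ (\sum_(i <- l) d)).
    rewrite big_mkcond/=; apply: ler_sum => i _; case: ifP => _;
      last exact: ltW.
    by rewrite /w -mulgA ltW.
  rewrite big_const_seq count_predT iter_addr_0 -mulr_natl.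
  have lN : (size l <= N + N)%N.
    by rewrite (leq_trans (size_undup _))// size_cat leq_add.
  rewrite /d mulrCA gtr_pMr// ltr_pdivrMr// mul1r ltr_nat ltnS//.
pose r A x := S A x / S xpredT x.
have ST0 x : 0 < S xpredT x by apply: lt_le_trans (ST1 x).
have r01 A x : 0 <= r A x <= 1.
  apply/andP; split; first by rewrite divr_ge0// ltW.
  by rewrite /r ler_pdivrMr// mul1r.
exists K, s, r; split=> //.
- move=> e e0; have e2 : 0 < e / 2 by rewrite divr_gt0.
  apply: filterS (S_near _ e2) => u Su A x.
  have -> : r A (u * x)%g - r A x =
      (S xpredT (u * x)%g)^-1 * ((S A (u * x)%g - S A x) +
       r A x * (S xpredT x - S xpredT (u * x)%g)).
    rewrite /r; move: (ST0 x) (ST0 (u * x)%g) => /lt0r_neq0 ? /lt0r_neq0 ?.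
    by field; apply/andP.
  have /andP[ra rb] := r01 A x.
  rewrite normrM ger0_norm ?invr_ge0// mulrC ltr_pdivrMr//.
  apply: (@lt_le_trans _ _ e); last by rewrite ler_peMr// ltW.
  rewrite (le_lt_trans (ler_normD _ _))// [ltRHS]splitr ltr_leD//.
  rewrite normrM ger0_norm// distrC.
  by rewrite -[leRHS]mul1r ler_pM// ltW.
- move=> A B x AB; rewrite /r -mulrDl; congr (_ / _).
  rewrite /S [LHS]big_mkcond [X in _ = X + _]big_mkcond
    [X in _ = _ + X]big_mkcond/=.
  rewrite -big_split/=; apply: eq_bigr => i _.
  by have := AB i; case: (A i); case: (B i) => //=; rewrite ?addr0 ?add0r// =>
    /(_ isT).
- by move=> x; rewrite /r divff// gt_eqF.
- move=> A B x AB; rewrite /r; congr (_ / _);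
    rewrite /S big_seq_cond [RHS]big_seq_cond.
  by apply: eq_bigl => i; case: (boolP (i \in s x)) => //= /AB.
- move=> A x rA; have : S A x != 0.
    by apply: contra rA => /eqP SA; rewrite /r SA mul0r.
  move=> SA; apply: contrapT => nA; move: SA; rewrite /S big1 ?eqxx// => i Ai.
  by apply/eqP; apply: contrapT => /negP w1; apply: nA; exists i => //;
    exact: wK.
- move=> x; have [t Tt xt] := Tcov x; exists (exist _ t (mem_set Tt)).
  by apply: wK; rewrite gt_eqF// (lt_le_trans ltr01).
- by move=> C x; exact: separated_finite.
Qed.

End uniform_partition.

(** * Coding the finite parts of f in one function *)

Section coding.
Variables (R : realType) (G : topologicalGroupType).
Hypotheses (lcG : locally_compact [set: G]).
Variables (T K : set G) (s : G -> seq T) (r : (T -> bool) -> G -> R).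
Hypothesis part : uniform_partition K s r.
Variable f : luc R G.

Lemma partition_part_near (e : R) : 0 < e -> nbhs (1 : G)%g [set u |
  forall (A : T -> bool) x, `|f (u * x)%g * r A (u * x)%g - f x * r A x| < e].
Proof.
move=> e0; have [M fM] := (luc_bounded_continuous f).2.
have e2 : 0 < e / 2 by rewrite divr_gt0.
have M0 : 0 < M + 1 by rewrite ltr_wpDl// (le_trans _ (fM 1%g)).
have e2M : 0 < e / 2 / (M + 1) by rewrite divr_gt0.
have [_ /(_ _ e2) f1] := (luc_near _).1 (lucP f).
apply: filterS (filterI f1 (partition_near part e2M)) => u [fu ru] A x.
have -> : f (u * x)%g * r A (u * x)%g - f x * r A x =
    (f (u * x)%g - f x) * r A (u * x)%g + f x * (r A (u * x)%g - r A x) by ring.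
have /andP[r0 r1] := partition01 part A (u * x)%g.
rewrite (le_lt_trans (ler_normD _ _))// [ltRHS]splitr ltr_leD//.
  by rewrite normrM (ger0_norm r0) (le_lt_trans _ (fu x))// ler_piMr.
rewrite normrM -[leRHS](divfK (lt0r_neq0 M0)) mulrC.
rewrite ler_pM//; first exact: ltW (ru A x).
by rewrite (le_trans (fM x))// lerDl.
Qed.

Lemma partition_part_subproof (A : T -> bool) :
  (fun x => f x * r A x : R^o) \in @luc_pred R G.
Proof.
apply/asboolP/luc_near; have [M fM] := (luc_bounded_continuous f).2.
split.
  exists M => x; have /andP[r0 r1] := partition01 part A x.
  by rewrite normrM (ger0_norm r0) (le_trans _ (fM x))// ler_piMr.
by move=> e /partition_part_near; apply: filterS => u; apply.
Qed.

Definition partition_part (A : T -> bool) : luc R G :=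
  Luc (partition_part_subproof A).

Lemma partition_partD (A B : T -> bool) : (forall i, A i -> ~~ B i) ->
  partition_part (fun i => A i || B i) = partition_part A + partition_part B.
Proof.
move=> AB; apply/val_inj/funext => x /=.
by rewrite (partitionD part)// mulrDr.
Qed.

Lemma partition_partT : partition_part xpredT = f.
Proof. by apply/val_inj/funext => x /=; rewrite (partitionT part) mulr1. Qed.

Lemma partition_part_cc (l : seq T) (A : T -> bool) :
  (forall i, A i -> i \in l) ->
  cc (partition_part A : G -> R).
Proof.
move=> Al; split; first exact: (luc_bounded_continuous _).1.
have [L Lc LP] : exists2 L : set G, compact L &
    forall i x, i \in l -> K (x * (val i)^-1)%g -> L x.
  elim: l {Al} => [|j l [L Lc LP]]; first by exists set0 => //; exact: compact0.
  exists (L `|` (fun x : G => x * val j)%g @` K).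
    apply: compactU => //; apply: continuous_compact;
      last exact: partition_compact part.
    by apply: continuous_subspaceT; exact: mulgr_continuous.
  move=> i x; rewrite inE => /orP[/eqP -> Kx|il Kx]; last by left;
    apply: LP il Kx.
  by right; exists (x * (val j)^-1)%g => //; rewrite mulgVK.
exists L => // x nLx /=; have [->|rA] := eqVneq (r A x) 0;
  first by rewrite mulr0.
have [i Ai Ki] := partition_support part rA.
by exfalso; apply: nLx; exact: LP (Al i Ai) Ki.
Qed.

(** [d.1] is a window of indices and [d.2] selects within it. The window is recorded separately
    because indices of the window that are not selected must be reproduced too. *)
Let code (d : seq T * seq T) (i : T) := (i \in d.1) && (i \in d.2).

(* [K] is enlarged by a compact neighborhood of [1] so that distinct codes stay
   apart under small left translations; this makes the sum below uniformly
   continuous. *)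
Lemma coding_exists : infinite_set [set: T] ->
  exists (g : luc R G) (z : seq T * seq T -> G),
  forall d x i, i \in d.1 -> K (x * (val i)^-1)%g ->
    g (x * z d)%g = f x * r (code d) x.
Proof.
move=> Tinf; have [e ei] := seq_embeds Tinf.
have [e2 [_ e2i]] := infinite_square Tinf.
have [W0 W01 W0c] := lc_nbhs lcG (1%g : G).
pose K' := K `|` (fun p : G * G => (p.1 * p.2)%g) @` (W0 `*` K).
have K'c : compact K'.
  apply: compactU; first exact: partition_compact part.
  apply: continuous_compact; first by apply: continuous_subspaceT;
    exact: mulg_continuous.
  by apply: compact_setX => //; exact: partition_compact part.
(* The room of [d] placed at [z]: the translates of [K'] by the indices of the window, moved by [z].
   A conflict below is an overlap of two rooms. *)
pose inC (d : seq T * seq T) (z x : G) :=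
  exists2 t, t \in d.1 & K' (x * z^-1 * (val t)^-1)%g.
pose conflict d (i : T) d' (i' : T) :=
  exists x, inC d (val i) x /\ inC d' (val i') x.
have [||d d' i'|y yP] := @selection T Tinf (seq T * seq T)%type
    (fun d => e2 (e d.1) (e d.2)) conflict.
- by move=> [a b] [a' b'] /= /e2i[]// /ei -> /ei ->.
- by move=> d i d' i' [x [? ?]]; exists x.
(* A common point of two rooms has the form k t i = k' t' i' with k and k' in [K']. Then [i * i'^-1]
   lies in a compact set depending on t and t' only, which leaves finitely many i for a given i'. *)
- pose C (t t' : T) :=
    (fun p : G * G => (val t)^-1 * (p.1^-1 * p.2) * val t')%g @` (K' `*` K').
  have Cc (t t' : T) : compact (C t t').
    apply: continuous_compact; last exact: compact_setX.
    apply: continuous_subspaceT => p.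
    apply: (@continuous_comp _ _ _
      (fun p : G * G => ((val t)^-1 * (p.1^-1 * p.2))%g)
      (fun x : G => x * val t')%g); last exact: mulgr_continuous.
    apply: (@continuous_comp _ _ _ (fun p : G * G => (p.1^-1 * p.2)%g)
      (fun x : G => (val t)^-1 * x)%g); last exact: mulgl_continuous.
    apply: (@continuous_comp _ _ _ (fun p : G * G => (p.1^-1, p.2)%g)
      (fun p : G * G => (p.1 * p.2)%g)); last exact: mulg_continuous.
    apply: cvg_pair; last exact: cvg_snd.
    apply: (@continuous_comp _ _ _ fst (fun x : G => (x^-1)%g));
      first exact: cvg_fst.
    exact: invg_continuous.
  pose F (p : T * T) := [set i : T | C p.1 p.2 (val i * (val i')^-1)%g].
  apply: (@sub_finite_set _ _ (\bigcup_(p in [set` d.1] `*` [set` d'.1]) F p)).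
    move=> i [x [[t td Kt] [t' td' Kt']]]; exists (t, t') => //.
    exists ((x * (val i)^-1 * (val t)^-1)%g, (x * (val i')^-1 * (val t')^-1)%g)
      => //=.
    by rewrite !invgM !invgK !mulgA mulVg mul1g !mulgVK.
  apply: bigcup_finite; first by apply: finite_setX; exact: finite_seq.
  by move=> p _; exact: (partition_finite part (val i') (Cc p.1 p.2)).
pose z d := val (y d).
have inC_uniq d d' x : inC d (z d) x -> inC d' (z d') x -> d = d'.
  move=> xd xd'; apply: contrapT => dd'; apply: (yP d d' dd'); by exists x.
pose h d x := f x * r (code d) x.
have /choice[g gP] : forall x, exists v : R,
    (forall d, inC d (z d) x -> v = h d (x * (z d)^-1)%g) /\
    ((forall d, ~ inC d (z d) x) -> v = 0).
  move=> x; have [[d xd]|nd] := pselect (exists d, inC d (z d) x).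
    exists (h d (x * (z d)^-1)%g); split=> [d' xd'|/(_ d)//].
    by rewrite (inC_uniq _ _ _ xd xd').
  by exists 0; split=> // d xd; exfalso; apply: nd; exists d.
have h_supp d x : h d x != 0 -> exists2 i, i \in d.1 & K (x * (val i)^-1)%g.
  rewrite mulf_eq0 negb_or =>
    /andP[_ /(partition_support part)[i /andP[id _] Ki]].
  by exists i.
have stay u x : W0 u -> g x != 0 ->
    exists d, inC d (z d) x /\ inC d (z d) (u * x)%g.
  move=> W0u gx; have [gd gn] := gP x.
  have [d xd] : exists d, inC d (z d) x.
    by apply: contrapT => /forallNP/gn gx0; rewrite gx0 eqxx in gx.
  exists d; split=> //; have [i id Ki] : exists2 i, i \in d.1 &
    K (x * (z d)^-1 * (val i)^-1)%g.
    by apply: h_supp; rewrite -gd.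
  exists i => //; right; exists (u, x * (z d)^-1 * (val i)^-1)%g => //=.
  by rewrite !mulgA.
have gluc : is_luc (g : G -> R^o).
  apply/luc_near; split.
    have [M fM] := (luc_bounded_continuous f).2; exists M => x.
    have [gd gn] := gP x; have M0 : 0 <= M by apply: le_trans (fM 1%g).
    have [[d xd]|nd] := pselect (exists d, inC d (z d) x); last first.
      by rewrite gn ?normr0//; exact/forallNP.
    have /andP[r0 r1] := partition01 part (code d) (x * (z d)^-1)%g.
    rewrite (gd _ xd) /h normrM (ger0_norm r0).
    by rewrite (le_trans _ (fM (x * (z d)^-1)%g))// ler_piMr.
  move=> eps eps0; have hn := partition_part_near eps0.
  apply: filterS (filterI hn (filterI W01 (nbhs1_inv W01))) =>
    u [hu [Wu Wu']] x.
  have both d : inC d (z d) x -> inC d (z d) (u * x)%g ->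
    `|g (u * x)%g - g x| < eps.
    move=> xd uxd; rewrite ((gP x).1 d xd) ((gP (u * x)%g).1 d uxd) /h -mulgA.
    exact: hu.
  have [gx|/(stay u _ Wu)[d [xd uxd]]] := eqVneq (g x) 0;
    last exact: both xd uxd.
  have [gux|/(stay _ _ Wu')[d [uxd]]] := eqVneq (g (u * x)%g) 0.
    by rewrite gx gux subrr normr0.
  by rewrite mulKg => xd; exact: both xd uxd.
exists (Luc (asboolT gluc)), z => d x i id Ki /=.
have xd : inC d (z d) (x * z d)%g by exists i => //; rewrite mulgK; left.
by rewrite ((gP _).1 d xd) mulgK.
Qed.

End coding.

(** * CBP measurable functionals *)

(** Continuous maps carry points without disjoint neighborhoods to such points. The use is for
    subspaces of products, with the coordinates as maps. *)
Lemma hausdorff_separated (X : topologicalType) :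
  (forall p q : X, (forall (Y : topologicalType) (f : X -> Y),
    hausdorff_space Y ->
    continuous f -> f p = f q) -> p = q) -> hausdorff_space X.
Proof.
move=> H p q pq; apply: H => Y f Yh fc; apply: Yh => A B /fc fA /fc fB.
by have [x [Ax Bx]] := pq _ _ fA fB; exists (f x).
Qed.

Lemma compact_set_type (X : topologicalType) (C : set X) :
  compact C -> compact [set: C].
Proof.
move=> Cc F FF _; have FP : ProperFilter (val @ F) by exact: fmap_proper_filter.
have FC : (val @ F) C.
  by apply: (@filterS _ F _ setT) => [y _|];
    [exact/set_mem/(valP y)|exact: filterT].
have [x [Cx xcl]] := Cc _ FP FC.
exists (exist _ x (mem_set Cx)); split=> // A B FA [_ [[W Wo <-] Wx WB]].
have vA : (val @ F) [set val a | a in (A : set C)].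
  by apply: (@filterS _ F _ A) => // a Aa; exists a.
have [_ [[a Aa <-] Wa]] := xcl _ _ vA (open_nbhs_nbhs (conj Wo Wx)).
by exists a; split=> //; exact: WB.
Qed.

Lemma cube_compact (I : eqType) : compact [set: {ptws I -> bool}].
Proof.
have := @tychonoff I (fun=> bool : topologicalType)
  (fun=> setT) (fun=> bool_compact).
by rewrite (_ : [set f | _] = setT)//; apply/seteqP; split.
Qed.

Lemma closed_equalizer (X : topologicalType) (R : realType) (u v : X -> R^o) :
  continuous u -> continuous v -> closed [set x | u x = v x].
Proof.
move=> uc vc; rewrite (_ : [set x | _] = (fun x => u x - v x) @^-1` [set 0]).
  apply: preimage_closed; last exact: closed_eq.
  by move=> x _; apply: cvgB; [exact: uc|exact: vc].
by apply/seteqP; split=> x /= /eqP; rewrite ?subr_eq0 => /eqP // ->;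
  rewrite subrr.
Qed.

Lemma closed_linear_relation (X : topologicalType) (R : realType) (a : R)
    (u v w : X -> R^o) : continuous u -> continuous v -> continuous w ->
  closed [set x | u x = a * v x + w x].
Proof.
move=> uc vc wc; apply: closed_equalizer => // x.
by apply: cvgD; [apply: cvgM; [exact: cvg_cst|exact: vc]|exact: wc].
Qed.

Section dual_topology.
Variables (R : realType) (G : topologicalGroupType).

Lemma dual_eval_continuous (f : luc R G) :
  continuous (fun n : luc_dual R G => n f : R^o).
Proof.
move=> n; apply: (@continuous_comp _ _ _
  (fun m : luc_dual R G => (m : luc R G -> R^o) : {ptws luc R G -> R^o})
  (fun psi : {ptws luc R G -> R^o} => psi f)).
  exact: initial_continuous.
exact: (@proj_continuous _ (fun _ : luc R G => R^o) f).
Qed.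

(** The unit ball is described by bare functions, so that it sits in a product space. *)
Definition unit_dual (psi : luc R G -> R^o) :=
  (forall a f g, psi (a *: f + g) = a * psi f + psi g) /\
    forall f, `|psi f| <= `|f|.

Lemma unit_dualP psi : unit_dual psi ->
  exists n : luc_dual R G, (n : luc R G -> R^o) = psi.
Proof.
move=> [psiL psi1].
pose L : {linear luc R G -> R^o} := HB.pack psi
  (GRing.isLinear.Build R (luc R G) R^o _ psi psiL).
suff Lc : continuous L by exists (LucDual Lc).
apply/linear_bounded_continuous/linear_boundedP; exists 1; split=> // r r1 f.
by rewrite (le_trans (psi1 f))// ler_peMl// ltW.
Qed.

(** The Banach--Alaoglu theorem: linearity is a closed condition inside a product of compact
    intervals. *)
Lemma unit_dual_compact :
  compact [set psi : {ptws luc R G -> R^o} | unit_dual psi].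
Proof.
have proj_cont f : continuous (fun psi : {ptws luc R G -> R^o} => psi f).
  exact: (@proj_continuous _ (fun _ : luc R G => R^o) f).
have Pc : compact [set psi : {ptws luc R G -> R^o} |
    forall f, [set t : R^o | - `|f| <= t <= `|f|] (psi f)].
  apply: (@tychonoff (luc R G) (fun=> R^o : topologicalType)
    (fun f => [set t : R^o | - `|f| <= t <= `|f|])) => f.
  suff -> : [set t : R^o | - `|f| <= t <= `|f|] = `[- `|f|, `|f|]%classic.
    exact: segment_compact.
  by apply/seteqP; split=> t /=; rewrite in_itv.
rewrite (_ : [set psi | _] = [set psi : {ptws luc R G -> R^o} |
    forall f, [set t : R^o | - `|f| <= t <= `|f|] (psi f)] `&`
  \bigcap_(t in [set: R * luc R G * luc R G])
    [set psi | psi (t.1.1 *: t.1.2 + t.2) = t.1.1 * psi t.1.2 + psi t.2]).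
  apply: compact_closedI => //; apply: closed_bigI => -[[a f] g] _ /=.
  exact: closed_linear_relation (proj_cont (a *: f + g)) (proj_cont f)
    (proj_cont g).
apply/seteqP; split=> [psi [psiL psi1]|psi [psi1 psiL]].
  by split=> [f|[[a f] g] _ /=]; [rewrite /= -ler_norml|rewrite psiL].
split=> [a f g|f]; last by rewrite ler_norml; exact: psi1.
exact: (psiL (a, f, g)).
Qed.

End dual_topology.

Section noncompact.
Variables (R : realType) (G : topologicalGroupType).
Hypotheses (lcG : locally_compact [set: G]) (hausG : hausdorff_space G).
Variables (T K : set G) (s : G -> seq T) (r : (T -> bool) -> G -> R).
Hypothesis part : uniform_partition K s r.

(** At x only the finitely many coordinates in [s x] matter, so the value is locally constant. *)
Lemma partition_part_continuous (Y : topologicalType) (pi : Y -> T -> bool) :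
  (forall p i, \forall p' \near p, pi p' i = pi p i) ->
  forall (f : luc R G) x,
    continuous (fun p => partition_part part f (pi p) x : R^o).
Proof.
move=> pi_near f x p.
have ag : nbhs p [set p' | agree (s x) (pi p) (pi p')] by exact: agree_near.
have const : nbhs p [set p' | f x * r (pi p') x = f x * r (pi p) x].
  apply: filterS ag => p' pp' /=; congr (_ * _);
    apply: (partition_local part) => i ix.
  by rewrite pp'.
move=> B /nbhs_singleton Bp; apply: filterS const => p' /= E.
by rewrite /= E.
Qed.

Hypothesis Tinf : infinite_set [set: T].
Variables m m0 : luc_dual R G.
Hypothesis m_cbp : LambdaCBP [set: luc_dual R G] m.
Hypothesis m0_slice : forall f : luc R G, exists g : luc R G,
  forall n, m0 (luc_dual_slice n f) = n g.
Hypothesis mm0 : forall f : luc R G, cc (f : G -> R) -> m f = m0 f.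

Lemma cbp_singular_eq0 (f : luc R G) : m f = m0 f.
Proof.
have [g [z gz]] := coding_exists lcG part f Tinf.
have [g0 g0P] := m0_slice g.
pose h A := partition_part part f A.
pose mu (A : T -> bool) : R := m (h A) - m0 (h A).
suff : mu xpredT = 0.
  by rewrite /mu /h partition_partT => /eqP; rewrite subr_eq0 => /eqP.
pose X := ({ptws luc R G -> R^o} * {ptws T -> bool})%type.
have eval_cont f' : continuous (fun p : X => p.1 f').
  move=> p; apply: (@continuous_comp _ _ _ fst
    (fun psi : {ptws luc R G -> R^o} => psi f')).
    exact: cvg_fst.
  exact: (@proj_continuous _ (fun _ : luc R G => R^o) f').
have coord_cont i : continuous (fun p : X => p.2 i).
  move=> p; apply: (@continuous_comp _ _ _ snd
    (fun A : {ptws T -> bool} => A i)).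
    exact: cvg_snd.
  exact: (@proj_continuous _ (fun _ : T => bool) i).
have coord_near (p : X) i : \forall p' \near p, p'.2 i = p.2 i.
  by apply: (coord_cont i p [set p.2 i]); exact: discrete_set1.
pose Q : set X := ([set psi | unit_dual psi] `*` setT) `&`
  \bigcap_(x in [set: G]) [set p | p.1 (left_translate g x) = h p.2 x].
have hcont x : continuous (fun p : X => h p.2 x : R^o).
  exact: (@partition_part_continuous X (fun p => p.2) coord_near f x).
have Qc : compact Q.
  apply: compact_closedI.
    apply: compact_setX; first exact: unit_dual_compact.
    exact: cube_compact.
  apply: closed_bigI => x _.
  exact: closed_equalizer (eval_cont (left_translate g x)) (hcont x).
have Q_onto : onto_cube (fun p : X => p.2 : T -> bool) Q.
  (* For a window [F], the Dirac functional at the place of [d F] reads off the values of [h A] at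
     the points that the window serves; a cluster point along growing windows gets all of them. *)
  move=> A; pose d (F : seq T) : seq T * seq T := (F, [seq i <- F | A i]).
  pose psi F : {ptws luc R G -> R^o} := dirac_dual R (z (d F)) : luc R G -> R^o.
  pose Fil := filter_from [set: seq T] (fun F =>
    [set F' : seq T | {subset F <= F'}]).
  have FilP : ProperFilter Fil.
    apply: filter_from_proper => [|F _]; last by exists F.
    apply: filter_from_filter; first by exists [::].
    move=> F F' _ _; exists (F ++ F') => // t Ft.
    by split=> i iF; apply: Ft; rewrite mem_cat iF ?orbT.
  have psiP : ProperFilter (psi @ Fil) by exact: fmap_proper_filter.
  have [|n [nu ncl]] := @unit_dual_compact R G _ psiP.
    exists [::] => // F _; split=> [a f1 f2|f1] //.
    exact: luc_normP.
  exists (n, A) => //; split=> // x _ /=.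
  pose v := h A x.
  have closed_v :
      closed [set psi : {ptws luc R G -> R^o} | psi (left_translate g x) = v].
    apply: closed_equalizer; last exact: cst_continuous.
    exact: (@proj_continuous _ (fun _ : luc R G => R^o)).
  apply: closed_v; move: ncl; rewrite clusterE; apply.
  have [i0 Ki0] := partition_cover part x.
  (* [i0] puts x within reach of the window, and [s x] makes the code agree with A wherever [r]
     looks at x. *)
  exists (i0 :: s x) => // F sF /=.
  have psiE : psi F (left_translate g x) = g (x * z (d F))%g by [].
  rewrite psiE (gz (d F) x i0)//; last by apply: sF; rewrite inE eqxx.
  rewrite /v /=; congr (_ * _); apply: (partition_local part) => i isx.
  have iF : i \in F by apply: sF; rewrite inE isx orbT.
  by rewrite /= mem_filter iF andbT.
(* The Dirac functional at 1 is a default off the unit ball; points of [Q] never meet it. *)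
have /choice[dual dualP] : forall psi : luc R G -> R^o, exists n : luc_dual R G,
    unit_dual psi -> (n : luc R G -> R^o) = psi.
  move=> psi; have [/unit_dualP[n nE]|npsi] := pselect (unit_dual psi);
    first by exists n.
  by exists (dirac_dual R 1%g).
pose H (p : X) : R := convolution m (dual p.1) g.
pose c (p : X) : R := p.1 g0.
have HE (p : X) : Q p -> H p = mu p.2 + c p.
  move=> [[pd _] pQ]; have dE := dualP _ pd.
  have slE : luc_dual_slice (dual p.1) g = h p.2.
    apply/val_inj/funext => x /=; rewrite dE; exact: (pQ x I).
  by rewrite /H convolutionE slE /mu /c -dE -g0P slE subrK.
apply: (@additive_category X T (fun p => p.2) coord_near R mu Q H c) => //.
- move=> A B AB; rewrite /mu /h partition_partD//.
  have E (n : luc_dual R G) u v : n (u + v) = n u + n v :> R by rewrite linearD.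
  by rewrite !E; lra.
- move=> l A Al; rewrite /mu mm0 ?subrr//; exact: (partition_part_cc part f Al).
- exact: eval_cont.
move=> C CQ Cc O Oo; have [_ /(_ g O Oo)] := m_cbp.
pose phi (p : C) : [set: luc_dual R G] := exist _ (dual (val p).1) (mem_set I).
move=> /(_ (C : topologicalType) phi); apply.
- exact: compact_set_type.
- apply: hausdorff_separated => p q pq; apply/val_inj.
  have val_cont : continuous (val : C -> X) by exact: initial_continuous.
  have e1 : (val p).1 = (val q).1.
    apply/funext => f'; apply: (pq R^o (fun p : C => (val p).1 f')).
      exact: Rhausdorff.
    move=> t.
    exact: (@continuous_comp C X R^o val (fun p : X => p.1 f') t (@val_cont t)
      (@eval_cont f' (val t))).
  have e2 : (val p).2 = (val q).2.
    apply/funext => i; apply: (pq bool (fun p : C => (val p).2 i)).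
      exact: discrete_hausdorff.
    move=> t.
    exact: (@continuous_comp C X bool val (fun p : X => p.2 i) t (@val_cont t)
      (@coord_cont i (val t))).
  by rewrite (surjective_pairing (val p)) e1 e2 -surjective_pairing.
(* The target carries an initial topology twice, as a subspace and as a space of functions; after
   both reductions the map is the first projection on [C]. *)
- apply: continuous_comp_initial.
  apply: continuous_comp_initial.
  rewrite (_ : _ \o _ = fst \o (val : C -> X)); last first.
    apply/funext => p /=; apply: dualP.
    by have [[? _] _] := CQ _ (set_mem (valP p)).
  move=> t; apply: continuous_comp; last exact: cvg_fst.
  exact: initial_continuous.
Qed.

End noncompact.

Lemma open_baire_property (X : topologicalType) (U : set X) : open U ->
  baire_property U.
Proof.
move=> Uo; exists U => //; exists (fun=> set0).
  by move=> n; rewrite /nowhere_dense closure0 interior0.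
by rewrite setYK bigcup0.
Qed.

(** * The inclusions between the three sets *)

Section lambda.
Variables (R : realType) (G : topologicalGroupType).

Lemma Lambda_sub_LambdaCBP (S : set (luc_dual R G)) : Lambda S `<=` LambdaCBP S.
Proof.
move=> m [Sm mc]; split=> // f U Uo K phi _ _ phic; apply: open_baire_property.
apply: open_comp => [x _|]; first exact: phic.
by apply: open_comp => // x _; exact: mc.
Qed.

Lemma Mt_sub_Lambda : hausdorff_space G ->
  Mt R G `<=` Lambda [set: luc_dual R G].
Proof.
move=> hausG m mMt; split=> // f; have [g gP] := Mt_slice hausG mMt f.
have -> : (fun n : [set: luc_dual R G] => convolution m (val n) f) =
    (fun n : luc_dual R G => n g : R^o) \o val.
  by apply/funext => n; rewrite convolutionE gP.
move=> n; apply: (@continuous_comp [set: luc_dual R G] (luc_dual R G) R^o val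
  (fun n : luc_dual R G => n g)); first exact: initial_continuous.
exact: dual_eval_continuous.
Qed.

Lemma LambdaCBP_sub_Mt : hausdorff_space G -> locally_compact [set: G] ->
  LambdaCBP [set: luc_dual R G] `<=` Mt R G.
Proof.
move=> hausG lcG m m_cbp.
have [m0 m0Mt mm0] := riesz_luc lcG hausG m.
suff mE f : m f = m0 f.
  have [nu nur nuE] := m0Mt; exists nu => // f; by rewrite mE nuE.
have [phi [phic phi0 phi1 phiV]] := symmetric_bump R lcG hausG.
have [T [Tsep Tcov]] := maximal_separated phi1 phiV.
have [K [s [r part]]] := uniform_partition_exists phic phi0 phi1 phiV Tsep Tcov.
have [Tfin|Tinf] := pselect (finite_set [set: T]); last first.
  exact: (cbp_singular_eq0 lcG part Tinf m_cbp (Mt_slice hausG m0Mt) mm0).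
(* When [T] is finite, f is itself one of its finite parts, hence compactly supported, and [m0]
   agrees with [m] there by construction. *)
have /finite_seqP[l lE] := Tfin.
rewrite -(partition_partT part f); apply: mm0.
apply: (partition_part_cc part f (l := l)) => i _.
by have : [set: T] i by []; rewrite lE.
Qed.

End lambda.

Theorem corollary3p2 (R : realType) (G : topologicalGroupType)
    (hausG : hausdorff_space G) (lcG : locally_compact [set: G]) :
  Lambda [set: luc_dual R G] = LambdaCBP [set: luc_dual R G] /\
  LambdaCBP [set: luc_dual R G] = Mt R G.
Proof.
have M_L := @Mt_sub_Lambda R G hausG.
have L_C := @Lambda_sub_LambdaCBP R G setT.
have C_M := @LambdaCBP_sub_Mt R G hausG lcG.
by split; apply/seteqP; split=> // m; [move=> /C_M/M_L|move=> /M_L/L_C].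
Qed.
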